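(* Consider the following three hypotheses, in which $\delta\in(0,1]$ is a constant independent of $n$. (M) For some integer $K\ge 1$ there is a positive, strictly increasing sequence of constants $\{\beta_k\}_{k=1}^K$, independent of $n$, such that $\mathbb{E}\int|\hat f_n(x)-f(x)|^k\,\mathbf{P}_X(dx)\asymp n^{-\beta_k}$ for $k=1,\dots,K$. (S$_r$) (for a given integer $r\ge1$) There are sequences $a_{1n}=\delta^{-1}n^{-\gamma}$, for some $\gamma\in(0,(\beta_k-\beta_r)/k)$ with $k>r$, and $a_{2n}=\delta^{-1}\sqrt{\log(n)/n}$, such that, with $\mu=\mu_\alpha$, $$\delta<\inf_{|y|\le a_{1n},|x|\le a_{2n}}F_{|\epsilon|}'\big(F_{|\epsilon|}^{-1}(\mu+x)+y\big)\le\sup_{|y|\le a_{1n},|x|\le a_{2n}}F_{|\epsilon|}'\big(F_{|\epsilon|}^{-1}(\mu+x)+y\big)<\delta^{-1},$$ $$\sup_{|y|\le a_{1n},|x|\le a_{2n}}\big|F_{|\epsilon|}''\big(F_{|\epsilon|}^{-1}(\mu+x)+y\big)\big|<\delta^{-1},$$ $$\sup_{|y|\le a_{1n},|x|\le a_{2n}}\big|F_{|\epsilon|}''\big(F_{|\epsilon|}^{-1}(\mu+x)+y\big)-F_{|\epsilon|}''\big(F_{|\epsilon|}^{-1}(\mu)\big)\big|=o(1)\quad\text{as }n\to\infty.$$ (T) There is a constant $\beta_\epsilon>0$, independent of $n$, such that $F_\epsilon(-x)+(1-F_\epsilon(x))\le\delta^{-1}|x|^{-\beta_\epsilon}$ for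 all $x\ge\delta^{-1}$. Let $\beta_\epsilon>2/n_2$ and $\alpha\in\Big[\frac{\beta_\epsilon+1}{\beta_\epsilon(n_2+1)},\,1-\frac{1}{\beta_\epsilon(n_2+1)}\Big)$. Let $\hat{\mathcal L}$ be the length of the symmetric split conformal prediction interval. (a) Suppose (M), (S$_1$) and (T) hold. Then $$\mathbb{E}(\hat{\mathcal L})=2F_{|\epsilon|}^{-1}(\mu_\alpha)+2H_{|\epsilon|}\big(F_{|\epsilon|}^{-1}(\mu_\alpha)\big)\,\mathbb{E}\mathbb{E}_1(\hat\gamma_1(X))+\sigma_\alpha^2\,(F_{|\epsilon|}^{-1})''(\mu_\alpha)+o\Big(\frac1{n_1^{\beta_1}}+\frac1{n_2}\Big).$$ Furthermore, under (S$_2$) (in addition to (M) and (T)), $$\operatorname{Var}(\hat{\mathcal L})=4\Big\{H_{|\epsilon|}\big(F_{|\epsilon|}^{-1}(\mu_\alpha)\big)\Big\}^2\operatorname{Var}\mathbb{E}_1(\hat\gamma_1(X))+4\sigma_\alpha^2\Big\{(F_{|\epsilon|}^{-1})'(\mu_\alpha)\Big\}^2+o\Big(\frac1{n_1^{\beta_2}}+\frac1{n_2}\Big).$$ Here $H_{|\epsilon|}(a)=-\{F_\epsilon'(a)-F_\epsilon'(-a)\}/F_{|\epsilon|}'(a)$. (b) Suppose the distribution of $\epsilon$ is symmetric and (M), (S$_2$) and (T) hold. Then $$\mathbb{E}(\hat{\mathcal L})=2F_{|\epsilon|}^{-1}(\mu_\alpha)+2G_\epsilon\big(F_{|\epsilon|}^{-1}(\mu_\alpha)\big)\,\mathbb{E}\mathbb{E}_1(\hat\gamma_1^2(X))+\sigma_\alpha^2\,(F_{|\epsilon|}^{-1})''(\mu_\alpha)+o\Big(\frac1{n_1^{\beta_2}}+\frac1{n_2}\Big).$$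 Furthermore, under (S$_4$) (in addition to (M), (T) and symmetry of $\epsilon$), $$\operatorname{Var}(\hat{\mathcal L})=4\Big\{G_\epsilon\big(F_{|\epsilon|}^{-1}(\mu_\alpha)\big)\Big\}^2\operatorname{Var}\mathbb{E}_1(\hat\gamma_1^2(X))+4\sigma_\alpha^2\Big\{(F_{|\epsilon|}^{-1})'(\mu_\alpha)\Big\}^2+o\Big(\frac1{n_1^{\beta_4}}+\frac1{n_2}\Big).$$ Here $G_\epsilon(a)=-F_\epsilon''(a)/(2F_\epsilon'(a))$.
   Context: Setting. $(X_i,Y_i)_{i=1}^{n+1}$ is an i.i.d. sample from the regression model $Y=f(X)+\epsilon$, with $X\sim\mathbf{P}_X$ on $\mathcal X$, real-valued $\epsilon\sim F_\epsilon$ i.i.d. and independent of the covariates; $F_\epsilon$ also denotes the distribution function of $\epsilon$, and $F_{|\epsilon|}$ that of $|\epsilon|$. The first $n$ observations are divided into two disjoint parts: a proper training set $\mathcal D_1$ of size $n_1$ and a calibration set $\mathcal D_2$ of size $n_2=n-n_1$. For each sample size $m$, $\hat f_m$ denotes the regression estimator of $f$ fitted on $m$ observations; $\hat f_1\equiv\hat f_{n_1}$ is the estimator fitted on $\mathcal D_1$ only (so the subscript 1 is shorthand for $n_1$). Symmetric split conformal interval. Conformity scores are $\hat\epsilon_i=|Y_i-\hat f_1(X_i)|$, $i\in\mathcal D_2$. Let $\hat q$ be the $\lceil(n_2+1)(1-\alpha)\rceil$-th order statistic of $\{\hat\epsilon_i:i\in\mathcal D_2\}$. The interval is $[\hat f_1(X_{n+1})-\hat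 q,\ \hat f_1(X_{n+1})+\hat q]$ and its length is $\hat{\mathcal L}=2\hat q$. Notation. $m_\alpha=\lceil(n_2+1)(1-\alpha)\rceil$, $\mu_\alpha=m_\alpha/(n_2+1)$, $\sigma_\alpha^2=\mu_\alpha(1-\mu_\alpha)/(n_2+2)$. The estimation error is $\hat\gamma_1(x)=\hat f_{n_1}(x)-f(x)$, and $\hat\gamma_1^2(x)=(\hat\gamma_1(x))^2$. $\mathbb{E}_1$ and $\operatorname{Var}_1$ denote conditional expectation and variance given $\mathcal D_1$, where $X\sim\mathbf{P}_X$ is independent of $\mathcal D_1$; e.g. $\mathbb{E}_1(\hat\gamma_1^2(X))=\int(\hat f_{n_1}(x)-f(x))^2\,\mathbf{P}_X(dx)$. The outer $\mathbb{E}$ and $\operatorname{Var}$ in $\mathbb{E}\mathbb{E}_1(\cdot)$, $\operatorname{Var}\mathbb{E}_1(\cdot)$ are over $\mathcal D_1$. Primes denote derivatives; $g^{-1}$ is the inverse function of $g$, so $(F_{|\epsilon|}^{-1})'$, $(F_{|\epsilon|}^{-1})''$ are the first and second derivatives of the quantile function of $|\epsilon|$. For positive sequences, $a_n\asymp b_n$ means $a_n=O(b_n)$ and $b_n=O(a_n)$. The $o(\cdot)$ remainders in the expansions are understood as $n_1,n_2\to\infty$ with $n=n_1+n_2$.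
   Formalization: In (S_r), F_ε itself (not only F_{|ε|}) is also assumed twice differentiable at plus and minus the points of the window, since (a) fails if F_ε' jumps at the quantile; α is a fixed level and the conditions on α, β_ε and (S_r) are required for large n_1, n_2. *)

(* Defs.v *)
From HB Require Import structures.
From mathcomp Require Import all_boot all_order all_algebra perm.
From mathcomp Require Import all_classical all_reals all_analysis.

Set Implicit Arguments.
Unset Strict Implicit.
Unset Printing Implicit Defensive.

Import Order.TTheory GRing.Theory Num.Theory.
Import numFieldNormedType.Exports.

Local Open Scope ring_scope.
Local Open Scope classical_set_scope.

(* Mutual independence of the whole family (X_0, e_0, X_1, e_1, ...), with
   X_i ~ PX and e_i ~ Q.  The product rule on an arbitrary finite subfamily is
   the instance where the other A_i, B_i are the full sets. *)
Definition iid_sample (R : realType) d (T : measurableType d)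
    d' (W : measurableType d') (P : probability W R)
    (PX : probability T R) (Q : probability R R)
    (X : nat -> {RV P >-> T}) (e : nat -> {RV P >-> R}) : Prop :=
  [/\ forall i (A : set T), measurable A -> distribution P (X i) A = PX A,
      forall i (B : set R), measurable B -> distribution P (e i) B = Q B &
      forall (n : nat) (A : nat -> set T) (B : nat -> set R),
        (forall i, measurable (A i)) -> (forall i, measurable (B i)) ->
        P [set w | forall i, (i < n)%N -> A i (X i w) /\ B i (e i w)] =
        (\prod_(i < n) (P (X i @^-1` A i) * P (e i @^-1` B i)))%E].

Definition obs (R : realType) (T W : Type) (f : T -> R)
    (X : nat -> W -> T) (e : nat -> W -> R) (i : nat) (w : W) : T * R :=
  (X i w, f (X i w) + e i w).

(* An estimation procedure gives, for each m and each data set of size m, a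
   function on the covariate space. *)
Definition estimator (R : realType) (T : Type) :=
  forall m : nat, m.-tuple (T * R) -> T -> R.

Definition measurable_estimator (R : realType) d (T : measurableType d)
    (fhat : estimator R T) : Prop :=
  forall m, measurable_fun [set: m.-tuple (T * R)%type * T]
              (fun z : m.-tuple (T * R)%type * T => fhat m z.1 z.2).

(* A permutation s of the n1 + n2 indices encodes the split: the images of the
   first n1 indices form D_1, the images of the last n2 form D_2. *)
Definition splitting := forall n1 n2 : nat, {perm 'I_(n1 + n2)}.

Definition training (R : realType) (T W : Type) (Z : nat -> W -> T * R)
    (s : splitting) (n1 n2 : nat) (w : W) : n1.-tuple (T * R) :=
  [tuple Z (s n1 n2 (lshift n2 i)) w | i < n1].

Definition calibration (R : realType) (T W : Type) (Z : nat -> W -> T * R)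
    (s : splitting) (n1 n2 : nat) (w : W) : n2.-tuple (T * R) :=
  [tuple Z (s n1 n2 (rshift n1 i)) w | i < n2].

Definition m_alpha (R : realType) (alpha : R) (n2 : nat) : nat :=
  `|Num.ceil (n2.+1%:R * (1 - alpha))|%N.

Definition mu_alpha (R : realType) (alpha : R) (n2 : nat) : R :=
  (m_alpha alpha n2)%:R / n2.+1%:R.

Definition sigma2_alpha (R : realType) (alpha : R) (n2 : nat) : R :=
  mu_alpha alpha n2 * (1 - mu_alpha alpha n2) / n2.+2%:R.

Definition scores (R : realType) (T W : Type) (fhat : estimator R T)
    (Z : nat -> W -> T * R) (s : splitting) (n1 n2 : nat) (w : W) : seq R :=
  [seq `|z.2 - fhat n1 (training Z s n1 n2 w) z.1|
     | z <- calibration Z s n1 n2 w].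

(* Order statistics are numbered from 1, positions in a sequence from 0. *)
Definition qhat (R : realType) (T W : Type) (alpha : R) (fhat : estimator R T)
    (Z : nat -> W -> T * R) (s : splitting) (n1 n2 : nat) (w : W) : R :=
  nth 0 (sort <=%R (scores fhat Z s n1 n2 w)) (m_alpha alpha n2).-1.

(* The interval [fhat x - qhat, fhat x + qhat] has the same length at every x. *)
Definition split_length (R : realType) (T W : Type) (alpha : R)
    (fhat : estimator R T) (Z : nat -> W -> T * R) (s : splitting)
    (n1 n2 : nat) (w : W) : R :=
  2 * qhat alpha fhat Z s n1 n2 w.

(* E_1 (gammahat_1 (X) ^ r), as a random variable *)
Definition E1_error (R : realType) d (T : measurableType d) (W : Type)
    (PX : probability T R) (f : T -> R) (fhat : estimator R T)
    (Z : nat -> W -> T * R) (s : splitting) (r n1 n2 : nat) (w : W) : R :=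
  \int[PX]_x ((fhat n1 (training Z s n1 n2 w) x - f x) ^+ r).

Definition F_eps (R : realType) (Q : probability R R) (t : R) : R :=
  fine (Q `]-oo, t]).

Definition F_abs (R : realType) (Q : probability R R) (t : R) : R :=
  fine (Q [set u | `|u| <= t]).

Definition quantile (R : realType) (F : R -> R) (u : R) : R :=
  inf [set t | u <= F t].

Definition symmetric_law (R : realType) (Q : probability R R) : Prop :=
  forall A : set R, measurable A -> Q [set - u | u in A] = Q A.

Definition H_abs (R : realType) (Q : probability R R) (a : R) : R :=
  - (derive1 (F_eps Q) a - derive1 (F_eps Q) (- a)) / derive1 (F_abs Q) a.

Definition G_eps (R : realType) (Q : probability R R) (a : R) : R :=
  - derive1n 2 (F_eps Q) a / (2 * derive1 (F_eps Q) a).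

Definition asymp (R : realType) (a : nat -> \bar R) (b : nat -> R) : Prop :=
  (exists C : R, \forall n \near \oo, (a n <= (C * b n)%:E)%E) /\
  (exists C : R, \forall n \near \oo, ((b n)%:E <= C%:E * a n)%E).

(* beta k is only meaningful for 1 <= k <= K. *)
Definition cond_M (R : realType) d (T : measurableType d)
    d' (W : measurableType d') (P : probability W R) (PX : probability T R)
    (f : T -> R) (fhat : estimator R T) (Z : nat -> W -> T * R)
    (K : nat) (beta : nat -> R) : Prop :=
  [/\ (1 <= K)%N,
      forall k, (1 <= k <= K)%N -> 0 < beta k,
      forall j k, (1 <= j)%N -> (j < k)%N -> (k <= K)%N -> beta j < beta k &
      forall k, (1 <= k <= K)%N ->
        asymp
          (fun n => \int[P]_w \int[PX]_x
             (`|fhat n [tuple Z i w | i < n] x - f x| ^+ k)%:E)%E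
          (fun n => n%:R `^ (- beta k))].

Definition twice_derivable (R : realType) (F : R -> R) (t : R) : Prop :=
  (\forall u \near t, derivable F u 1) /\ derivable (derive1 F) t 1.

(* The points F_abs^{-1}(mu + x) + y with |y| <= a_{1n}, |x| <= a_{2n} *)
Definition window (R : realType) (Q : probability R R) (delta gamma mu : R)
    (n : nat) : set R :=
  [set t | exists x y : R,
     [/\ `|y| <= delta^-1 * n%:R `^ (- gamma),
         `|x| <= delta^-1 * Num.sqrt (ln n%:R / n%:R) &
         t = quantile (F_abs Q) (mu + x) + y]].

(* - The conditions hold for n1 and n2 large enough, with n = n1 + n2.
   - Suprema and infima are extended-real, so that they are not affected by the
     default value of the real sup and inf on unbounded sets.
   - derive1 is total, so existence of the derivatives is a separate clause.
     F_abs t = F_eps t - F_eps (- t), up to an atom at - t, and F_abs', F_abs''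
     are understood as coming from the derivatives of F_eps at t and - t, which
     also occur in H_abs and G_eps.  For a symmetric law the conditions on F_eps
     already follow from the one on F_abs. *)
Definition cond_S (R : realType) (Q : probability R R) (delta alpha : R)
    (K : nat) (beta : nat -> R) (r : nat) : Prop :=
  exists (k : nat) (gamma : R),
  let F := F_abs Q in
  let D n1 n2 := window Q delta gamma (mu_alpha alpha n2) (n1 + n2) in
  [/\ (r < k <= K)%N,
      0 < gamma < (beta k - beta r) / k%:R,
      \forall n1 \near \oo & n2 \near \oo, forall t, D n1 n2 t ->
        [/\ twice_derivable F t, twice_derivable (F_eps Q) t &
            twice_derivable (F_eps Q) (- t)],
      \forall n1 \near \oo & n2 \near \oo,
        [/\ (delta%:E < ereal_inf [set (derive1 F t)%:E | t in D n1 n2])%E,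
            (ereal_inf [set (derive1 F t)%:E | t in D n1 n2] <=
             ereal_sup [set (derive1 F t)%:E | t in D n1 n2])%E,
            (ereal_sup [set (derive1 F t)%:E | t in D n1 n2] < delta^-1%:E)%E &
            (ereal_sup [set `|derive1n 2 F t|%:E | t in D n1 n2]
             < delta^-1%:E)%E] &
      forall eta : R, 0 < eta -> \forall n1 \near \oo & n2 \near \oo,
        (ereal_sup [set `|derive1n 2 F t -
                          derive1n 2 F (quantile F (mu_alpha alpha n2))|%:E
                      | t in D n1 n2] <= eta%:E)%E].

Definition cond_T (R : realType) (Q : probability R R) (delta beta_eps : R)
  : Prop :=
  0 < beta_eps /\
  forall x : R, delta^-1 <= x ->
    F_eps Q (- x) + (1 - F_eps Q x) <= delta^-1 * `|x| `^ (- beta_eps).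

(* L = M + o(g) as n1, n2 -> oo, with M real-valued for n1, n2 large *)
Definition expands (R : realType) (L M : nat -> nat -> \bar R)
    (g : nat -> nat -> R) : Prop :=
  forall eta : R, 0 < eta -> \forall n1 \near \oo & n2 \near \oo,
    (M n1 n2 \is a fin_num) /\
    exists2 rem : R, `|rem| <= eta * g n1 n2 &
      L n1 n2 = (M n1 n2 + rem%:E)%E.

(* Main.v *)
Require Import Defs.
From HB Require Import structures.
From mathcomp Require Import all_boot all_order all_algebra perm.
From mathcomp Require Import all_classical all_reals all_analysis.
From mathcomp Require Import measurable_realfun.
From mathcomp Require Import zify ring lra.
Import Order.TTheory GRing.Theory Num.Theory.
Import numFieldNormedType.Exports.
Set Implicit Arguments.
Unset Strict Implicit.
Unset Printing Implicit Defensive.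
Local Open Scope ring_scope.
Local Open Scope classical_set_scope.

(** The length of the interval is twice an order statistic of the calibration
    scores. Conditionally on the training data the scores are i.i.d. with
    distribution function
      [Fh t = P (|epsilon - g X| <= t | training data)], [g = fhat - f],
    so their [m_alpha]-th order statistic is distributed as [Fh^-1 U], with [U] of
    law [Beta (m_alpha, n2 + 1 - m_alpha)] independent of the training data
    ([law_qhat]). Only the laws of the training error and of [U] matter from there
    on; the mean of [U] is [mu_alpha], its variance is [sigma2_alpha], and its
    fourth centred moment is of order [1 / n2 ^ 2].

    Shifting the noise by [g] changes [F] by [kappa * g ^ p] up to a smaller
    remainder: [p = 1] in general, and [p = 2] for a symmetric noise, for which the
    linear terms of the two endpoints cancel ([shift_expansion1],
    [shift_expansion2]). Averaged over the covariate, this gives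
    [Fh = F + kappa * m] near the quantile, with [m = E_1 (g ^ p)], up to
    [eta * E_1 |g| ^ p + C * E_1 |g| ^ k]; the last term comes from the points where
    the error is not small, and is of a smaller order as [k > p]. Inverting,
    [Fh^-1 u = F^-1 u - (kappa / F' (q)) * m] up to a remainder of the same form
    ([quantile_expand]). A Taylor expansion of [F^-1] at [mu_alpha] then yields the
    two expansions [quantile_second_order] (for the mean) and
    [quantile_first_order] (for the variance, with a bound on the square).

    These hold for [u] near [1 - alpha] and a small [E_1 |g| ^ k]. Elsewhere
    everything is bounded by [C * (1 - u) ^ - J * (1 + E_1 |g| ^ k)], thanks to the
    polynomial tail of the noise ([quantile_tail_bound]), and a constant is at most
    a multiple of [E_1 |g| ^ k + (u - (1 - alpha)) ^ 4]. The Beta law integrates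
    [(1 - u) ^ - J] uniformly in [n2] and keeps the fourth moment small with that
    weight ([betaP_tail_bounds]). Hence the remainders contribute at most
      [eta * (n1 ^ - beta_p + 1 / n2) + C * (n1 ^ - beta_k + 1 / n2 ^ 2)]
    for every [eta > 0], which is the announced [o].

    For the mean, the linear term in [U - mu_alpha] disappears and the quadratic one
    gives [sigma2_alpha * (F^-1)'' / 2]. For the variance, [U] and [m] are
    independent, so their variances add up, and the remainder enters through the
    Cauchy-Schwarz inequality ([mean_sqr_perturb]). *)

(** * Moments of Beta laws with integer parameters *)

(** With [s = a + b] and [p = a * b], the fourth centred moment of [Beta (a, b)]
    is [3 p (2 s ^ 2 + p (s - 6)) / (s ^ 4 (s + 1) (s + 2) (s + 3))]; this bounds it
    by [3 / s ^ 2]. *)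
Lemma fourth_moment_poly_ineq (R : realType) (s p : R) : 0 < s -> 0 < p -> p <= s ^+ 2 ->
  3 * p * (2 * s ^+ 2 + p * (s - 6)) <= 3 * s ^+ 2 * (s + 1) * (s + 2) * (s + 3).
Proof.
move=> s0 p0 ps.
have h1 : p * p * s <= s ^+ 2 * s ^+ 2 * s by rewrite ler_pM2r// ler_pM// ltW.
have h2 : p * s ^+ 2 <= s ^+ 2 * s ^+ 2 by rewrite ler_pM2r// exprn_gt0.
have h3 : 0 <= p * p by rewrite mulr_ge0// ltW.
have h4 : 0 <= s ^+ 2 by exact: sqr_ge0.
have h5 : 0 <= s ^+ 2 * s by rewrite mulr_ge0// ltW.
have h6 : 0 <= s ^+ 2 * s ^+ 2 by rewrite mulr_ge0.
have e1 : 3 * p * (2 * s ^+ 2 + p * (s - 6)) =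
  6 * (p * s ^+ 2) + 3 * (p * p * s) - 18 * (p * p) by ring.
have e2 : 3 * s ^+ 2 * (s + 1) * (s + 2) * (s + 3) =
  3 * (s ^+ 2 * s ^+ 2 * s) + 18 * (s ^+ 2 * s ^+ 2) + 33 * (s ^+ 2 * s) + 18 * s ^+ 2 by ring.
rewrite e1 e2; move: (p * s ^+ 2) (p * p * s) (p * p) (s ^+ 2 * s ^+ 2 * s)
  (s ^+ 2 * s ^+ 2) (s ^+ 2 * s) (s ^+ 2) h1 h2 h3 h4 h5 h6.
clear; move=> x1 x2 x3 x4 x5 x6 x7.
lra.
Qed.

Lemma beta_fourth_ineq (R : realType) (A N : R) : 0 <= A -> A <= N ->
  let m := (A + 1) / (N + 2) in
  m ^+ 4 + - 4 * m ^+ 3 * m + 6 * m ^+ 2 * ((A + 2) / (N + 3) * m) +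
  - 4 * m * ((A + 3) / (N + 4) * ((A + 2) / (N + 3) * m)) +
  1 * ((A + 4) / (N + 5) * ((A + 3) / (N + 4) * ((A + 2) / (N + 3) * m))) <=
  3 / (N + 2) ^+ 2.
Proof.
move=> A0 AN /=; set L := (X in X <= _).
have -> : L = (3 * ((A + 1) * (N - A + 1)) *
     (2 * (N + 2) ^+ 2 + (A + 1) * (N - A + 1) * (N + 2 - 6))) /
   ((N + 2) ^+ 4 * (N + 3) * (N + 4) * (N + 5)).
  by rewrite /L; field; rewrite !gt_eqF//; lra.
have s0 : 0 < N + 2 by lra.
rewrite ler_pdivrMr; last by rewrite !mulr_gt0// ?exprn_gt0//; lra.
have -> : 3 / (N + 2) ^+ 2 * ((N + 2) ^+ 4 * (N + 3) * (N + 4) * (N + 5)) =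
  3 * (N + 2) ^+ 2 * (N + 2 + 1) * (N + 2 + 2) * (N + 2 + 3).
  by field; rewrite gt_eqF.
have p0 : 0 < (A + 1) * (N - A + 1) by rewrite mulr_gt0//; lra.
apply: fourth_moment_poly_ineq => //.
have := sqr_ge0 (A + 1); have := sqr_ge0 (N - A + 1).
move: p0; rewrite !expr2; lra.
Qed.

Section beta_moments.
Context {R : realType}.
Local Notation mu := (@lebesgue_measure R).
Import HBNNSimple.
Local Open Scope ereal_scope.

Let idR : measurableTypeR R -> R := idfun.

Let measurable_idR : measurable_fun [set: measurableTypeR R] idR.
Proof. exact: measurable_id. Qed.

#[local] HB.instance Definition _ :=
  @isMeasurableFun.Build _ _ _ _ idR measurable_idR.

(** [beta_prob] lives on a different measurable type with carrier [R]; this is its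
    image on the Borel sets of [R], with the parameters shifted so that they are
    positive. *)
Definition betaP (a b : nat) : probability R R :=
  distribution (beta_prob a.+1 b.+1 : probability _ R) idR.

Lemma ge0_integral_betaP (a b : nat) (g : R -> \bar R) :
  measurable_fun [set: R] g -> (forall x, 0 <= g x) ->
  \int[betaP a b]_x g x = \int[mu]_x (g x * (beta_pdf a.+1 b.+1 x)%:E).
Proof.
move=> mg g0.
pose h := nnsfun_approx measurableT mg.
have mh n : measurable_fun [set: R] (fun x => (h n x)%:E).
  by apply/measurable_EFinP.
have hh n x : 0 <= (h n x)%:E by rewrite lee_fin.
have ndh x : {homo (fun n => (h n x)%:E) : m n / (m <= n)%N >-> m <= n}.
  by move=> m n mn; rewrite lee_fin; apply/lefP/nd_nnsfun_approx.
have cvh x : (fun n => (h n x)%:E) @ \oo --> g x.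
  exact: cvg_nnsfun_approx.
have mp : measurable_fun [set: R] (fun x => (beta_pdf a.+1 b.+1 x)%:E).
  by apply/measurable_EFinP; exact: measurable_beta_pdf.
transitivity (limn (fun n => \int[betaP a b]_x (h n x)%:E)).
  rewrite -monotone_convergence//.
  by apply: eq_integral => x _; apply/esym/cvg_lim.
transitivity (limn (fun n => \int[mu]_x ((h n x)%:E * (beta_pdf a.+1 b.+1 x)%:E))).
  congr (limn _); apply/funext => n.
  rewrite /betaP ge0_integral_pushforward// preimage_setT.
  rewrite integral_beta_prob//; first exact: mh.
  have [M [Mr hM]] := simple_bounded (h n).
  have {}hM x : (`|h n x| <= `|M| + 1)%R.
    apply: (hM (`|M| + 1)%R) => //.
    by rewrite ltr_pwDr// ler_norm.
  apply: (@le_lt_trans _ _ (\int[beta_prob a.+1 b.+1]_x (`|M| + 1)%:E)).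
    apply: ge0_le_integral => //; first exact: (measurableT_comp _ (mh n)).
    by move=> x _; rewrite lee_fin.
  rewrite integral_cst//= (@probability_setT _ _ _ (beta_prob a.+1 b.+1)).
  by rewrite mule1 ltry.
rewrite -monotone_convergence//.
- apply: eq_integral => x _; apply/cvg_lim => //.
  by apply: cvgeZr.
- by move=> n; apply: emeasurable_funM; [exact: mh|exact: mp].
- by move=> n x _; rewrite mule_ge0// lee_fin beta_pdf_ge0.
- by move=> x _ m n mn; rewrite lee_wpmul2r ?lee_fin ?beta_pdf_ge0// -lee_fin ndh.
Qed.

Lemma betaP_power (a b k : nat) :
  \int[betaP a b]_x (`|x| ^+ k)%:E =
  (beta_fun (a + k).+1 b.+1 / beta_fun a.+1 b.+1)%:E :> \bar R.
Proof.
rewrite ge0_integral_betaP; last 2 first.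
- by apply/measurable_EFinP; apply: measurable_funX; exact: normr_measurable.
- by move=> x; rewrite lee_fin exprn_ge0.
rewrite EFinM EFin_beta_fun -ge0_integralZr//.
- apply: eq_integral => x _; rewrite /beta_pdf -!EFinM; congr EFin.
  rewrite !mulrA !patchE; case: ifPn => [|_]; last by rewrite mulr0 !mul0r.
  rewrite inE/= in_itv/= => /andP[x0 x1]; rewrite /XMonemX/= ger0_norm//.
  by rewrite mulrA -exprD addnC.
- apply/measurable_EFinP/measurable_restrict => //=.
  by apply: measurable_funTS; exact: measurable_XMonemX.
- by move=> x _; rewrite lee_fin patchE; case: ifPn => // /[1!inE]; exact: XMonemX_ge0.
- by rewrite lee_fin invr_ge0 beta_fun_ge0.
Qed.

Lemma betaP_01 (a b : nat) :
  {ae betaP a b, forall x : R, (0 < x < 1)%R}.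
Proof.
have b1 (x : R) : {ae betaP a b, forall y, y != x}.
  exists [set x]; split => //; last by move=> y /= /negP /[!negbK] /eqP.
  have [N [mN N0 xN]] : (beta_prob a.+1 b.+1 : probability _ R).-negligible [set x].
    have /null_content_dominatesP := @beta_prob_dom R a.+1 b.+1.
    move=> /(_ [set x]) h; exists [set x]; split => //; apply: h => //.
    exact: lebesgue_measure_set1.
  by apply: subset_measure0 N0 => //; exact: xN.
have b2 : {ae betaP a b, forall y : R, (0 <= y <= 1)%R}.
  exists (~` `[0%R, 1%R]%classic); split; first exact: measurableC.
    change (beta_prob a.+1 b.+1 (~` `[0%R, 1%R]%classic) = 0 :> \bar R).
    transitivity (1 - beta_prob a.+1 b.+1 `[0%R, 1%R]%classic : \bar R).
      exact: (@probability_setC _ _ _ (beta_prob a.+1 b.+1)).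
    by rewrite (@beta_prob01 R) subee.
  by move=> x /= h1 h2; apply: h1; rewrite in_itv/= in h2.
apply: filterS3 (b1 0%R) (b1 1%R) b2 => x x0 x1 /andP[h0 h1].
by rewrite !lt_neqAle h0 h1 x1 eq_sym x0.
Qed.

(** The [k]-th moment of [betaP a b], as a ratio of normalising constants. *)
Definition beta_raw (a b k : nat) : R := beta_fun (a + k).+1 b.+1 / beta_fun a.+1 b.+1.

Lemma beta_raw0 a b : beta_raw a b 0 = 1%R.
Proof. by rewrite /beta_raw addn0 divff// gt_eqF// beta_fun_gt0. Qed.

Lemma beta_rawS a b k : beta_raw a b k.+1 =
  ((a + k).+1%:R / (a + b + k).+2%:R * beta_raw a b k)%R.
Proof.
rewrite /beta_raw !mulrA; congr (_ / _)%R; rewrite addnS !beta_fun_fact.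
rewrite addSn factS (factS (a + k + b).+1) !natrM addnAC.
by field; rewrite !gt_eqF// ltr0n ?fact_gt0.
Qed.

Lemma integrable_betaP_power (a b k : nat) :
  (betaP a b).-integrable [set: R] (fun x => (x ^+ k)%:E).
Proof.
apply/integrableP; split; first by apply/measurable_EFinP; exact: measurable_funX.
under eq_integral do rewrite /= normrX.
by rewrite betaP_power ltry.
Qed.

Lemma integral_betaP_power (a b k : nat) :
  \int[betaP a b]_x (x ^+ k)%:E = (beta_raw a b k)%:E.
Proof.
rewrite -betaP_power; apply: ae_eq_integral => //.
- by apply/measurable_EFinP; exact: measurable_funX.
- apply/measurable_EFinP; apply: measurable_funX; exact: normr_measurable.
- apply: filterS (betaP_01 a b) => x /andP[x0 _] _.
  by rewrite ger0_norm// ltW.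
Qed.

Lemma integral_betaP_poly (a b n : nat) (c : nat -> R) :
  (betaP a b).-integrable [set: R] (fun x => (\sum_(k < n) c k * x ^+ k)%:E) /\
  \int[betaP a b]_x (\sum_(k < n) c k * x ^+ k)%:E =
  (\sum_(k < n) c k * beta_raw a b k)%:E.
Proof.
elim: n => [|n [ih1 ih2]].
  split; last by under eq_integral do rewrite big_ord0; rewrite integral0 big_ord0.
  by under eq_fun do rewrite big_ord0; exact: integrable0.
have E : (fun x : R => (\sum_(k < n.+1) c k * x ^+ k)%:E) =
    (fun x => (\sum_(k < n) c k * x ^+ k)%:E) \+ (fun x => (c n)%:E * (x ^+ n)%:E).
  by apply/funext => x; rewrite big_ord_recr.
have i2 : (betaP a b).-integrable [set: R] (fun x => (c n)%:E * (x ^+ n)%:E).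
  by apply: integrableZl => //; exact: integrable_betaP_power.
rewrite E; split; first exact: integrableD.
rewrite integralD// ih2 integralZl//; last exact: integrable_betaP_power.
by rewrite integral_betaP_power big_ord_recr.
Qed.

Definition beta_mean (a b : nat) : R := a.+1%:R / (a + b).+2%:R.

(** Polynomials of degree at most four, in the explicit form in which the centred
    moments are expanded. *)
Lemma integral_betaP_poly5 (a b : nat) (c0 c1 c2 c3 c4 : R) (g : R -> R) :
  (forall x, g x = c0 + c1 * x + c2 * x ^+ 2 + c3 * x ^+ 3 + c4 * x ^+ 4)%R ->
  (betaP a b).-integrable [set: R] (EFin \o g) /\
  \int[betaP a b]_x (g x)%:E =
  (c0 + c1 * beta_raw a b 1 + c2 * beta_raw a b 2 + c3 * beta_raw a b 3
   + c4 * beta_raw a b 4)%:E.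
Proof.
move=> gE; pose c := nth 0%R [:: c0; c1; c2; c3; c4].
have [i1 i2] := integral_betaP_poly a b 5 c.
have gE' : EFin \o g = fun x => (\sum_(k < 5) c k * x ^+ k)%:E.
  by apply/funext => x; rewrite /= gE !big_ord_recr big_ord0/= add0r expr0 mulr1 expr1.
split; first by rewrite gE'.
transitivity (\int[betaP a b]_x (EFin \o g) x) => //.
by rewrite gE' i2 !big_ord_recr big_ord0/= add0r beta_raw0 mulr1.
Qed.

Lemma beta_raw1 a b : beta_raw a b 1 = (a.+1%:R / (a + b).+2%:R)%R.
Proof. by rewrite beta_rawS !addn0 beta_raw0 mulr1. Qed.

Lemma beta_raw_field (a b : nat) :
  let A : R := (a%:R)%R in let N : R := ((a + b)%:R)%R in
  [/\ beta_raw a b 1 = ((A + 1) / (N + 2))%R,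
      beta_raw a b 2 = ((A + 2) / (N + 3) * ((A + 1) / (N + 2)))%R,
      beta_raw a b 3 = ((A + 3) / (N + 4) * ((A + 2) / (N + 3) * ((A + 1) / (N + 2))))%R &
      beta_raw a b 4 = ((A + 4) / (N + 5) * ((A + 3) / (N + 4) *
         ((A + 2) / (N + 3) * ((A + 1) / (N + 2)))))%R].
Proof.
have e1 k : ((a + k).+1%:R = a%:R + k.+1%:R :> R)%R by rewrite -addnS natrD.
have e2 k : ((a + b + k).+2%:R = (a + b)%:R + k.+2%:R :> R)%R.
  by rewrite -!addnS natrD.
by rewrite /= !beta_rawS beta_raw0 mulr1 !e1 !e2.
Qed.

Lemma integral_betaP_mean (a b : nat) :
  (betaP a b).-integrable [set: R] (fun x => (x - beta_mean a b)%:E) /\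
  \int[betaP a b]_x (x - beta_mean a b)%:E = 0.
Proof.
have [|i1 i2] := @integral_betaP_poly5 a b (- beta_mean a b) 1 0 0 0
  (fun x => x - beta_mean a b)%R; first by move=> x; ring.
split; first exact: i1.
rewrite i2 beta_raw1 /beta_mean; congr EFin.
by ring.
Qed.

Lemma integral_betaP_variance (a b : nat) :
  (betaP a b).-integrable [set: R] (fun x => ((x - beta_mean a b) ^+ 2)%:E) /\
  \int[betaP a b]_x ((x - beta_mean a b) ^+ 2)%:E =
  (beta_mean a b * (1 - beta_mean a b) / (a + b).+3%:R)%:E.
Proof.
set m := beta_mean a b.
have [|i1 i2] := @integral_betaP_poly5 a b (m ^+ 2)%R (- 2 * m)%R 1 0 0
  (fun x => (x - m) ^+ 2)%R; first by move=> x; ring.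
split; first exact: i1.
rewrite i2; congr EFin; have [-> -> -> ->] := beta_raw_field a b.
rewrite /m /beta_mean -[in (a + b).+3%:R]addn3 -[in (a + b).+2%:R]addn2 -addn1 !(natrD _ _ 1)
  !(natrD _ _ 2) !(natrD _ _ 3) -!natrD.
have : (0 <= (a + b)%:R :> R)%R by [].
move: (a%:R : R) ((a + b)%:R : R) => A N N0.
by field; rewrite !gt_eqF//; lra.
Qed.

Lemma integral_betaP_fourth (a b : nat) :
  (betaP a b).-integrable [set: R] (fun x => ((x - beta_mean a b) ^+ 4)%:E) /\
  \int[betaP a b]_x ((x - beta_mean a b) ^+ 4)%:E <=
  (3 / (a + b).+2%:R ^+ 2)%:E.
Proof.
set m := beta_mean a b.
have [|i1 i2] := @integral_betaP_poly5 a b (m ^+ 4)%R (- 4 * m ^+ 3)%R (6 * m ^+ 2)%R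
  (- 4 * m)%R 1 (fun x => (x - m) ^+ 4)%R; first by move=> x; ring.
split; first exact: i1.
rewrite i2 lee_fin; have [-> -> -> ->] := beta_raw_field a b.
rewrite /m /beta_mean -[in (a + b).+2%:R]addn2 -addn1 !(natrD _ _ 1) !(natrD _ _ 2).
have AN : (a%:R <= (a + b)%:R :> R)%R by rewrite ler_nat leq_addr.
exact: (beta_fourth_ineq (ler0n R a) AN).
Qed.

(** Multiplying the Beta density by a negative power of [1 - x] lowers its
    second parameter, at the cost of a ratio of normalising constants. *)
Lemma ge0_integral_betaP_tail (a b J : nat) (g : R -> \bar R) :
  (J <= b)%N -> measurable_fun [set: R] g -> (forall x, 0 <= g x) ->
  \int[betaP a b]_x ((`|1 - x|^-1 ^+ J)%:E * g x) <=
  (beta_fun a.+1 (b - J).+1 / beta_fun a.+1 b.+1)%:E * \int[betaP a (b - J)]_x g x.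
Proof.
move=> Jb mg g0.
have mv : measurable_fun [set: R] (fun x : R => ((`|1 - x|^-1 ^+ J)%R)%:E).
  apply/measurable_EFinP; apply: measurable_funX.
  under eq_fun do rewrite -powR_inv1//.
  apply: (@measurableT_comp _ _ _ _ _ _ (fun y : R => y `^ (-1))%R).
    exact: measurable_powR.
  by apply: measurableT_comp; [exact: normr_measurable|exact: measurable_funB].
rewrite ge0_integral_betaP//; last 2 first.
- exact: emeasurable_funM.
- by move=> x; rewrite mule_ge0// lee_fin exprn_ge0// invr_ge0.
rewrite ge0_integral_betaP//.
have mp (c d : nat) : measurable_fun [set: R] (fun x => (beta_pdf c d x)%:E).
  by apply/measurable_EFinP; exact: measurable_beta_pdf.
rewrite -ge0_integralZl//; last 3 first.
- by apply: emeasurable_funM; [exact: mg|exact: mp].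
- by move=> x _; rewrite mule_ge0// lee_fin beta_pdf_ge0.
- by rewrite lee_fin divr_ge0// beta_fun_ge0.
apply: ge0_le_integral => //.
- by move=> x _; rewrite !mule_ge0// lee_fin ?exprn_ge0 ?invr_ge0// beta_pdf_ge0.
- by apply: emeasurable_funM; [exact: emeasurable_funM|exact: mp].
- by apply: emeasurable_funM => //; apply: emeasurable_funM; [exact: mg|exact: mp].
move=> x _; rewrite [in leRHS]muleCA [in leLHS]muleAC [in leLHS]muleC.
rewrite lee_wpmul2l// -!EFinM lee_fin /beta_pdf !patchE.
case: ifPn => [|_]; last by rewrite !mul0r !mulr0.
rewrite inE/= in_itv/= => /andP[x0 x1].
have B1 : (0 < beta_fun a.+1 b.+1 :> R)%R by exact: beta_fun_gt0.
have B2 : (0 < beta_fun a.+1 (b - J).+1 :> R)%R by exact: beta_fun_gt0.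
rewrite /= [leRHS](_ : _ = XMonemX a (b - J) x / beta_fun a.+1 b.+1)%R; last first.
  by field; rewrite !gt_eqF.
rewrite mulrA ler_pM2r ?invr_gt0// -[XMonemX a b x]/(x ^+ a * (1 - x) ^+ b)%R.
rewrite -[XMonemX a (b - J) x]/(x ^+ a * (1 - x) ^+ (b - J))%R mulrCA.
rewrite ler_wpM2l ?exprn_ge0// ger0_norm ?subr_ge0// -{1}(subnK Jb) exprD mulrC -mulrA -exprMn.
have y0 : (0 <= 1 - x)%R by rewrite subr_ge0.
rewrite ler_piMr ?exprn_ge0// exprn_ile1// ?mulr_ge0 ?invr_ge0//.
by have [->|yn0] := eqVneq (1 - x)%R 0%R; [rewrite mul0r|rewrite divff].
Qed.

End beta_moments.
Arguments betaP {R}.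

Section tail_bounds.
Context {R : realType}.
Implicit Types alpha : R.

Lemma beta_fun_ratio_le (a b J : nat) :
  (beta_fun a.+1 b.+1 / beta_fun a.+1 (b + J).+1 <=
   ((a + b).+2%:R / b.+1%:R) ^+ J :> R).
Proof.
elim: J => [|J ih]; first by rewrite addn0 divff// gt_eqF// beta_fun_gt0.
rewrite addnS exprSr.
have rec : beta_fun a.+1 (b + J).+2 =
    (b + J).+1%:R / (a + (b + J)).+2%:R * beta_fun a.+1 (b + J).+1 :> R.
  rewrite !beta_fun_fact addnS !factS !natrM.
  by field; rewrite !gt_eqF// ltr0n ?fact_gt0.
have -> : beta_fun a.+1 b.+1 / beta_fun a.+1 (b + J).+2 =
    beta_fun a.+1 b.+1 / beta_fun a.+1 (b + J).+1 *
    ((a + (b + J)).+2%:R / (b + J).+1%:R) :> R.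
  by rewrite rec; field; rewrite !gt_eqF// ?ltr0n// beta_fun_gt0.
apply: ler_pM => //; first by rewrite divr_ge0// beta_fun_ge0.
rewrite ler_pdivrMr ?ltr0n// mulrAC ler_pdivlMr ?ltr0n// -!natrM ler_nat.
by rewrite addnA; nia.
Qed.

Lemma m_alpha_bounds alpha n : 0 < alpha < 1 ->
  n.+1%:R * (1 - alpha) <= (m_alpha alpha n)%:R < n.+1%:R * (1 - alpha) + 1.
Proof.
move=> /andP[a0 a1].
have p : 0 < n.+1%:R * (1 - alpha) by rewrite mulr_gt0// subr_gt0.
have c0 : 0 <= Num.ceil (n.+1%:R * (1 - alpha)).
  by rewrite -(ler0z R) (le_trans (ltW p))// ceil_ge.
have -> : (m_alpha alpha n)%:R = (Num.ceil (n.+1%:R * (1 - alpha)))%:~R :> R.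
  by rewrite /m_alpha natr_absz ger0_norm.
have /andP[] := ceil_itv (n.+1%:R * (1 - alpha)).
by rewrite intrB ltrBlDr => -> ->.
Qed.

Lemma m_alpha_gt0 alpha n : 0 < alpha < 1 -> (0 < m_alpha alpha n)%N.
Proof.
move=> a01; have /andP[+ _] := m_alpha_bounds n a01.
rewrite -(ltr_nat R); apply: lt_le_trans.
by case/andP: a01 => a0 a1; rewrite mulr_gt0// subr_gt0.
Qed.

(** Since [alpha > 0], the order statistic stays away from the maximum by a
    multiple of [n], which leaves room for any fixed power of [1 / (1 - u)]. *)
Lemma m_alpha_room alpha (J : nat) : 0 < alpha < 1 -> \forall n \near \oo,
  [/\ (m_alpha alpha n + J <= n)%N, (J.*2 <= n)%N, (0 < n)%N &
      n.+1%:R * alpha / 2 <= (n - m_alpha alpha n - J).+1%:R].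
Proof.
move=> a01; have /andP[a0 a1] := a01.
have [N hN] : exists N : nat, (2 * (J + 2)%:R / alpha <= N%:R).
  exists (Num.truncn (2 * (J + 2)%:R / alpha)).+1.
  by rewrite ltW// truncnS_gt.
exists (N + J.*2).+1 => // n /= nN.
have /andP[m1 m2] := m_alpha_bounds n a01.
have h : 2 * (J + 2)%:R <= n.+1%:R * alpha.
  rewrite -ler_pdivrMr// (le_trans hN)// ler_nat; lia.
have mJ : (m_alpha alpha n + J <= n)%N.
  rewrite -(ler_nat R) natrD.
  move: m2 h; rewrite natrD -[n.+1]addn1 natrD; have : (0 <= J%:R :> R) by []; lra.
split; [exact: mJ|lia|lia|].
have -> : ((n - m_alpha alpha n - J).+1 = n.+1 - (m_alpha alpha n + J))%N by lia.
rewrite natrB ?(leq_trans mJ)// natrD.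
move: m2 h; rewrite natrD -[n.+1]addn1 natrD; have : (0 <= J%:R :> R) by []; lra.
Qed.

(** The weight [(1 - u) ^ - J] turns [Beta (m, n - m + 1)] into a Beta law with the
    second parameter lowered by [J], up to a factor bounded uniformly in [n]; the
    mean of the new law is still within [O (1 / n)] of [1 - alpha]. *)
Lemma betaP_tail_bounds alpha (J : nat) : 0 < alpha < 1 ->
  exists2 C : R, 0 < C & \forall n \near \oo, let m := m_alpha alpha n in
  (\int[betaP m.-1 (n - m)]_x (`|1 - x|^-1 ^+ J)%:E <= C%:E)%E /\
  (\int[betaP m.-1 (n - m)]_x ((`|1 - x|^-1 ^+ J)%:E * ((x - (1 - alpha)) ^+ 4)%:E)
     <= (C / n%:R ^+ 2)%:E)%E.
Proof.
move=> a01; have /andP[a0 a1] := a01.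
(* [8 * 3 / (n / 2) ^ 2] for the centred moment, and [8 * (2 (J + 1) / n) ^ 4] for
   the distance of the means. *)
pose D : R := 96 + 128 * (J + 1)%:R ^+ 4.
have D1 : 1 <= D.
  by rewrite /D; have : 0 <= 128 * (J + 1)%:R ^+ 4 :> R by []; lra.
exists ((2 / alpha) ^+ J * D).
  by rewrite mulr_gt0 ?exprn_gt0 ?divr_gt0// (lt_le_trans ltr01).
near=> n.
have : [/\ (m_alpha alpha n + J <= n)%N, (J.*2 <= n)%N, (0 < n)%N &
   n.+1%:R * alpha / 2 <= (n - m_alpha alpha n - J).+1%:R].
  by near: n; exact: m_alpha_room.
set m := m_alpha alpha n; move=> [mJ nJ n0 hb].
have m0 : (0 < m)%N by exact: m_alpha_gt0.
have /andP[m1 m2] := m_alpha_bounds n a01; rewrite -/m in m1 m2.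
have Jb : (J <= n - m)%N by lia.
have nm : (m.-1 + (n - m - J)).+2 = (n.+1 - J)%N by lia.
have ratio : (beta_fun m.-1.+1 (n - m - J).+1 / beta_fun m.-1.+1 (n - m).+1 <= (2 / alpha) ^+ J :> R)%R.
  have := beta_fun_ratio_le m.-1 (n - m - J) J; rewrite subnK// nm => /le_trans; apply.
  rewrite lerXn2r// ?nnegrE ?divr_ge0// ?(ltW a0)// ler_pdivrMr// mulrAC ler_pdivlMr//.
  apply: (@le_trans _ _ (n.+1%:R * alpha)); first by rewrite ler_pM2r// ler_nat leq_subr.
  by move: hb; lra.
have mpow : measurable_fun [set: R] (fun x => ((x - (1 - alpha)) ^+ 4)%:E).
  by apply/measurable_EFinP; apply: measurable_funX; exact: measurable_funB.
split.
- under eq_integral do rewrite -[X in X%:E]mulr1 EFinM.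
  apply: le_trans; first exact: (@ge0_integral_betaP_tail R _ _ _ (cst 1%E) Jb).
  have -> : (\int[betaP m.-1 (n - m - J)]_x cst 1 x = 1 :> \bar R)%E.
    by rewrite integral_cst// mul1e; exact: probability_setT.
  rewrite mule1 lee_fin (le_trans ratio)// ler_peMr//.
  by rewrite exprn_ge0// divr_ge0// ltW.
apply: le_trans.
  apply: (@ge0_integral_betaP_tail R _ _ _ _ Jb mpow) => x.
  by rewrite lee_fin exprn_even_ge0.
have nJ0 : (0 < n.+1 - J)%N by lia.
set m' := beta_mean m.-1 (n - m - J) : R.
have m'E : m' = m%:R / (n.+1 - J)%:R by rewrite /m' /beta_mean nm prednK.
have nh : n%:R / 2 <= (n.+1 - J)%:R :> R.
  rewrite ler_pdivrMr// -natrM ler_nat; lia.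
have n0R : 0 < n%:R :> R by rewrite ltr0n.
have dm : `|m' - (1 - alpha)| <= 2 * (J + 1)%:R / n%:R.
  rewrite m'E -[X in _ - X](mulfK (x := (n.+1 - J)%:R)) ?gt_eqF ?ltr0n// -mulrBl normrM.
  rewrite [X in _ * X]ger0_norm ?invr_ge0// ler_pdivrMr ?ltr0n//.
  have -> : m%:R - (1 - alpha) * (n.+1 - J)%:R =
     m%:R - n.+1%:R * (1 - alpha) + (1 - alpha) * J%:R.
    by rewrite natrB; [ring|lia].
  apply: (@le_trans _ _ (J + 1)%:R).
    have q : 0 <= (1 - alpha) * J%:R by rewrite mulr_ge0// subr_ge0 ltW.
    have q2 : 0 <= alpha * J%:R by rewrite mulr_ge0// ltW.
    by rewrite natrD ger0_norm; move: q q2 m1 m2; lra.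
  rewrite mulrAC ler_pdivlMr//.
  have J1 : 0 < (J + 1)%:R :> R by rewrite ltr0n addn1.
  by move: nh; rewrite -(ler_pM2l J1) -natrM; lra.
have [fi fb] := integral_betaP_fourth m.-1 (n - m - J) (R := R).
rewrite -/m' nm in fi fb.
apply: (@le_trans _ _ (((2 / alpha) ^+ J)%:E * (D / n%:R ^+ 2)%:E)%E); last first.
  by rewrite -EFinM mulrA.
apply: lee_pmul.
- by rewrite lee_fin divr_ge0// beta_fun_ge0.
- by apply: integral_ge0 => x _; rewrite lee_fin exprn_even_ge0.
- by rewrite lee_fin.
apply: (@le_trans _ _ (\int[betaP m.-1 (n - m - J)]_x
   (8%:E * ((x - m') ^+ 4)%:E + (8 * (m' - (1 - alpha)) ^+ 4)%:E))%E).
  apply: ge0_le_integral => //.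
  - by move=> x _; rewrite lee_fin exprn_even_ge0.
  - apply: emeasurable_funD => //; apply: measurable_funeM.
    by apply/measurable_EFinP; apply: measurable_funX; exact: measurable_funB.
  move=> x _; rewrite -EFinM -EFinD lee_fin.
  have -> : x - (1 - alpha) = (x - m') + (m' - (1 - alpha)) by ring.
  move: (x - m') (m' - (1 - alpha)) => y z.
  have e : 8 * y ^+ 4 + 8 * z ^+ 4 - (y + z) ^+ 4 =
    (y - z) ^+ 2 * (7 * y ^+ 2 + 10 * y * z + 7 * z ^+ 2) by ring.
  rewrite -subr_ge0 e mulr_ge0 ?sqr_ge0//.
  by have := sqr_ge0 (y + z); have := sqr_ge0 y; have := sqr_ge0 z; rewrite !expr2; lra.
rewrite ge0_integralD//; last 3 first.
- by move=> x _; rewrite -EFinM lee_fin mulr_ge0// exprn_even_ge0.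
- apply: measurable_funeM.
  by apply/measurable_EFinP; apply: measurable_funX; exact: measurable_funB.
- by move=> x _; rewrite lee_fin mulr_ge0// exprn_even_ge0.
rewrite integral_cst// [X in (_ * X)%E](_ : _ = 1%E); last exact: probability_setT.
rewrite mule1 ge0_integralZl//; last 2 first.
- by apply/measurable_EFinP; apply: measurable_funX; exact: measurable_funB.
- by move=> x _; rewrite lee_fin exprn_even_ge0.
apply: (@le_trans _ _ (8%:E * (3 / (n.+1 - J)%:R ^+ 2)%:E +
   (8 * (2 * (J + 1)%:R / n%:R) ^+ 4)%:E)%E).
  apply: leeD; first by rewrite lee_pmul2l.
  rewrite lee_fin ler_pM2l// -[X in X <= _]ger0_norm ?exprn_even_ge0// normrX.
  by rewrite lerXn2r// nnegrE// divr_ge0// mulr_ge0.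
rewrite -EFinM -EFinD lee_fin /D [leRHS]mulrDl; apply: lerD.
  rewrite mulrA ler_pdivrMr ?exprn_gt0 ?ltr0n// mulrAC ler_pdivlMr ?exprn_gt0//.
  have : (n%:R / 2) ^+ 2 <= (n.+1 - J)%:R ^+ 2 :> R.
    by rewrite lerXn2r// nnegrE// divr_ge0.
  by rewrite expr_div_n; lra.
have n1 : 1 <= n%:R :> R by rewrite ler1n.
rewrite expr_div_n exprMn mulrA (_ : 8 * (2 ^+ 4 * _) = 128 * (J + 1)%:R ^+ 4); last by ring.
rewrite ler_pM2l ?mulr_gt0 ?exprn_gt0 ?ltr0n ?addn1// lef_pV2 ?posrE ?exprn_gt0//.
by rewrite ler_weXn2l.
Unshelve. all: by end_near. Qed.

End tail_bounds.

(** * Finite samples and their laws *)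

Section pi_systems.
Context {R : realType}.

Lemma probability_unique d (S : measurableType d) (G : set (set S))
    (m1 m2 : {measure set S -> \bar R}) :
  @measurable _ S = <<s G >> -> setI_closed G -> G setT ->
  (m1 setT < +oo)%E -> (forall A, G A -> m1 A = m2 A) ->
  forall A, measurable A -> m1 A = m2 A.
Proof.
move=> GE GI GT m1oo m12 A mA.
apply: (@g_sigma_algebra_measure_unique _ _ _ G _ (fun=> setT)) => //.
- by rewrite GE; exact: sub_sigma_algebra.
- by rewrite bigcup_const//; exists 0%N.
- by rewrite -GE.
Qed.

Definition cylinders d (U : measurableType d) (G : set (set U)) (n : nat) :
    set (set (n.-tuple U)) :=
  [set A | exists2 C : 'I_n -> set U, (forall i, G (C i)) &
     A = [set v | forall i, C i (tnth v i)]].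
Arguments cylinders {d U} G n.

Lemma setI_closed_cylinders d (U : measurableType d) (G : set (set U)) n :
  setI_closed G -> setI_closed (cylinders G n).
Proof.
move=> GI _ _ [C GC ->] [D GD ->]; exists (fun i => C i `&` D i).
  by move=> i; exact: GI.
apply/seteqP; split => [v [/= vC vD] i|v /= vCD]; first by split.
by split => i; have [] := vCD i.
Qed.

Lemma measurable_tupleE d (U : measurableType d) (G : set (set U)) n :
  @measurable _ U = <<s G >> -> G setT ->
  @measurable _ (n.-tuple U) = <<s cylinders G n >>.
Proof.
move=> GE GT; rewrite eqEsubset; split.
- apply: smallest_sub; first exact: smallest_sigma_algebra.
  move=> A; rewrite -bigcup_seq => -[i _] [B mB <-].
  pose f := (fun v => tnth v i) : g_sigma_algebraType (cylinders G n) -> U.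
  have mf : measurable_fun setT f.
    apply: (@measurability _ _ (g_sigma_algebraType (cylinders G n)) U setT f G GE) => _ [C GC <-].
    apply: sub_sigma_algebra; rewrite setTI.
    exists (fun j => if j == i then C else setT).
      by move=> j; case: ifP.
    apply/seteqP; split => [v /= fC j|v /= /(_ i)]; last by rewrite eqxx.
    by case: eqP => // ->.
  exact: (mf measurableT B mB).
- apply: smallest_sub; first exact: sigma_algebra_measurable.
  move=> _ [C GC ->].
  have -> : [set v : n.-tuple U | forall i, C i (tnth v i)] =
      \big[setI/setT]_(i < n) ((fun v => tnth v i) @^-1` C i).
    rewrite -bigcap_seq; apply/seteqP; split => [v h i _|v h i]; first exact: h.
    by apply: h => /=; rewrite mem_index_enum.
  apply: bigsetI_measurable => i _; rewrite -[X in measurable X]setTI.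
  by apply: measurable_tnth => //; rewrite GE; exact: sub_sigma_algebra.
Qed.

Lemma measurable_prodE d1 d2 (U1 : measurableType d1) (U2 : measurableType d2)
    (G1 : set (set U1)) (G2 : set (set U2)) :
  @measurable _ U1 = <<s G1 >> -> @measurable _ U2 = <<s G2 >> ->
  G1 setT -> G2 setT ->
  @measurable _ (U1 * U2)%type =
    <<s [set A `*` B | A in G1 & B in G2] >>.
Proof.
move=> E1 E2 T1 T2; rewrite eqEsubset; split.
- apply: smallest_sub; first exact: smallest_sigma_algebra.
  pose G := [set A `*` B | A in G1 & B in G2].
  have m1 : measurable_fun setT (fst : g_sigma_algebraType G -> U1).
    apply: (@measurability _ _ (g_sigma_algebraType G) U1 setT fst G1 E1) => _ [C GC <-].
    apply: sub_sigma_algebra; exists C => //; exists setT => //.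
    by apply/seteqP; split => [[x y] [/=]|[x y] [/=]].
  have m2 : measurable_fun setT (snd : g_sigma_algebraType G -> U2).
    apply: (@measurability _ _ (g_sigma_algebraType G) U2 setT snd G2 E2) => _ [C GC <-].
    apply: sub_sigma_algebra; exists setT => //; exists C => //.
  by move=> _ [[B mB <-]|[B mB <-]]; [exact: m1|exact: m2].
- apply: smallest_sub; first exact: sigma_algebra_measurable.
  move=> _ [A GA] [B GB <-]; apply: measurableX.
    by rewrite E1; exact: sub_sigma_algebra.
  by rewrite E2; exact: sub_sigma_algebra.
Qed.

Lemma setI_closed_prod d1 d2 (U1 : measurableType d1) (U2 : measurableType d2)
    (G1 : set (set U1)) (G2 : set (set U2)) :
  setI_closed G1 -> setI_closed G2 ->
  setI_closed [set A `*` B | A in G1 & B in G2].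
Proof.
move=> I1 I2 _ _ [A GA] [B GB <-] [C GC] [D GD <-].
exists (A `&` C); first exact: I1.
by exists (B `&` D); [exact: I2|rewrite setXI].
Qed.

End pi_systems.
Arguments cylinders {d U} G n.

Section iid_tuples.
Context {R : realType} d (U : measurableType d) (nu : probability U R)
  (G : set (set U)) d' (W : measurableType d') (P : probability W R)
  (V : nat -> {mfun W >-> U}).
Hypothesis GE : @measurable _ U = <<s G >>.
Hypothesis GI : setI_closed G.
Hypothesis GT : G setT.
Hypothesis iidV : forall n (C : nat -> set U), (forall i, G (C i)) ->
  P [set w | forall i, (i < n)%N -> C i (V i w)] = (\prod_(i < n) nu (C i))%E.

Definition tup n (s : {perm 'I_n}) (w : W) : n.-tuple U := [tuple V (s i) w | i < n].

Lemma measurable_tup n s : measurable_fun [set: W] (@tup n s).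
Proof.
apply/measurable_fun_tnthP => i.
rewrite (_ : _ \o _ = V (s i)); last by apply/funext => w /=; rewrite tnth_mktuple.
exact: measurable_funP.
Qed.

HB.instance Definition _ n (s : {perm 'I_n}) :=
  @isMeasurableFun.Build _ _ _ _ (tup s) (measurable_tup s).

Lemma tup_cylinder n (s : {perm 'I_n}) (C : 'I_n -> set U) :
  (forall i, G (C i)) ->
  P [set w | forall i, C i (tnth (tup s w) i)] = (\prod_(i < n) nu (C i))%E.
Proof.
move=> GC.
pose C' (j : nat) := if insub j is Some k then C ((s^-1)%g k) else setT.
have C'E (k : 'I_n) : C' k = C ((s^-1)%g k) by rewrite /C' valK.
have GC' j : G (C' j) by rewrite /C'; case: insubP.
rewrite (reindex_inj (@perm_inj _ (s^-1)%g)) /=.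
under eq_bigr do rewrite -C'E.
rewrite -iidV//; congr (P _); apply/seteqP; split => w /= h.
- move=> i ni; have := h ((s^-1)%g (Ordinal ni)).
  by rewrite tnth_mktuple permKV -C'E.
- move=> i; have := h (s i) (ltn_ord _).
  by rewrite C'E permK tnth_mktuple.
Qed.

(** An i.i.d. sample is exchangeable, so the split can be taken to consist of the
    first and of the last observations. *)
Lemma law_tup_perm n (s s' : {perm 'I_n}) (A : set (n.-tuple U)) : measurable A ->
  P (tup s @^-1` A) = P (tup s' @^-1` A).
Proof.
move=> mA; change (distribution P (tup s) A = distribution P (tup s') A).
move: A mA; apply: (@probability_unique _ _ _ (cylinders G n)).
- exact: measurable_tupleE.
- exact: setI_closed_cylinders.
- by exists (fun=> setT) => //; apply/seteqP.
- by rewrite [ltLHS]probability_setT ltry.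
- move=> _ [C GC ->]; transitivity (\prod_(i < n) nu (C i))%E.
    exact: (tup_cylinder s GC).
  exact/esym/(tup_cylinder s' GC).
Qed.

(** An observation is independent of the earlier ones. *)
Lemma law_tup_next n (A : set (n.-tuple U * U)%type) : measurable A ->
  P [set w | A (tup (1%g : {perm 'I_n}) w, V n w)] =
  (distribution P (tup (1%g : {perm 'I_n})) \x nu)%E A.
Proof.
have mp : measurable_fun setT (fun w => (tup (1%g : {perm 'I_n}) w, V n w)).
  by apply: measurable_fun_pair => //; exact: measurable_tup.
pose f : {mfun W >-> (n.-tuple U * U)%type} := mfun_Sub (mem_set mp).
move=> mA; change (distribution P f A = (distribution P (tup 1%g) \x nu)%E A).
move: A mA; apply: (@probability_unique _ _ _ [set A `*` B | A in cylinders G n & B in G]).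
- apply: measurable_prodE => //; first exact: measurable_tupleE.
  by exists (fun=> setT) => //; apply/seteqP.
- by apply: setI_closed_prod => //; exact: setI_closed_cylinders.
- exists setT; last by exists setT => //; rewrite setXTT.
  by exists (fun=> setT) => //; apply/seteqP.
- by rewrite [ltLHS]probability_setT ltry.
- move=> _ [_ [C GC ->]] [B GB <-].
  transitivity ((\prod_(i < n) nu (C i)) * nu B)%E; last first.
    rewrite -(tup_cylinder 1%g GC); apply/esym.
    apply: (product_measure1E (distribution P (tup (1%g : {perm 'I_n}))) nu).
      rewrite (@measurable_tupleE _ _ G)//.
      by apply: sub_sigma_algebra; exists C.
    by rewrite GE; exact: sub_sigma_algebra.
  pose C' (j : nat) := if insub j is Some k then C k else B.
  have GC' j : G (C' j) by rewrite /C'; case: insubP.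
  have := iidV n.+1 GC'; rewrite big_ord_recr/=.
  have -> : C' n = B by rewrite /C' insubF// ltnn.
  have -> : (\prod_(i < n) nu (C' i) = \prod_(i < n) nu (C i))%E.
    by apply: eq_bigr => i _; rewrite /C' valK.
  move=> <-; congr (P _); apply/seteqP; split => w /=.
  + move=> [h hB] i; rewrite ltnS leq_eqVlt => /orP[/eqP ->|ni].
      by rewrite /C' insubF// ltnn.
    by have := h (Ordinal ni); rewrite /C' insubT tnth_mktuple perm1.
  + move=> h; split => [i|]; last by have := h n (ltnSn n); rewrite /C' insubF// ltnn.
    have := h i (ltnW (ltn_ord i)); rewrite /C' valK tnth_mktuple perm1; exact.
Qed.

Lemma integral_tup_next n (h : (n.-tuple U * U)%type -> \bar R) :
  measurable_fun [set: (n.-tuple U * U)%type] h -> (forall z, 0 <= h z)%E ->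
  (\int[P]_w h (tup (1%g : {perm 'I_n}) w, V n w) =
   \int[P]_w \int[nu]_v h (tup (1%g : {perm 'I_n}) w, v))%E.
Proof.
move=> mh h0.
have mp : measurable_fun setT (fun w => (tup (1%g : {perm 'I_n}) w, V n w)).
  by apply: measurable_fun_pair => //; exact: measurable_tup.
pose f : {mfun W >-> (n.-tuple U * U)%type} := mfun_Sub (mem_set mp).
transitivity (\int[distribution P f]_z h z)%E.
  by rewrite ge0_integral_distribution.
transitivity (\int[(distribution P (tup (1%g : {perm 'I_n})) \x nu)%E]_z h z)%E.
  by apply: eq_measure_integral => A mA _; exact: law_tup_next.
rewrite fubini_tonelli1// ge0_integral_distribution//.
- exact: measurable_fun_fubini_tonelli_F.
- by move=> y; apply: integral_ge0.
Qed.

End iid_tuples.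

(** * Binomial tails and the Beta distribution function *)

(** The probability of at least [m] successes in [n] trials. The recursion on the
    last trial is the one that adding an observation to the sample produces. *)
Fixpoint binom_tail {R : realType} (n m : nat) (p : R) : R :=
  match m, n with
  | O, _ => 1
  | m'.+1, O => 0
  | m'.+1, n'.+1 => p * binom_tail n' m' p + (1 - p) * binom_tail n' m'.+1 p
  end.

Section binom_tail.
Context {R : realType}.

Lemma binom_tail0 n (p : R) : binom_tail n 0 p = 1.
Proof. by case: n. Qed.

Lemma binom_tail_01 n m (p : R) : 0 <= p <= 1 -> 0 <= binom_tail n m p <= 1.
Proof.
move=> /andP[p0 p1]; elim: n m => [|n ih] [|m] /=; rewrite ?lexx ?ler01//.
have /andP[a0 a1] := ih m; have /andP[b0 b1] := ih m.+1.
have q0 : 0 <= 1 - p by rewrite subr_ge0.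
apply/andP; split; first by rewrite addr_ge0// mulr_ge0.
have : p * binom_tail n m p <= p * 1 by rewrite ler_wpM2l.
have : (1 - p) * binom_tail n m.+1 p <= (1 - p) * 1 by rewrite ler_wpM2l.
by lra.
Qed.

Lemma measurable_binom_tail n m : measurable_fun [set: R] (binom_tail n m).
Proof.
elim: n m => [|n ih] [|m] //=.
apply: measurable_funD; apply: measurable_funM => //.
exact: measurable_funB.
Qed.

Let binom_pmf n m (p : R) : R := ('C(n, m))%:R * p ^+ m * (1 - p) ^+ (n - m).

Lemma binom_tail_diff n m p : binom_tail n m p - binom_tail n m.+1 p = binom_pmf n m p.
Proof.
rewrite /binom_pmf; elim: n m => [|n ih] [|m] /=.
- by rewrite bin0 subn0 !expr0 !mulr1 subr0.
- by rewrite bin0n subrr !mul0r.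
- have := ih 0%N; rewrite binom_tail0 !bin0 !subn0 !expr0 !mul1r exprS => <-.
  by ring.
- have -> : p * binom_tail n m p + (1 - p) * binom_tail n m.+1 p -
     (p * binom_tail n m.+1 p + (1 - p) * binom_tail n m.+2 p) =
     p * (binom_tail n m p - binom_tail n m.+1 p) +
     (1 - p) * (binom_tail n m.+1 p - binom_tail n m.+2 p) by ring.
  rewrite !ih binS natrD subSS exprS.
  have [mn|nm] := ltnP m n.
    have -> : (n - m = (n - m.+1).+1)%N by lia.
    by rewrite !exprS; ring.
  rewrite (bin_small (m := m.+1))// !mul0r mulr0; ring.
Qed.

(** The derivative is the density of [Beta (m, n - m + 1)], because the sum over
    the number of successes telescopes. *)
Definition binom_tail_deriv n m (p : R) : R :=
  if m is m'.+1 then (n * 'C(n.-1, m'))%:R * p ^+ m' * (1 - p) ^+ (n - m) else 0.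

Lemma is_derive_binom_tail n m (p : R) :
  is_derive p 1 (binom_tail n m) (binom_tail_deriv n m p).
Proof.
elim: n m => [|n ih] [|m] /=.
- exact: is_derive_cst.
- by rewrite mul0n !mul0r; exact: is_derive_cst.
- exact: is_derive_cst.
have d1 : is_derive p 1 (fun p => p * binom_tail n m p)
    (p *: binom_tail_deriv n m p + binom_tail n m p *: 1).
  exact: is_deriveM.
have d0 : is_derive p 1 (fun p : R => 1 - p) (0 - 1) by exact: is_deriveB.
have d2 : is_derive p 1 (fun p => (1 - p) * binom_tail n m.+1 p)
    ((1 - p) *: binom_tail_deriv n m.+1 p + binom_tail n m.+1 p *: (0 - 1)).
  exact: is_deriveM.
apply: is_derive_eq.
rewrite /GRing.scale/=.
have := binom_tail_diff n m p; rewrite /binom_pmf subSS.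
move=> /eqP; rewrite subr_eq => /eqP ->.
have e1 : p * binom_tail_deriv n m p = (m * 'C(n, m))%:R * p ^+ m * (1 - p) ^+ (n - m).
  case: m {ih d1 d2} => [|m] /=; first by rewrite mul0n mulr0 !mul0r.
  by rewrite mul_bin_diag exprS; ring.
have e2 : (1 - p) * ((n * 'C(n.-1, m))%:R * p ^+ m * (1 - p) ^+ (n - m.+1)) =
    ((n - m) * 'C(n, m))%:R * p ^+ m * (1 - p) ^+ (n - m).
  rewrite mul_bin_down; have [mn|nm] := ltnP m n.
    have -> : (1 - p) ^+ (n - m) = (1 - p) * (1 - p) ^+ (n - m.+1).
      by rewrite -exprS subnSK.
    by ring.
  by rewrite (eqP nm) mul0n !mul0r mulr0.
have e3 : (n.+1 * 'C(n, m))%:R = (m * 'C(n, m))%:R + 'C(n, m)%:R + ((n - m) * 'C(n, m))%:R :> R.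
  have [mn|nm] := leqP m n; last by rewrite bin_small// !muln0 !addr0.
  by rewrite -!natrD; congr (_%:R); rewrite -{1}(subnKC mn); lia.
by rewrite e1 e2 e3; ring.
Qed.

Lemma continuous_binom_tail n m : continuous (binom_tail n m : R -> R).
Proof.
move=> p; have /@ex_derive := is_derive_binom_tail n m p.
by move=> /derivable1_diffP/differentiable_continuous.
Qed.

Lemma binom_tail_at0 n m : binom_tail n m.+1 (0 : R) = 0.
Proof. by elim: n => [//|n ih] /=; rewrite mul0r add0r subr0 mul1r ih. Qed.

(** Both sides vanish at [0] and have the same derivative. Probabilistically, the
    [m]-th order statistic of [n] uniform variables is at most [p] when at least
    [m] of them are. *)
Lemma betaP_cdf (n m : nat) (p : R) : (0 < m <= n)%N -> 0 <= p <= 1 ->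
  betaP m.-1 (n - m) `]-oo, p]%classic = (binom_tail n m p)%:E :> \bar R.
Proof.
move=> /andP[m0 mn] /andP[p0 p1].
case: m m0 mn => // m _ mn; rewrite [m.+1.-1]/=.
have -> : betaP m (n - m.+1) `]-oo, p]%classic =
    (\int[betaP m (n - m.+1)]_x (\1_`]-oo, p]%classic x)%:E)%E :> \bar R.
  by rewrite integral_indic// setIT.
rewrite ge0_integral_betaP; last 2 first.
- exact/measurable_EFinP.
- by move=> x; rewrite lee_fin.
have Bp : (n * 'C(n.-1, m))%:R = (beta_fun m.+1 (n - m.+1).+1)^-1 :> R.
  have [k ->] : exists k, n = (m + k).+1 by exists (n - m.+1)%N; lia.
  rewrite subSS addKn /= beta_fun_fact invf_div.
  apply: (@mulIf _ (m`! * k`!)%:R).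
    by rewrite pnatr_eq0 -lt0n muln_gt0 !fact_gt0.
  rewrite divfK; last by rewrite pnatr_eq0 -lt0n muln_gt0 !fact_gt0.
  by rewrite -natrM -mulnA -[in k`!](addKn m k) bin_fact ?leq_addr// factS.
transitivity (\int[lebesgue_measure]_(x in `[0%R, p]) (binom_tail_deriv n m.+1 x)%:E)%E.
  rewrite [RHS]integral_mkcond; apply: eq_integral => x _.
  rewrite /beta_pdf restrict_EFin -EFinM; congr EFin.
  rewrite indicE !patchE /= !mem_setE !in_itv/=.
  have [xp|px] := leP x p; last by rewrite andbF mul0r.
  rewrite andbT mul1r (le_trans xp p1) andbT.
  by case: ifP => _; [rewrite Bp mulrC mulrA|rewrite mul0r].
have [->|pn0] := eqVneq p 0.
  by rewrite binom_tail_at0 set_itv1 integral_set1.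
rewrite (@continuous_FTC2 _ _ (binom_tail n m.+1)) ?lt_neqAle ?p0 ?andbT 1?eq_sym//.
- by rewrite binom_tail_at0 sube0.
- apply: continuous_subspaceT => x /=.
  apply: cvgM; last exact: continuous_onemXn.
  by apply: cvgM; [exact: cvg_cst|exact: exprn_continuous].
- split.
  + by move=> x _; have /@ex_derive := is_derive_binom_tail n m.+1 x.
  + exact/cvg_at_right_filter/continuous_binom_tail.
  + exact/cvg_at_left_filter/continuous_binom_tail.
- move=> x _; rewrite derive1E.
  by have /@derive_val := is_derive_binom_tail n m.+1 x.
Qed.

End binom_tail.

(** * Counting hits conditionally on a first part of the sample *)

Section conditional_count.
Context {R : realType} d (U : measurableType d) (nu : probability U R)
  (G : set (set U)) d' (W : measurableType d') (P : probability W R)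
  (V : nat -> {mfun W >-> U}).
Hypothesis GE : @measurable _ U = <<s G >>.
Hypothesis GI : setI_closed G.
Hypothesis GT : G setT.
Hypothesis iidV : forall n (C : nat -> set U), (forall i, G (C i)) ->
  P [set w | forall i, (i < n)%N -> C i (V i w)] = (\prod_(i < n) nu (C i))%E.
Context (n1 : nat) (Gam : set (n1.-tuple U * U)%type).
Hypothesis mGam : measurable Gam.

Let tup1 n (w : W) := tup V (1%g : {perm 'I_n}) w.

Definition first_part k (y : (n1 + k).-tuple U) : n1.-tuple U :=
  [tuple tnth y (lshift k i) | i < n1].

Definition count_part k (y : (n1 + k).-tuple U) : nat :=
  \sum_(i < k) ((first_part y, tnth y (rshift n1 i)) \in Gam).

Definition hit_prob (y : n1.-tuple U) : R := fine (nu (xsection Gam y)).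

Lemma hit_prob_01 y : 0 <= hit_prob y <= 1.
Proof.
have mx : measurable (xsection Gam y) by exact: measurable_xsection.
rewrite /hit_prob fine_ge0//= -lee_fin fineK ?fin_num_measure//.
exact: probability_le1.
Qed.

Lemma measurable_hit_prob : measurable_fun setT hit_prob.
Proof.
apply: (@measurableT_comp _ _ _ _ _ _ (fine : \bar R -> R)) => //.
exact: measurable_fun_xsection.
Qed.

Lemma measurable_first_part k : measurable_fun setT (@first_part k).
Proof.
apply/measurable_fun_tnthP => i.
rewrite [X in measurable_fun _ X](_ : _ = fun y => tnth y (lshift k i)).
  exact: measurable_tnth.
by apply/funext => y /=; rewrite tnth_mktuple.
Qed.

Lemma measurable_count_part k (m : nat) :
  measurable_fun setT (fun y => (m <= @count_part k y)%N).
Proof.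
rewrite (_ : (fun y => _) = fun y => m%:R <=
   \sum_(i < k) (\1_Gam (first_part y, tnth y (rshift n1 i)) : R)); last first.
  apply/funext => y; rewrite -(ler_nat R) natr_sum.
  by congr (_ <= _).
apply: measurable_fun_ler => //; apply: measurable_sum => i.
apply: (@measurableT_comp _ _ _ _ _ _ (\1_Gam : _ -> R)) => //.
apply: measurable_fun_pair; first exact: measurable_first_part.
exact: measurable_tnth.
Qed.

(** Given the first [n1] observations, the others hit their random target
    independently and with the same probability, so the number of hits is
    binomial. The factor [g] carries the conditioning through the induction on the
    number of observations. *)
Lemma integral_count_part k (m : nat) (g : n1.-tuple U -> \bar R) :
  measurable_fun setT g -> (forall y, 0 <= g y)%E ->
  (\int[P]_w (g (tup1 n1 w) * (m <= count_part (tup1 (n1 + k) w))%:R%:E) =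
   \int[P]_w (g (tup1 n1 w) * (binom_tail k m (hit_prob (tup1 n1 w)))%:E))%E.
Proof.
elim: k m g => [|k ih] m g mg g0.
  apply: eq_integral => w _; rewrite /count_part big_ord0.
  by case: m => [|m].
case: m => [|m].
  by apply: eq_integral => w _; rewrite leq0n binom_tail0.
have mh := measurable_hit_prob.
have h01 := hit_prob_01.
have fpE j w : first_part (tup1 (n1 + j) w) = tup1 n1 w.
  by apply: eq_from_tnth => i; rewrite !tnth_mktuple !perm1.
have cS w : count_part (tup1 (n1 + k.+1) w) =
    (count_part (tup1 (n1 + k) w) + ((tup1 n1 w, V (n1 + k)%N w) \in Gam))%N.
  rewrite /count_part big_ord_recr/= !fpE; congr (_ + _)%N.
    by apply: eq_bigr => i _; rewrite !tnth_mktuple !perm1.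
  by rewrite tnth_mktuple perm1.
pose a (y : (n1 + k).-tuple U) : R := (m <= count_part y)%N%:R.
pose b (y : (n1 + k).-tuple U) : R := (m < count_part y)%N%:R.
have mnat (j : nat) : measurable_fun setT (fun y : (n1 + k).-tuple U => (j <= count_part y)%N%:R : R).
  have := measurable_count_part j; move=> /(_ k) mj.
  apply: (@measurableT_comp _ _ _ _ _ _ (fun c : bool => c%:R : R)) => //.
have ma : measurable_fun setT a by exact: mnat.
have mb : measurable_fun setT b by exact: mnat.
pose h (z : (n1 + k).-tuple U * U) : \bar R :=
  (g (first_part z.1) * (a z.1 * \1_Gam (first_part z.1, z.2) + b z.1 * \1_(~` Gam) (first_part z.1, z.2))%:E)%E.
transitivity (\int[P]_w h (tup1 (n1 + k) w, V (n1 + k)%N w))%E.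
  apply: eq_integral => w _; rewrite /h/= fpE cS /a /b !indicE in_setC.
  case: (_ \in Gam); rewrite /= ?addn1 ?addn0 ?mulr1 ?mulr0 ?addr0 ?add0r//.
have mf1 : measurable_fun setT (fun z : (n1 + k).-tuple U * U => first_part z.1).
  by apply: measurableT_comp => //; exact: measurable_first_part.
have mpr : measurable_fun setT (fun z : (n1 + k).-tuple U * U => (first_part z.1, z.2)).
  exact: measurable_fun_pair.
have mGamC : measurable (~` Gam) by exact: measurableC.
have mind (A : set (n1.-tuple U * U)) : measurable A ->
    measurable_fun setT (fun z : (n1 + k).-tuple U * U => \1_A (first_part z.1, z.2) : R).
  move=> mA; apply: (@measurableT_comp _ _ _ _ _ _ (\1_A : _ -> R)) => //.
rewrite (@integral_tup_next _ _ _ nu G)//; last 2 first.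
- apply: emeasurable_funM; first exact: measurableT_comp.
  apply/measurable_EFinP; apply: measurable_funD; apply: measurable_funM; try exact: mind.
    exact: (measurableT_comp ma).
  exact: (measurableT_comp mb).
- by move=> z; rewrite mule_ge0// lee_fin addr_ge0// mulr_ge0// /a /b.
have mt n : measurable_fun setT (tup1 n) by exact: measurable_tup.
have mg1 : measurable_fun setT (fun w => g (tup1 n1 w)) by exact: measurableT_comp.
have mp1 : measurable_fun setT (fun w => (hit_prob (tup1 n1 w))%:E).
  by apply/measurable_EFinP; exact: measurableT_comp.
have mq : measurable_fun setT (fun y => (1 - hit_prob y)%:E).
  by apply/measurable_EFinP; exact: measurable_funB.
have mq1 : measurable_fun setT (fun w => (1 - hit_prob (tup1 n1 w))%:E).
  exact: measurableT_comp mq (mt n1).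
have ma1 : measurable_fun setT (fun w => (a (tup1 (n1 + k) w))%:E).
  by apply/measurable_EFinP; exact: measurableT_comp.
have mb1 : measurable_fun setT (fun w => (b (tup1 (n1 + k) w))%:E).
  by apply/measurable_EFinP; exact: measurableT_comp.
have p0 y : (0 <= (hit_prob y)%:E)%E by rewrite lee_fin; have /andP[] := h01 y.
have q0 y : (0 <= (1 - hit_prob y)%:E)%E by rewrite lee_fin subr_ge0; have /andP[] := h01 y.
have t0 j y : (0 <= (binom_tail k j (hit_prob y))%:E)%E.
  by rewrite lee_fin; have /andP[] := binom_tail_01 k j (h01 y).
have a0 y : (0 <= (a y)%:E)%E by rewrite lee_fin.
have b0 y : (0 <= (b y)%:E)%E by rewrite lee_fin.
have mbt j : measurable_fun setT (fun w => (binom_tail k j (hit_prob (tup1 n1 w)))%:E).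
  apply/measurable_EFinP.
  apply: (@measurableT_comp _ _ _ _ _ _ (binom_tail k j)); first exact: measurable_binom_tail.
  exact: measurableT_comp.
transitivity (\int[P]_w (g (tup1 n1 w) * (hit_prob (tup1 n1 w))%:E * (a (tup1 (n1 + k) w))%:E +
   g (tup1 n1 w) * (1 - hit_prob (tup1 n1 w))%:E * (b (tup1 (n1 + k) w))%:E))%E.
  apply: eq_integral => w _; rewrite /h/= fpE.
  set y := tup1 n1 w; set A := a _; set B := b _.
  have A0 : 0 <= A by rewrite /A /a.
  have B0 : 0 <= B by rewrite /B /b.
  have mx : measurable (xsection Gam y) by exact: measurable_xsection.
  have i1 v : \1_Gam (y, v) = \1_(xsection Gam y) v :> R by rewrite !indicE mem_xsection.
  have i2 v : \1_(~` Gam) (y, v) = \1_(~` xsection Gam y) v :> R.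
    by rewrite !indicE !in_setC mem_xsection.
  have mi (D : set U) : measurable D -> measurable_fun setT (\1_D : U -> R) by [].
  rewrite ge0_integralZl//; last 2 first.
  - apply/measurable_EFinP; under eq_fun do rewrite i1 i2.
    by apply: measurable_funD; apply: measurable_funM => //; apply: mi => //; exact: measurableC.
  - by move=> v _; rewrite lee_fin addr_ge0// mulr_ge0.
  have -> : (\int[nu]_v (A * \1_Gam (y, v) + B * \1_(~` Gam) (y, v))%:E =
     (A * hit_prob y + B * (1 - hit_prob y))%:E)%E.
    under eq_integral do rewrite i1 i2 EFinD !EFinM.
    have fx : nu (xsection Gam y) \is a fin_num by rewrite fin_num_measure.
    rewrite ge0_integralD//; last 4 first.
    + by move=> v _; rewrite -EFinM lee_fin mulr_ge0.
    + by apply: measurable_funeM; apply/measurable_EFinP; exact: mi.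
    + by move=> v _; rewrite -EFinM lee_fin mulr_ge0.
    + by apply: measurable_funeM; apply/measurable_EFinP; apply: mi; exact: measurableC.
    have z1 (D : set U) (c : R) : measurable D -> 0 <= c ->
        (\int[nu]_v (c%:E * (\1_D v)%:E) = c%:E * nu D)%E.
      move=> mD c0; rewrite ge0_integralZl//; last by apply/measurable_EFinP; exact: mi.
      by rewrite integral_indic// setIT.
    rewrite !z1//; last exact: measurableC.
    by rewrite probability_setC// EFinD !EFinM EFinB /hit_prob fineK.
  rewrite EFinD !EFinM ge0_muleDr//; last 2 first.
  - by rewrite -EFinM lee_fin mulr_ge0//; have /andP[] := h01 y.
  - by rewrite -EFinM lee_fin mulr_ge0// subr_ge0; have /andP[] := h01 y.
  by rewrite [(A%:E * _)%E]muleC [(B%:E * _)%E]muleC !muleA.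
have mgp : measurable_fun setT (fun y => g y * (hit_prob y)%:E)%E.
  by apply: emeasurable_funM => //; exact/measurable_EFinP.
have mgq : measurable_fun setT (fun y => g y * (1 - hit_prob y)%:E)%E.
  exact: emeasurable_funM.
have gp0 y : (0 <= g y * (hit_prob y)%:E)%E by exact: mule_ge0.
have gq0 y : (0 <= g y * (1 - hit_prob y)%:E)%E by exact: mule_ge0.
rewrite ge0_integralD//; last 4 first.
- by move=> w _; rewrite !mule_ge0.
- by apply: emeasurable_funM => //; exact: emeasurable_funM.
- by move=> w _; rewrite !mule_ge0.
- by apply: emeasurable_funM => //; exact: emeasurable_funM.
rewrite (ih m (fun y => g y * (hit_prob y)%:E)%E)//.
rewrite (ih m.+1 (fun y => g y * (1 - hit_prob y)%:E)%E)//.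
rewrite -ge0_integralD//; last 4 first.
- by move=> w _; rewrite !mule_ge0.
- by apply: emeasurable_funM => //; exact: emeasurable_funM.
- by move=> w _; rewrite !mule_ge0.
- by apply: emeasurable_funM => //; exact: emeasurable_funM.
apply: eq_integral => w _; rewrite /= -!muleA -ge0_muleDr//; exact: mule_ge0.
Qed.

End conditional_count.

(** * Quantiles of the law of a nonnegative variable *)

Section cdf_and_quantile.
Context {R : realType}.

(** The full set is included so that total masses need no separate argument. *)
Definition rays : set (set R) := [set A | A = setT \/ exists x, A = `]-oo, x]%classic].

Lemma measurable_raysE : @measurable _ R = <<s rays >>.
Proof.
rewrite eqEsubset; split.
- have -> : @measurable _ R = <<s @RGenOInfty.G R >> by exact: RGenOInfty.measurableE.
  apply: smallest_sub; first exact: smallest_sigma_algebra.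
  move=> _ [x ->]; rewrite -setCitvl.
  have := @smallest_sigma_algebra _ setT rays; case=> _ + _.
  move=> /(_ `]-oo, x]%classic); rewrite setTD; apply.
  by apply: sub_sigma_algebra; right; exists x.
- apply: smallest_sub; first exact: sigma_algebra_measurable.
  by move=> _ [->|[x ->]].
Qed.

Lemma setI_closed_rays : setI_closed rays.
Proof.
move=> _ _ [->|[x ->]] [->|[y ->]].
- by left; rewrite setTI.
- by right; exists y; rewrite setTI.
- by right; exists x; rewrite setIT.
- right; exists (Num.min x y); apply/seteqP; split => z /=; rewrite !in_itv/= le_min.
    by move=> [-> ->].
  by move/andP.
Qed.

Lemma measurable_fun_le_sets d (S : measurableType d) (g : S -> R) :
  (forall t, measurable [set x | g x <= t]) -> measurable_fun setT g.
Proof.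
move=> mg; apply: (@measurability _ _ S R setT g rays measurable_raysE) => _ [A [->|[x ->]] <-].
  by rewrite setTI preimage_setT.
rewrite setTI (_ : _ @^-1` _ = [set y | g y <= x])//.
Qed.

Context d (S : measurableType d) (mu : probability S R) (Z : S -> R).
Hypothesis mZ : measurable_fun setT Z.
Hypothesis Z0 : forall x, 0 <= Z x.

Let F t := fine (mu [set x | Z x <= t]).
Let Zf : {RV mu >-> R} := mfun_Sub (mem_set mZ).

Let cdfE t : cdf Zf t = (F t)%:E.
Proof.
have E : [set x | Z x <= t] = setT `&` Z @^-1` `]-oo, t]%classic.
  by rewrite setTI; apply/seteqP; split => x /=; rewrite in_itv.
rewrite /F fineK ?fin_num_measure// E; last exact: mZ.
Qed.

Lemma law_cdf_nd s t : s <= t -> F s <= F t.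
Proof. by move=> st; rewrite -lee_fin -!cdfE; exact: cdf_nondecreasing. Qed.

Lemma law_cdf_01 t : 0 <= F t <= 1.
Proof. by rewrite -!lee_fin -cdfE cdf_le1 andbT cdf_ge0. Qed.

Lemma law_cdf_neg t : t < 0 -> F t = 0.
Proof.
move=> t0; rewrite /F (_ : [set x | _] = set0) ?measure0//.
by apply/seteqP; split => x //= /le_lt_trans => /(_ _ t0); rewrite ltNge Z0.
Qed.

Lemma law_cdf_to1 u : u < 1 -> exists t, u <= F t.
Proof.
move=> u1; have := cvg_cdfy1 Zf.
have -> : (1%E : \bar R) = (1%R)%:E by [].
rewrite (_ : cdf Zf = fun t => (F t)%:E); last exact/funext/cdfE.
move=> /fine_cvgP[_ /= /cvgrPdist_lt /(_ (1 - u))]; rewrite subr_gt0 => /(_ u1) [M [_ h]].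
exists (M + 1); have := h (M + 1); rewrite ltrDl ltr01 => /(_ isT) /=.
by rewrite ltr_norml => /andP[]; lra.
Qed.

Lemma law_cdf_right u t : (forall e, 0 < e -> u <= F (t + e)) -> u <= F t.
Proof.
move=> h; have := @cdf_right_continuous _ _ _ _ Zf t.
rewrite cdfE; rewrite (_ : cdf Zf = fun t => (F t)%:E); last exact/funext/cdfE.
move=> /fine_cvgP[_ /= /cvgrPdist_lt cF].
rewrite leNgt; apply/negP => Fu.
have := cF (u - F t); rewrite subr_gt0 => /(_ Fu) [e /= e0 he].
have := he (t + e / 2); rewrite /= opprD addNKr normrN gtr0_norm ?divr_gt0//.
rewrite ltr_pdivrMr// ltr_pMr// ltr1n ltrDl divr_gt0// => /(_ isT isT).
have := h (e / 2); rewrite divr_gt0// => /(_ isT).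
by rewrite ltr_norml => ? /andP[]; lra.
Qed.

(** The Galois connection that characterises the quantile function. It needs the
    right-continuity of [F], and the limits of [F] for the infimum to be that of a
    nonempty set bounded below. *)
Lemma quantile_leP u t : 0 < u < 1 -> (quantile F u <= t) = (u <= F t).
Proof.
move=> /andP[u0 u1].
have hi : has_inf [set t | u <= F t].
  split; first exact: law_cdf_to1.
  exists 0 => z /= uz; rewrite leNgt; apply/negP => /law_cdf_neg Fz.
  by move: uz; rewrite Fz leNgt u0.
apply/idP/idP => [qt|ut]; last by apply: ge_inf => //; exact: hi.2.
apply: law_cdf_right => e e0.
have [z /= uz zq] := inf_adherent e0 hi.
apply: (le_trans uz); apply: law_cdf_nd.
by rewrite (le_trans (ltW zq))// lerD2r.
Qed.

Lemma quantile_ge0 u : 0 < u < 1 -> 0 <= quantile F u.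
Proof.
move=> u01; rewrite leNgt; apply/negP => q0.
have := quantile_leP (quantile F u) u01; rewrite lexx law_cdf_neg// => /esym.
by case/andP: u01 => u0 _; rewrite leNgt u0.
Qed.

End cdf_and_quantile.
Arguments rays {R}.

(** * The law of the order statistic of the scores *)

Section law_of_qhat.
Context {R : realType} d (T : measurableType d) d' (W : measurableType d')
  (P : probability W R) (PX : probability T R) (Q : probability R R)
  (f : T -> R) (mf : measurable_fun [set: T] f)
  (X : nat -> {RV P >-> T}) (e : nat -> {RV P >-> R})
  (iidXe : iid_sample PX Q X e)
  (fhat : estimator R T) (mfhat : measurable_estimator fhat)
  (s : splitting) (alpha : R).

Let U : measurableType _ := (T * R)%type.
Let nu : probability U R := (PX \x Q)%E.
Let G : set (set U) := [set A `*` B | A in measurable & B in measurable].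

Let mV i : measurable_fun setT (fun w => (X i w, e i w)).
Proof. by apply: measurable_fun_pair. Qed.

Definition noise_pair (i : nat) : {mfun W >-> U} := mfun_Sub (mem_set (mV i)).
Let V := noise_pair.

Let GE : @measurable _ U = <<s G >>.
Proof. exact: measurable_prod_measurableType. Qed.

Let GI : setI_closed G.
Proof. by apply: setI_closed_prod => A B mA mB; exact: measurableI. Qed.

Let GT : G setT.
Proof. by exists setT => //; exists setT => //; rewrite setXTT. Qed.

Let iidV n (C : nat -> set U) : (forall i, G (C i)) ->
  P [set w | forall i, (i < n)%N -> C i (V i w)] = (\prod_(i < n) nu (C i))%E.
Proof.
move=> GC; have [hX he hI] := iidXe.
pose A i := sval (cid2 (GC i)).
have mA i : measurable (A i) by rewrite /A; case: cid2.
have hB i : exists2 B, measurable B & A i `*` B = C i by rewrite /A; case: cid2.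
pose B i := sval (cid2 (hB i)).
have mB i : measurable (B i) by rewrite /B; case: (cid2 (hB i)).
have AB i : A i `*` B i = C i by rewrite /B; case: (cid2 (hB i)).
transitivity (\prod_(i < n) (P (X i @^-1` A i) * P (e i @^-1` B i)))%E.
  by rewrite -hI//; congr (P _); apply/seteqP; split => w /= h i ni;
    have := h i ni; rewrite -AB.
apply: eq_bigr => i _; rewrite -AB [RHS]product_measure1E//.
by congr (_ * _)%E; [exact: hX|exact: he].
Qed.

(** The estimation error as a function of the covariates and noises of the
    training set, which are the variables that are i.i.d. *)
Definition est_error (n1 : nat) (y : n1.-tuple U) (x : T) : R :=
  @fhat n1 [tuple ((tnth y i).1, f (tnth y i).1 + (tnth y i).2) | i < n1] x - f x.

Definition err_cdf (c : T -> R) (t : R) : R :=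
  fine (nu [set v | `|v.2 - c v.1| <= t]).

Lemma measurable_est_error n1 :
  measurable_fun setT (fun z : n1.-tuple U * T => est_error z.1 z.2).
Proof.
apply: measurable_funB; last exact: measurableT_comp.
have mpsi : measurable_fun setT (fun v : U => (v.1, f v.1 + v.2)).
  apply: measurable_fun_pair => //; apply: measurable_funD => //.
  exact: measurableT_comp.
have mt : measurable_fun setT (fun y : n1.-tuple U => [tuple ((tnth y i).1, f (tnth y i).1 + (tnth y i).2) | i < n1] : n1.-tuple U).
  apply/measurable_fun_tnthP => i.
  rewrite [X in measurable_fun _ X](_ : _ = (fun v : U => (v.1, f v.1 + v.2)) \o (fun y => tnth y i)).
    by apply: measurableT_comp => //; exact: measurable_tnth.
  by apply/funext => y /=; rewrite tnth_mktuple.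
apply: (@measurableT_comp _ _ _ _ _ _ (fun z : n1.-tuple U * T => @fhat n1 z.1 z.2) _
  (fun z : n1.-tuple U * T =>
    ([tuple ((tnth z.1 i).1, f (tnth z.1 i).1 + (tnth z.1 i).2) | i < n1] : n1.-tuple U, z.2))).
  exact: mfhat.
apply: measurable_fun_pair => //.
by apply: (measurableT_comp mt).
Qed.

Lemma measurable_est_error1 n1 (y : n1.-tuple U) : measurable_fun setT (est_error y).
Proof. exact: (measurableT_comp (@measurable_est_error n1) (pair1_measurable y)). Qed.

Lemma measurable_abs_err (c : T -> R) : measurable_fun setT c ->
  measurable_fun setT (fun v : U => `|v.2 - c v.1|).
Proof.
move=> mc; apply: (@measurableT_comp _ _ _ _ _ _ (@Num.norm R R)) => //.
by apply: measurable_funB => //; exact: measurableT_comp.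
Qed.

Section fixed_sizes.
Variables n1 n2 : nat.
Let m := m_alpha alpha n2.
Hypothesis m0 : (0 < m)%N.
Hypothesis mn : (m <= n2)%N.

Let one n : {perm 'I_n} := 1%g.
Let D (w : W) : n1.-tuple U := tup V (one n1) w.

Let Gam (t : R) : set (n1.-tuple U * U) :=
  [set z | `|z.2.2 - est_error z.1 z.2.1| <= t].

Let mGam t : measurable (Gam t).
Proof.
rewrite -[Gam t]setTI (_ : Gam t =
  (fun z : n1.-tuple U * U => `|z.2.2 - est_error z.1 z.2.1|) @^-1` `]-oo, t]%classic); last first.
  by apply/seteqP; split => z /=; rewrite in_itv.
have : measurable_fun setT (fun z : n1.-tuple U * U => `|z.2.2 - est_error z.1 z.2.1|).
  apply: (@measurableT_comp _ _ _ _ _ _ (@Num.norm R R)) => //.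
  apply: measurable_funB; first by apply: measurableT_comp.
  apply: (@measurableT_comp _ _ _ _ _ _ (fun z : n1.-tuple U * T => est_error z.1 z.2) _
    (fun z : n1.-tuple U * U => (z.1, z.2.1))); first exact: measurable_est_error.
  by apply: measurable_fun_pair => //; exact: measurableT_comp.
by move=> h; apply: h.
Qed.

Let hitE y t : hit_prob nu (Gam t) y = err_cdf (est_error y) t.
Proof.
rewrite /hit_prob /err_cdf; congr (fine (nu _)).
by apply/seteqP; split => v /=; rewrite /xsection/= inE.
Qed.

Let score (y : (n1 + n2).-tuple U) (i : 'I_n2) : R :=
  `|(tnth y (rshift n1 i)).2 - est_error (first_part y) (tnth y (rshift n1 i)).1|.

Let qh (y : (n1 + n2).-tuple U) : R := nth 0 (sort <=%R [seq score y i | i <- enum 'I_n2]) m.-1.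

Let qh_le y t : (qh y <= t) = (m <= count_part (Gam t) y)%N.
Proof.
set sc := [seq score y i | i <- enum 'I_n2].
have ssz : size (sort <=%R sc) = n2 by rewrite size_sort size_map size_enum_ord.
have srt : sorted <=%R (sort <=%R sc) by apply: sort_sorted; exact: le_total.
have -> : count_part (Gam t) y = count (<= t) (sort <=%R sc).
  rewrite count_sort count_map -sum1_count big_enum_cond/= big_mkcond.
  apply: eq_bigr => i _; rewrite /Gam /score.
  rewrite (_ : (_ \in _) = (score y i <= t)); first by case: (score y i <= t).
  by rewrite /score; apply/idP/idP; rewrite inE.
have [cm|cm] := leqP m (count (<= t) (sort <=%R sc)).
  by apply: nth_count_le => //; rewrite prednK.
apply/negbTE; rewrite -ltNge; apply: nth_count_gt => //.
by rewrite ssz; apply/andP; split; [rewrite -ltnS prednK|rewrite prednK].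
Qed.

Let mqh : measurable_fun setT qh.
Proof.
apply: measurable_fun_le_sets => t.
have mc := @measurable_count_part R _ U _ _ (mGam t) n2 m.
rewrite (_ : [set y | _] = (fun y => (m <= count_part (Gam t) y)%N) @^-1` [set true]).
  by rewrite -[X in measurable X]setTI; apply: mc.
by apply/seteqP; split => y /=; rewrite qh_le.
Qed.

Let Z := obs f X e.

Let qhatE w : qhat alpha fhat Z s n1 n2 w = qh (tup V (s n1 n2) w).
Proof.
rewrite /qhat /qh; congr (nth 0 (sort _ _) _).
rewrite /scores /calibration /= -map_comp; apply: eq_map => i /=.
rewrite /score /est_error !tnth_mktuple /Z /obs /=.
set y1 := training _ _ _ _ _; set y2 := [tuple _ | _ < _].
have -> : y1 = y2.
  by apply: eq_from_tnth => j; rewrite /y1 /y2 !tnth_mktuple.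
by congr (`| _ |); ring.
Qed.

Lemma measurable_qhat : measurable_fun setT (qhat alpha fhat Z s n1 n2).
Proof.
rewrite (_ : qhat _ _ _ _ _ _ = qh \o tup V (s n1 n2)); last exact/funext/qhatE.
apply: measurableT_comp => //; exact: measurable_tup.
Qed.

(** Conditionally on the training data, the calibration scores are i.i.d. with
    distribution function [err_cdf], so that their order statistic is distributed
    as the corresponding quantile at an independent Beta variable. *)
Definition coupled_q (z : W * R) : R :=
  if 0 < z.2 < 1 then quantile (err_cdf (est_error (D z.1))) z.2 else 0.

Let coupled_le (w : W) (u t : R) : 0 < u < 1 ->
  (coupled_q (w, u) <= t) = (u <= err_cdf (est_error (D w)) t).
Proof.
move=> u01; rewrite /coupled_q/= u01.
have mc := measurable_abs_err (measurable_est_error1 (D w)).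
exact: (@quantile_leP _ _ _ nu _ mc (fun=> normr_ge0 _)).
Qed.

Lemma measurable_coupled_q : measurable_fun setT coupled_q.
Proof.
apply: measurable_fun_le_sets => t.
have mD : measurable_fun setT D by exact: measurable_tup.
have mF : measurable_fun setT (fun z : W * R => err_cdf (est_error (D z.1)) t).
  under eq_fun do rewrite -hitE.
  apply: (@measurableT_comp _ _ _ _ _ _ (hit_prob nu (Gam t))).
    exact: measurable_hit_prob.
  exact: measurableT_comp.
have mb : measurable_fun setT (fun z : W * R => if 0 < z.2 < 1 then z.2 <= err_cdf (est_error (D z.1)) t else 0 <= t).
  apply: measurable_fun_ifT => //; last exact: measurable_fun_ler.
  by apply: measurable_and; exact: measurable_fun_ltr.
have -> : [set z | coupled_q z <= t] = setT `&`
   (fun z : W * R => if 0 < z.2 < 1 then z.2 <= err_cdf (est_error (D z.1)) t else 0 <= t) @^-1` [set true].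
  rewrite setTI; apply/seteqP; split => -[w u] /=; case: ifP => u01.
  - by rewrite coupled_le.
  - by rewrite /coupled_q u01.
  - by move=> h; rewrite coupled_le.
  - by move=> h; rewrite /coupled_q u01.
exact: mb.
Qed.

(** Both laws give [`]-oo, t]] the probability that at least [m] of the [n2] scores
    are at most [t], which is a binomial tail at the random level [Fh t] and, by
    [betaP_cdf], the probability that [U <= Fh t]. *)
Lemma law_qhat (A : set R) : measurable A ->
  P (qhat alpha fhat Z s n1 n2 @^-1` A) =
  (P \x betaP m.-1 (n2 - m))%E (coupled_q @^-1` A).
Proof.
move=> mA.
pose q1 : {RV P >-> R} := mfun_Sub (mem_set measurable_qhat).
pose q2 : {RV (P \x betaP m.-1 (n2 - m))%E >-> R} := mfun_Sub (mem_set measurable_coupled_q).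
change (distribution P q1 A = distribution (P \x betaP m.-1 (n2 - m))%E q2 A).
move: A mA; apply: (@probability_unique _ _ _ rays).
- exact: measurable_raysE.
- exact: setI_closed_rays.
- by left.
- by rewrite [ltLHS]probability_setT ltry.
move=> _ [->|[t ->]]; first by rewrite [LHS]probability_setT [RHS]probability_setT.
have mD : measurable_fun setT D by exact: measurable_tup.
transitivity (\int[P]_w (binom_tail n2 m (err_cdf (est_error (D w)) t))%:E)%E.
  transitivity (P (tup V (s n1 n2) @^-1` [set y | qh y <= t])).
    by congr (P _); apply/seteqP; split => w /=; rewrite in_itv/= qhatE.
  rewrite (law_tup_perm GE GI GT iidV (s n1 n2) 1%g); last first.
    have -> : [set y | qh y <= t] = setT `&` qh @^-1` `]-oo, t]%classic.
      by rewrite setTI; apply/seteqP; split => y /=; rewrite in_itv.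
    exact: mqh.
  have := @integral_count_part _ _ _ nu G _ _ P V GE GI GT iidV n1 (Gam t) (mGam t) n2 m (cst 1%E).
  move=> /(_ (@measurable_cst _ _ _ _ _ _) (fun=> lee01)) /=.
  under eq_integral do rewrite mul1e.
  under [in X in _ = X -> _]eq_integral do rewrite mul1e hitE.
  move=> <-.
  have mE : measurable (tup V (one (n1 + n2)) @^-1` [set y | qh y <= t]).
    rewrite -[X in measurable X]setTI.
    have -> : tup V (one (n1 + n2)) @^-1` [set y | qh y <= t] =
       (qh \o tup V (one (n1 + n2))) @^-1` `]-oo, t]%classic.
      by apply/seteqP; split => y /=; rewrite in_itv.
    by apply: (measurableT_comp mqh (measurable_tup _ _)).
  transitivity (\int[P]_w (\1_(tup V (one (n1 + n2)) @^-1` [set y | qh y <= t]) w)%:E)%E.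
    by rewrite integral_indic// setIT.
  apply: eq_integral => w _; rewrite indicE; rewrite -qh_le; congr ((nat_of_bool _)%:R%:E).
  by apply/idP/idP; rewrite inE.
apply/esym.
transitivity (\int[P]_w betaP m.-1 (n2 - m) (xsection (coupled_q @^-1` `]-oo, t]%classic) w))%E => //.
apply: eq_integral => w _.
have F01 := law_cdf_01 nu (measurable_abs_err (measurable_est_error1 (D w))) t.
rewrite -betaP_cdf ?m0//.
have mray : measurable (`]-oo, err_cdf (est_error (D w)) t]%classic : set R) by [].
have msec : measurable (xsection (coupled_q @^-1` `]-oo, t]%classic) w).
  apply: measurable_xsection; rewrite -[X in measurable X]setTI.
  by apply: measurable_coupled_q.
have E (B : set R) : measurable B -> betaP m.-1 (n2 - m) B = (\int[betaP m.-1 (n2 - m)]_u (\1_B u)%:E)%E.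
  by move=> mB; rewrite integral_indic// setIT.
rewrite !E//; apply: ae_eq_integral => //.
- by apply/measurable_EFinP; exact: measurable_indic.
- by apply/measurable_EFinP; exact: measurable_indic.
apply: filterS (betaP_01 m.-1 (n2 - m)) => u u01 _.
rewrite !indicE; congr ((nat_of_bool _)%:R%:E).
by apply/idP/idP; rewrite !inE /xsection/= !in_itv/= inE/= in_itv/= coupled_le.
Qed.

Definition error_moment (r : nat) (y : n1.-tuple U) : R :=
  \int[PX]_x (est_error y x ^+ r).

Lemma measurable_error_moment r : measurable_fun setT (error_moment r).
Proof.
apply: (@measurableT_comp _ _ _ _ _ _ (fine : \bar R -> R)) => //.
under eq_fun do rewrite integralE.
have mh : measurable_fun setT (fun z : n1.-tuple U * T => (est_error z.1 z.2 ^+ r)%:E).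
  by apply/measurable_EFinP; apply: measurable_funX; exact: measurable_est_error.
apply: emeasurable_funB.
- have hp : measurable_fun setT
      (fubini_F PX (fun z : n1.-tuple U * T => (est_error z.1 z.2 ^+ r)%:E)^\+%E).
    apply: measurable_fun_fubini_tonelli_F; first exact: measurable_funepos.
    by move=> z; exact: funepos_ge0.
  by apply: eq_measurable_fun hp => y _; apply: eq_integral => x _; rewrite !funeposE.
- have hn : measurable_fun setT
      (fubini_F PX (fun z : n1.-tuple U * T => (est_error z.1 z.2 ^+ r)%:E)^\-%E).
    apply: measurable_fun_fubini_tonelli_F; first exact: measurable_funeneg.
    by move=> z; exact: funeneg_ge0.
  by apply: eq_measurable_fun hn => y _; apply: eq_integral => x _; rewrite !funenegE.
Qed.

Let E1E r w : E1_error PX f fhat Z s r n1 n2 w =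
  error_moment r (first_part (tup V (s n1 n2) w)).
Proof.
rewrite /E1_error /error_moment; apply: eq_Rintegral => x _.
congr ((_ - _) ^+ _); rewrite /=.
set y1 := training _ _ _ _ _; set y2 := [tuple _ | _ < _].
have -> // : y1 = y2.
by apply: eq_from_tnth => j; rewrite /y1 /y2 !tnth_mktuple.
Qed.

Lemma measurable_E1_error r : measurable_fun setT (E1_error PX f fhat Z s r n1 n2).
Proof.
rewrite (_ : E1_error _ _ _ _ _ _ _ _ =
   (error_moment r \o first_part (k := n2)) \o tup V (s n1 n2)); last exact/funext/E1E.
apply: measurableT_comp; last exact: measurable_tup.
by apply: measurableT_comp; [exact: measurable_error_moment|exact: measurable_first_part].
Qed.

Lemma law_E1_error r (A : set R) : measurable A ->
  P (E1_error PX f fhat Z s r n1 n2 @^-1` A) = P ((fun w => error_moment r (D w)) @^-1` A).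
Proof.
move=> mA.
have mh : measurable_fun setT (error_moment r \o first_part (k := n2)).
  by apply: measurableT_comp; [exact: measurable_error_moment|exact: measurable_first_part].
have mB : measurable ((error_moment r \o first_part (k := n2)) @^-1` A).
  by rewrite -[X in measurable X]setTI; exact: mh.
transitivity (P (tup V (s n1 n2) @^-1` ((error_moment r \o first_part (k := n2)) @^-1` A))).
  by congr (P _); apply/seteqP; split => w /=; rewrite E1E.
rewrite (law_tup_perm GE GI GT iidV (s n1 n2) 1%g mB); congr (P _).
have E w : first_part (tup V (one (n1 + n2)) w) = D w.
  by apply: eq_from_tnth => i; rewrite !tnth_mktuple !perm1.
by apply/seteqP; split => w /=; rewrite E.
Qed.

Lemma training_first_obs w x : est_error (D w) x =
  @fhat n1 [tuple Z i w | i < n1] x - f x.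
Proof.
rewrite /est_error; congr (@fhat n1 _ x - _).
by apply: eq_from_tnth => i; rewrite !tnth_mktuple perm1.
Qed.

End fixed_sizes.
End law_of_qhat.

(** * Mean value and Taylor bounds *)

Section taylor.
Context {R : realType}.
Implicit Types (g : R -> R) (x y z l eta rho : R).

Lemma derivable1_continuous g x : derivable g x 1 -> {for x, continuous g}.
Proof. by move=> /derivable1_diffP/differentiable_continuous. Qed.

Lemma near_ballP (P : R -> Prop) z :
  (\forall x \near z, P x) <-> exists2 rho, 0 < rho & forall x, `|x - z| < rho -> P x.
Proof.
split=> [/nbhs_ballP[r /= r0 h]|[r r0 h]].
  by exists r => // x xz; apply: h; rewrite /ball/= distrC.
by apply/nbhs_ballP; exists r => //= x; rewrite /ball/= distrC; exact: h.
Qed.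

Definition between x y t := (Num.min x y <= t <= Num.max x y).

Lemma betweenC x y t : between x y t = between y x t.
Proof. by rewrite /between minC maxC. Qed.

Lemma between_ball z rho x y t : `|x - z| < rho -> `|y - z| < rho ->
  between x y t -> `|t - z| < rho.
Proof.
rewrite /between ge_min le_max !ltr_norml => /andP[? ?] /andP[? ?].
by move=> /andP[/orP[?|?] /orP[?|?]]; lra.
Qed.

Lemma between_dist x y t : between x y t -> `|t - x| <= `|y - x|.
Proof.
rewrite /between; have [xy|yx] := leP x y => /andP[h1 h2].
  by rewrite !ger0_norm ?subr_ge0// lerB.
by rewrite !ler0_norm ?subr_le0 ?(ltW yx)// lerN2 lerB.
Qed.

(** The mean value theorem with no assumption on the order of the endpoints. *)
Lemma mvt_between g x y l eta :
  (forall t, between x y t -> derivable g t 1) ->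
  (forall t, between x y t -> `|derive1 g t - l| <= eta) ->
  `|g y - g x - l * (y - x)| <= eta * `|y - x|.
Proof.
wlog xy : x y / x <= y => [main|].
  have [xy|/ltW yx] := leP x y; first exact: main.
  move=> h1 h2; rewrite [in leRHS]distrC.
  have -> : `|g y - g x - l * (y - x)| = `|g x - g y - l * (x - y)|.
    by rewrite -normrN; congr `|_|; ring.
  by apply: main => // t; rewrite betweenC; [exact: h1|exact: h2].
rewrite /between (min_idPl xy) (max_idPr xy) => dg bg.
have [||t] := @MVT_segment R g (derive1 g) x y xy.
- move=> t; rewrite in_itv/= => /andP[/ltW xt /ltW ty].
  have d : derivable g t 1 by apply: dg; rewrite xt.
  by apply: DeriveDef => //; rewrite derive1E.
- by apply: derivable_within_continuous => t; rewrite in_itv/=; exact: dg.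
rewrite in_itv/= => xty ->.
by rewrite -mulrBl normrM ler_wpM2r// bg.
Qed.

Lemma mvt_lin g z rho l eta :
  (forall x, `|x - z| < rho -> derivable g x 1) ->
  (forall x, `|x - z| < rho -> `|derive1 g x - l| <= eta) ->
  forall x y, `|x - z| < rho -> `|y - z| < rho ->
  `|g y - g x - l * (y - x)| <= eta * `|y - x|.
Proof.
move=> dg bg x y xz yz; apply: mvt_between => t xty.
  exact/dg/(between_ball xz yz).
exact/bg/(between_ball xz yz).
Qed.

(** The mean value inequality applied to the first-order remainder, whose
    derivative is controlled by [mvt_lin]. *)
Lemma taylor2 g z rho l eta : 0 <= eta ->
  (forall x, `|x - z| < rho -> derivable g x 1 /\ derivable (derive1 g) x 1) ->
  (forall x, `|x - z| < rho -> `|derive1 (derive1 g) x - l| <= eta) ->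
  forall x y, `|x - z| < rho -> `|y - z| < rho ->
  `|g y - g x - derive1 g x * (y - x) - l / 2 * (y - x) ^+ 2| <= eta * (y - x) ^+ 2.
Proof.
move=> eta0 dg bg x y xz yz.
have b' := mvt_lin (fun x h => (dg x h).2) bg.
pose G t := g t - derive1 g x * t - l / 2 * (t - x) ^+ 2.
have dG t : `|t - z| < rho -> is_derive t 1 G (derive1 g t - derive1 g x - l * (t - x)).
  move=> tz; have [d1 _] := dg t tz.
  have id1 : is_derive t 1 g (derive1 g t) by apply: DeriveDef => //; rewrite derive1E.
  have id2 : is_derive t 1 (fun t => derive1 g x * t) (derive1 g x *: 1) by exact: is_deriveZ.
  have id3 : is_derive t 1 (fun t => t - x) (1 - 0) by exact: is_deriveB.
  have id4 : is_derive t 1 (fun t => (t - x) ^+ 2) (2%:R *: (t - x) ^+ 1 *: (1 - 0)).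
    exact: (is_deriveX 2).
  have id5 : is_derive t 1 (fun t => l / 2 * (t - x) ^+ 2) ((l / 2) *: (2%:R *: (t - x) ^+ 1 *: (1 - 0))).
    exact: is_deriveZ.
  have id6 := is_deriveB (is_deriveB id1 id2) id5.
  apply: (is_derive_eq (df := _)) => //.
  by rewrite /GRing.scale/=; field.
have := @mvt_between G x y 0 (eta * `|y - x|).
rewrite mul0r subr0 -mulrA -expr2 real_normK ?num_real//.
have -> : G y - G x = g y - g x - derive1 g x * (y - x) - l / 2 * (y - x) ^+ 2.
  by rewrite /G; ring.
apply=> t xty; have tz := between_ball xz yz xty.
  by have /@ex_derive := dG t tz.
rewrite subr0 derive1E.
have /@derive_val -> := dG t tz.
by rewrite (le_trans (b' _ _ xz tz))// ler_wpM2l// between_dist.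
Qed.

End taylor.

(** * Regularity of a quantile function *)

(** A function that is regular near a quantile [q0] has a quantile function that
    is regular near its level [c]. *)
Section inverse.
Context {R : realType}.
Variables (F phi : R -> R) (c q0 rho0 delta : R).
Hypothesis F01 : forall t, 0 <= F t <= 1.
Hypothesis galois : forall u t, 0 < u < 1 -> (phi u <= t) = (u <= F t).
Hypothesis c01 : 0 < c < 1.
Hypothesis q0E : q0 = phi c.
Hypothesis rho00 : 0 < rho0.
Hypothesis delta0 : 0 < delta.
Hypothesis dF : forall t, `|t - q0| < rho0 -> derivable F t 1 /\ derivable (derive1 F) t 1.
Hypothesis F'ge : forall t, `|t - q0| < rho0 -> delta < derive1 F t.
Hypothesis F''c : forall eta, 0 < eta ->
  exists2 rho, 0 < rho & forall t, `|t - q0| < rho ->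
  `|derive1 (derive1 F) t - derive1 (derive1 F) q0| <= eta.

Lemma F_incr s t : `|s - q0| < rho0 -> `|t - q0| < rho0 -> s < t -> F s < F t.
Proof.
move=> sq tq st; have [||x] := @MVT R F (derive1 F) s t st.
- move=> x; rewrite in_itv/= => /andP[/ltW sx /ltW xt].
  have /dF[d _] : `|x - q0| < rho0.
    by apply: between_ball sq tq _; rewrite /between (min_idPl (ltW st)) (max_idPr (ltW st)) sx.
  by apply: DeriveDef => //; rewrite derive1E.
- apply: derivable_within_continuous => x; rewrite in_itv/= => sxt.
  suff /dF[d _] : `|x - q0| < rho0 by exact: d.
  by apply: between_ball sq tq _; rewrite /between (min_idPl (ltW st)) (max_idPr (ltW st)).
rewrite in_itv/= => /andP[/ltW sx /ltW xt] E.
rewrite -subr_gt0 E mulr_gt0 ?subr_gt0// (lt_trans delta0)// F'ge//.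
by apply: between_ball sq tq _; rewrite /between (min_idPl (ltW st)) (max_idPr (ltW st)) sx.
Qed.

Let ball_mid t : `|t - q0| < rho0 -> exists2 d, 0 < d & forall s, `|s - t| < d -> `|s - q0| < rho0.
Proof.
move=> tq; exists (rho0 - `|t - q0|); first by rewrite subr_gt0.
move=> s; rewrite ltrBrDr; apply: le_lt_trans.
exact: ler_distD.
Qed.

Lemma F_in01 t : `|t - q0| < rho0 -> 0 < F t < 1.
Proof.
move=> tq; have [d d0 hd] := ball_mid tq.
have l : F (t - d / 2) < F t.
  apply: F_incr => //; last by rewrite ltrBlDr ltrDl divr_gt0.
  apply: hd; rewrite addrAC subrr add0r normrN gtr0_norm ?divr_gt0//.
  by rewrite ltr_pdivrMr// ltr_pMr// ltr1n.
have r : F t < F (t + d / 2).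
  apply: F_incr => //; last by rewrite ltrDl divr_gt0.
  apply: hd; rewrite addrAC subrr add0r gtr0_norm ?divr_gt0//.
  by rewrite ltr_pdivrMr// ltr_pMr// ltr1n.
have /andP[a _] := F01 (t - d / 2); have /andP[_ b] := F01 (t + d / 2).
by rewrite (le_lt_trans a l) (lt_le_trans r b).
Qed.

Lemma phiF t : `|t - q0| < rho0 -> phi (F t) = t.
Proof.
move=> tq; have Ft := F_in01 tq.
apply/eqP; rewrite eq_le galois// lexx/= leNgt; apply/negP => lt.
have [d d0 hd] := ball_mid tq.
pose s := Num.max (phi (F t)) (t - d / 2).
have st : s < t by rewrite /s gt_max lt/= ltrBlDr ltrDl divr_gt0.
have sq : `|s - q0| < rho0.
  apply: hd; rewrite ltr0_norm ?subr_lt0// opprB ltrBlDr -ltrBlDl.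
  have : t - d / 2 <= s by rewrite /s le_max lexx orbT.
  by move: d0; lra.
have := galois s Ft; rewrite /s le_max lexx/= -/s => /esym.
by rewrite leNgt F_incr.
Qed.

Lemma F_cont t : `|t - q0| < rho0 -> {for t, continuous F}.
Proof. by move=> /dF[+ _]; exact: derivable1_continuous. Qed.

Let q0q0 : `|q0 - q0| < rho0. Proof. by rewrite subrr normr0. Qed.

Lemma F_q0 : F q0 = c.
Proof.
apply/eqP; rewrite eq_le; apply/andP; split; last by rewrite -galois// q0E.
rewrite leNgt; apply/negP => cF.
have /cvgrPdist_lt/(_ (F q0 - c)) := F_cont q0q0.
rewrite subr_gt0 => /(_ cF)/near_ballP[d d0 hd].
have e : `|q0 - d / 2 - q0| < d.
  rewrite addrAC subrr add0r normrN gtr0_norm ?divr_gt0//.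
  by rewrite ltr_pdivrMr// ltr_pMr// ltr1n.
have := hd _ e; rewrite ltr_norml => /andP[_ h].
have : phi c <= q0 - d / 2 by rewrite galois// ltW//; lra.
by rewrite -q0E leNgt ltrBlDr ltrDl divr_gt0.
Qed.

(** The quantile function is only known through the Galois connection; the
    intermediate value theorem makes it a continuous inverse near [c]. *)
Lemma phi_local r : 0 < r -> exists2 rho1, 0 < rho1 &
  forall u, `|u - c| < rho1 -> `|phi u - q0| < r /\ F (phi u) = u.
Proof.
move=> r0; pose r' : R := Num.min r rho0 / 2.
have r'0 : 0 < r' by rewrite divr_gt0// lt_min r0.
have r'lt : r' < r /\ r' < rho0.
  have : Num.min r rho0 <= r by rewrite ge_min lexx.
  have : Num.min r rho0 <= rho0 by rewrite ge_min lexx orbT.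
  by move: r'0; rewrite /r'; move: (Num.min r rho0) => w; split; lra.
have aq : `|q0 - r' - q0| < rho0 by rewrite addrAC subrr add0r normrN gtr0_norm// r'lt.2.
have bq : `|q0 + r' - q0| < rho0 by rewrite addrAC subrr add0r gtr0_norm// r'lt.2.
have Fa : F (q0 - r') < c by rewrite -F_q0; apply: F_incr => //; rewrite ltrBlDr ltrDl.
have Fb : c < F (q0 + r') by rewrite -F_q0; apply: F_incr => //; rewrite ltrDl.
exists (Num.min (c - F (q0 - r')) (F (q0 + r') - c)); first by rewrite lt_min !subr_gt0 Fa.
move=> u uc; have /andP[u1 u2] : F (q0 - r') < u < F (q0 + r').
  by move: uc; rewrite lt_min !ltr_norml => /andP[/andP[? _] /andP[_ ?]]; apply/andP; split; lra.
have ab : q0 - r' <= q0 + r' by lra.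
have [||t] := @IVT R F _ _ u ab.
- apply: derivable_within_continuous => x; rewrite in_itv/= => /andP[x1 x2].
  suff /dF[d _] : `|x - q0| < rho0 by exact: d.
  by have r2 := r'lt.2; rewrite ltr_norml; apply/andP; split; lra.
- by rewrite ge_min le_max; apply/andP; split; apply/orP; [left|right]; lra.
rewrite in_itv/= => /andP[t1 t2] Ft.
have tq : `|t - q0| <= r' by rewrite ler_norml; apply/andP; split; lra.
have tq' : `|t - q0| < rho0 := le_lt_trans tq r'lt.2.
have phiu : phi u = t by rewrite -Ft; exact: phiF.
by rewrite phiu; split; [exact: (le_lt_trans tq r'lt.1)|].
Qed.

Lemma phi_derive : exists2 rho1, 0 < rho1 &
  forall u, `|u - c| < rho1 -> [/\ `|phi u - q0| < rho0, F (phi u) = u &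
     is_derive u 1 phi (derive1 F (phi u))^-1].
Proof.
have [rho1 r10 h] := phi_local rho00.
exists rho1 => // u /h[uq Fu]; split=> //.
rewrite -[X in is_derive X]Fu; apply: (@is_derive_inverse _ F phi).
- have [d d0 hd] := ball_mid uq.
  by apply/near_ballP; exists d => // s /hd; exact: phiF.
- have [d d0 hd] := ball_mid uq.
  by apply/near_ballP; exists d => // s /hd; exact: F_cont.
- by have [d _] := dF uq; apply: DeriveDef => //; rewrite derive1E.
- by rewrite gt_eqF// (lt_trans delta0)// F'ge.
Qed.

Lemma phi_twice : exists2 rho1, 0 < rho1 &
  forall u, `|u - c| < rho1 -> [/\ `|phi u - q0| < rho0, F (phi u) = u,
     is_derive u 1 phi (derive1 F (phi u))^-1 &
     is_derive u 1 (derive1 phi) (- derive1 (derive1 F) (phi u) / derive1 F (phi u) ^+ 3)].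
Proof.
have [rho1 r10 h] := phi_derive.
exists rho1 => // u uc; have [h1 h2 h3] := h u uc; split=> //.
have F'0 : derive1 F (phi u) != 0 by rewrite gt_eqF// (lt_trans delta0)// F'ge.
have [_ d2] := dF h1.
have id2 : is_derive (phi u) 1 (derive1 F) (derive1 (derive1 F) (phi u)).
  by apply: DeriveDef; [exact: d2|rewrite (derive1E (derive1 F))].
have id3 : is_derive u 1 (derive1 F \o phi) (derive1 (derive1 F) (phi u) * (derive1 F (phi u))^-1).
  exact: is_derive1_comp.
have id4 := is_deriveV (f := derive1 F \o phi) F'0 id3.
have uc' : 0 < rho1 - `|u - c| by rewrite subr_gt0.
have nE : \near u, (derive1 F (phi u))^-1 = derive1 phi u.
  apply/near_ballP; exists (rho1 - `|u - c|) => // v vu.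
  have vc : `|v - c| < rho1.
    by rewrite (le_lt_trans (ler_distD u _ _))// -ltrBrDr.
  have [_ _ hv] := h v vc; rewrite [RHS]derive1E.
  by have /@derive_val -> := hv.
apply: (near_eq_is_derive nE); apply: is_derive_eq id4 _.
by rewrite /GRing.scale/=; field.
Qed.

Lemma phi_regular : exists2 rho1, 0 < rho1 &
  forall u, `|u - c| < rho1 -> [/\ derivable phi u 1, derivable (derive1 phi) u 1,
    `|phi u - q0| < rho0, F (phi u) = u &
    derive1 (derive1 phi) u = - derive1 (derive1 F) (phi u) / derive1 F (phi u) ^+ 3].
Proof.
have [rho1 r10 h] := phi_twice; exists rho1 => // u /h[h1 h2 h3 h4].
have d1 := @ex_derive _ _ _ _ _ _ _ h3; have d2 := @ex_derive _ _ _ _ _ _ _ h4.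
split; [exact: d1|exact: d2|exact: h1|exact: h2|rewrite (derive1E (derive1 phi))].
exact: (@derive_val _ _ _ _ _ _ _ h4).
Qed.

Lemma phi_cont : {for c, continuous phi}.
Proof.
have [rho1 r10 h] := phi_regular; apply: derivable1_continuous.
by have [|+ _ _ _ _] := h c; rewrite ?subrr ?normr0.
Qed.

Lemma phi_second_cont eta : 0 < eta -> exists2 rho, 0 < rho &
  forall u, `|u - c| < rho ->
    `|derive1 (derive1 phi) u - derive1 (derive1 phi) c| <= eta.
Proof.
move=> eta0; have [rho1 r10 h] := phi_regular.
have F''cont : {for phi c, continuous (derive1 (derive1 F))}.
  rewrite -q0E; apply/cvgrPdist_le => e e0; have [r r0 hr] := F''c e0.
  by apply/near_ballP; exists r; [exact: r0|move=> t tr; rewrite distrC; exact: hr].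
have F'cont : {for phi c, continuous (derive1 F)}.
  by rewrite -q0E; have [_ d2] := dF q0q0; exact: derivable1_continuous d2.
pose psi t := - derive1 (derive1 F) t / derive1 F t ^+ 3.
have F'0 : derive1 F (phi c) ^+ 3 != 0.
  by rewrite expf_neq0// gt_eqF// (lt_trans delta0)// F'ge// -q0E.
have psic : {for phi c, continuous psi}.
  apply: cvgM; first exact: cvgN.
  apply: cvgV => //.
  apply: (@continuous_comp _ _ _ (derive1 F) (fun x => x ^+ 3)) => //.
  exact: exprn_continuous.
have pc : {for c, continuous (psi \o phi)} by apply: continuous_comp; [exact: phi_cont|].
have /cvgrPdist_le/(_ _ eta0)/near_ballP[r r0 hr] := pc.
exists (Num.min r rho1); first by rewrite lt_min r0.
move=> u; rewrite lt_min => /andP[ur ur1].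
have [_ _ _ _ ->] := h u ur1.
have [|_ _ _ _ ->] := h c; first by rewrite subrr normr0.
by rewrite distrC; exact: hr.
Qed.

End inverse.

(** * Shifts of the noise law *)

Section shifted_law.
Context {R : realType} (Q : probability R R).
Local Notation Fe := (F_eps Q).
Local Notation F := (F_abs Q).

Definition shifted_cdf (t c : R) : R := fine (Q [set u | `|u - c| <= t]).

Lemma shifted_cdf0 t : shifted_cdf t 0 = F t.
Proof.
by rewrite /shifted_cdf /F_abs; congr (fine (Q _)); apply/seteqP; split => u /=; rewrite subr0.
Qed.

Let finQ (A : set R) : measurable A -> Q A \is a fin_num.
Proof. by move=> mA; rewrite fin_num_measure. Qed.

Lemma F_eps_itv x y : x <= y -> Q `]x, y]%classic = (Fe y - Fe x)%:E :> \bar R.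
Proof.
move=> xy; rewrite EFinB /F_eps !fineK ?finQ//.
have -> : `]-oo, y]%classic = `]-oo, x]%classic `|` `]x, y]%classic :> set R.
  by rewrite -itv_bndbnd_setU ?bnd_simp.
rewrite measureU//; first by rewrite addeAC subee ?add0e ?finQ.
apply/seteqP; split => z //=; rewrite !in_itv/= => -[zx /andP[xz _]].
by move: xz; rewrite ltNge zx.
Qed.

Lemma no_atom x : {for x, continuous Fe} -> Q [set x] = 0 :> \bar R.
Proof.
move=> /cvgrPdist_le cx; apply/eqP; rewrite eq_le measure_ge0 andbT.
apply/lee_addgt0Pr => e e0; rewrite add0e.
have /near_ballP[r r0 hr] := cx e e0.
have e2 : `|x - r / 2 - x| < r.
  by rewrite addrAC subrr add0r normrN gtr0_norm ?divr_gt0// ltr_pdivrMr// ltr_pMr// ltr1n.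
have xr : x - r / 2 <= x by rewrite lerBlDr lerDl divr_ge0// ltW.
apply: (@le_trans _ _ (Q `]x - r / 2, x]%classic)).
  apply: le_measure; rewrite ?inE// => z /= ->; rewrite in_itv/= lexx andbT.
  by rewrite ltrBlDr ltrDl divr_gt0.
rewrite F_eps_itv// lee_fin.
exact: le_trans (ler_norm _) (hr _ e2).
Qed.

Lemma shifted_cdfE t c : 0 <= t -> {for (c - t), continuous Fe} ->
  shifted_cdf t c = Fe (c + t) - Fe (c - t).
Proof.
move=> t0 /no_atom Q0; have ct : c - t <= c + t by lra.
rewrite /shifted_cdf.
have -> : [set u | `|u - c| <= t] = [set (c - t)] `|` `]c - t, c + t]%classic.
  apply/seteqP; split => u /=.
    rewrite ler_norml in_itv/= => /andP[h1 h2].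
    have [->|n] := eqVneq u (c - t); first by left.
    by right; rewrite lt_neqAle eq_sym n; apply/andP; split; lra.
  move=> [->|]; rewrite ?in_itv/=.
    by rewrite ler_norml; apply/andP; split; lra.
  by move=> /andP[? ?]; rewrite ler_norml; apply/andP; split; lra.
rewrite measureU//; last first.
  by apply/seteqP; split => z //= [->]; rewrite in_itv/= ltxx.
rewrite [X in fine (X + _)%E](_ : _ = 0%E) ?add0e; last exact: Q0.
by rewrite [X in fine X](F_eps_itv ct).
Qed.

Lemma symmetric_F_eps x : symmetric_law Q -> {for x, continuous Fe} -> Fe (- x) = 1 - Fe x.
Proof.
move=> sQ /no_atom Q0.
have E : Q `]-oo, - x]%classic = Q `[x, +oo[%classic.
  rewrite -sQ//; congr (Q _); apply/seteqP; split => z /=.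
    by move=> [u]; rewrite in_itv/= => h <-; rewrite in_itv/= lerNr andbT.
  rewrite in_itv/= andbT => xz; exists (- z); last by rewrite opprK.
  by rewrite in_itv/= lerN2.
have -> : Fe (- x) = fine (Q `]x, +oo[%classic).
  rewrite /F_eps E; congr fine.
  have -> : `[x, +oo[%classic = [set x] `|` `]x, +oo[%classic.
    apply/seteqP; split => z /=; rewrite !in_itv/= !andbT.
      by rewrite le_eqVlt => /predU1P[->|]; [left|right].
    by move=> [->|/ltW].
  rewrite measureU//; last by apply/seteqP; split => z //= [->]; rewrite in_itv/= ltxx.
  by rewrite [X in (X + _)%E](_ : _ = 0%E) ?add0e; last exact: Q0.
have -> : `]x, +oo[%classic = ~` `]-oo, x]%classic by rewrite setCitvl.
by rewrite probability_setC// /F_eps fineB// fin_num_measure.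
Qed.

(** Uniformity in [t] near [q0] is what allows inverting the expansion. *)
Definition shift_expansion (q0 : R) (p : nat) (kappa : R) : Prop :=
  forall eta, 0 < eta -> exists2 rho, 0 < rho & forall t c,
    `|t - q0| < rho -> `|c| < rho ->
    `|shifted_cdf t c - F t - kappa * c ^+ p| <= eta * `|c| ^+ p.

Variables (q0 rho0 : R).
Hypothesis q00 : 0 < q0.
Hypothesis rho00 : 0 < rho0.

(** To first order, the endpoint [t] gains [Fe' (q0) * c] and the endpoint [- t]
    gains [Fe' (- q0) * c]. *)
Lemma shift_expansion1 :
  (forall t, `|t - q0| < rho0 -> derivable Fe t 1 /\ derivable Fe (- t) 1) ->
  {for q0, continuous (derive1 Fe)} -> {for - q0, continuous (derive1 Fe)} ->
  shift_expansion q0 1 (derive1 Fe q0 - derive1 Fe (- q0)).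
Proof.
move=> dFe c1 c2 eta eta0.
have eta20 : 0 < eta / 2 by rewrite divr_gt0.
have /cvgrPdist_le/(_ _ eta20)/near_ballP[r1 r10 h1] := c1.
have /cvgrPdist_le/(_ _ eta20)/near_ballP[r2 r20 h2] := c2.
pose r := Num.min (Num.min rho0 q0) (Num.min r1 r2).
have r0 : 0 < r by rewrite !lt_min rho00 q00 r10 r20.
have rle x : x < r -> [/\ x < rho0, x < q0, x < r1 & x < r2].
  by rewrite !lt_min => /andP[/andP[-> ->] /andP[-> ->]].
have m1 := @mvt_lin _ Fe q0 r (derive1 Fe q0) (eta / 2).
have m2 := @mvt_lin _ Fe (- q0) r (derive1 Fe (- q0)) (eta / 2).
have nN x : `|x - - q0| < r -> `|- x - q0| < r.
  by rewrite opprK -normrN opprD.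
exists (r / 2) => [|t c tq cr]; first by rewrite divr_gt0.
have ca : {for (c - t), continuous Fe} .
  apply: derivable1_continuous; rewrite -[c - t]opprK.
  have [|_ //] := dFe (- (c - t)).
  have : `|- (c - t) - q0| < r.
    have -> : - (c - t) - q0 = t - q0 - c by ring.
    by rewrite (le_lt_trans (ler_normB _ _))//; lra.
  by move=> /rle[].
have ca0 : {for (0 - t), continuous Fe}.
  by apply: derivable1_continuous; rewrite sub0r; have [|//] := dFe t; have [|//] := rle `|t - q0|; lra.
have t0 : 0 <= t.
  have [|_ + _ _] := rle `|t - q0|; first by lra.
  by rewrite ltr_norml => /andP[]; lra.
rewrite expr1 -shifted_cdf0 !shifted_cdfE// add0r sub0r expr1.
have {}m1 : `|Fe (c + t) - Fe t - derive1 Fe q0 * (c + t - t)| <= eta / 2 * `|c + t - t|.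
  apply: m1 => [x /rle[h _ _ _]|x /rle[_ _ h _]||].
  - by have [] := dFe x h.
  - by rewrite distrC; exact: h1.
  - by lra.
  - have -> : c + t - q0 = t - q0 + c by ring.
    by rewrite (le_lt_trans (ler_normD _ _))//; lra.
have {}m2 : `|Fe (c - t) - Fe (- t) - derive1 Fe (- q0) * (c - t - - t)| <= eta / 2 * `|c - t - - t|.
  apply: m2 => [x /nN /rle[h _ _ _]|x /rle[_ _ _ h]||].
  - by have [_] := dFe _ h; rewrite opprK.
  - by rewrite distrC; exact: h2.
  - by rewrite opprK addrC distrC; lra.
  - have -> : c - t - - q0 = - (t - q0) + c by ring.
    by rewrite (le_lt_trans (ler_normD _ _))// normrN; lra.
move: m1 m2; rewrite addrK opprK subrK => m1 m2.
have -> : Fe (c + t) - Fe (c - t) - (Fe t - Fe (- t)) - (derive1 Fe q0 - derive1 Fe (- q0)) * c =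
  (Fe (c + t) - Fe t - derive1 Fe q0 * c) - (Fe (c - t) - Fe (- t) - derive1 Fe (- q0) * c) by ring.
by rewrite (le_trans (ler_normB _ _))//; lra.
Qed.

(** By symmetry the mass of the shifted interval is
    [Fe (t + c) + Fe (t - c) - 1], and the first-order terms cancel. *)
Lemma shift_expansion2 : symmetric_law Q ->
  (forall t, `|t - q0| < rho0 -> [/\ derivable Fe t 1, derivable Fe (- t) 1 & derivable (derive1 Fe) t 1]) ->
  {for q0, continuous (derive1 (derive1 Fe))} ->
  shift_expansion q0 2 (derive1 (derive1 Fe) q0).
Proof.
move=> sQ dFe c1 eta eta0.
have eta20 : 0 < eta / 2 by rewrite divr_gt0.
have /cvgrPdist_le/(_ _ eta20)/near_ballP[r1 r10 h1] := c1.
pose r := Num.min (Num.min rho0 q0) r1.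
have r0 : 0 < r by rewrite !lt_min rho00 q00 r10.
have rle x : x < r -> [/\ x < rho0, x < q0 & x < r1].
  by rewrite !lt_min => /andP[/andP[-> ->] ->].
exists (r / 2) => [|t c tq cr]; first by rewrite divr_gt0.
have tr : `|t - q0| < r by lra.
have tcr : `|t - c - q0| < r.
  have -> : t - c - q0 = t - q0 - c by ring.
  by rewrite (le_lt_trans (ler_normB _ _))//; lra.
have tcr' : `|t + c - q0| < r.
  have -> : t + c - q0 = t - q0 + c by ring.
  by rewrite (le_lt_trans (ler_normD _ _))//; lra.
have co x : `|x - q0| < r -> {for x, continuous Fe}.
  by move=> /rle[/dFe[d _ _] _ _]; exact: derivable1_continuous.
have coN x : `|x - q0| < r -> {for (- x), continuous Fe}.
  by move=> /rle[/dFe[_ d _] _ _]; exact: derivable1_continuous.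
have t0 : 0 <= t.
  by have [_ + _] := rle _ tr; rewrite ltr_norml => /andP[]; lra.
have e1 : c - t = - (t - c) by ring.
rewrite -shifted_cdf0 !shifted_cdfE//; last 2 first.
- by rewrite sub0r; exact: coN.
- by rewrite e1; exact: coN.
rewrite add0r sub0r e1 !symmetric_F_eps//; [|exact: co|exact: co].
have T := @taylor2 _ Fe q0 r (derive1 (derive1 Fe) q0) (eta / 2) (ltW eta20).
have {}T : forall x y, `|x - q0| < r -> `|y - q0| < r ->
    `|Fe y - Fe x - derive1 Fe x * (y - x) - derive1 (derive1 Fe) q0 / 2 * (y - x) ^+ 2|
      <= eta / 2 * (y - x) ^+ 2.
  apply: T => x /rle[h _ h']; first by have [] := dFe x h.
  by rewrite distrC; exact: h1.
have T1 := T _ _ tr tcr'; have T2 := T _ _ tr tcr.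
move: T1 T2.
have -> : t + c - t = c by ring.
have -> : t - c - t = - c by ring.
rewrite sqrrN (addrC c t) => T1 T2.
rewrite (_ : _ - _ = (Fe (t + c) - Fe t - derive1 Fe t * c - derive1 (derive1 Fe) q0 / 2 * c ^+ 2)
   + (Fe (t - c) - Fe t - derive1 Fe t * - c - derive1 (derive1 Fe) q0 / 2 * c ^+ 2)); last by field.
rewrite (le_trans (ler_normD _ _))// real_normK ?num_real//.
by apply: (le_trans (lerD T1 T2)); rewrite -mulrDl -splitr.
Qed.

End shifted_law.

(** * Perturbation of quantiles *)

Section quantile_perturbation.
Context {R : realType}.
Implicit Types (F phi Fh : R -> R) (c l kappa eta rho r q m mp eps u x y t s M : R).

(** To restore the level [u] after [F] has moved by [kappa * m], the quantile moves by
    [- kappa * m / l], where [l] is the slope of [F] at [q0]: the function [Fh]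
    passes the level [u] within [tau] of that point. *)
Lemma quantile_expand F phi c (q0 : R) l kappa : 0 < l ->
  (forall eta, 0 < eta -> exists2 r, 0 < r & forall x y, `|x - q0| < r -> `|y - q0| < r ->
     `|F y - F x - l * (y - x)| <= eta * `|y - x|) ->
  (forall r, 0 < r -> exists2 rho1 : R, 0 < rho1 &
     forall u, `|u - c| < rho1 -> `|phi u - q0| < r /\ F (phi u) = u) ->
  forall rho eta, 0 < rho -> 0 < eta -> exists rho1 tau0 : R, [/\ 0 < rho1, 0 < tau0 &
    forall Fh q m mp eps u,
      (forall t, (q <= t) = (u <= Fh t)) -> `|m| <= mp -> 0 <= eps -> mp + eps <= tau0 ->
      (forall t, `|t - q0| < rho -> `|Fh t - F t - kappa * m| <= eps) ->
      `|u - c| < rho1 -> `|q - phi u - (- kappa / l) * m| <= 2 / l * eps + eta * mp].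
Proof.
move=> l0 lin loc rho eta rho0 eta0; set h0 : R := - kappa / l.
pose eta1 : R := Num.min (l / 2) (eta * l / (2 * (`|h0| + 1))).
have h1 : 0 < `|h0| + 1 by rewrite ltr_wpDl.
have eta10 : 0 < eta1 by rewrite lt_min divr_gt0//= divr_gt0 ?mulr_gt0.
have eta1l : eta1 <= l / 2 by rewrite ge_min lexx.
have eta1h : eta1 * `|h0| <= eta * l / 2.
  apply: (@le_trans _ _ (eta1 * (`|h0| + 1))); first by rewrite ler_pM2l// lerDl.
  rewrite -ler_pdivlMr//.
  have -> : eta * l / 2 / (`|h0| + 1) = eta * l / (2 * (`|h0| + 1)) by field; rewrite gt_eqF.
  by rewrite ge_min lexx orbT.
have [r1 r10 hlin] := lin _ eta10.
pose r : R := Num.min r1 rho.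
have r0 : 0 < r by rewrite lt_min r10.
have rle x : x < r -> x < r1 /\ x < rho by rewrite lt_min => /andP.
have ltr0Sn4 : 0 < 4 :> R by [].
have [rho1 rho10 hloc] := loc (r / 4) (divr_gt0 r0 ltr0Sn4).
pose K := `|h0| + 2 / l + eta.
have K0 : 0 < K by rewrite ltr_wpDl// addr_ge0// divr_ge0// ltW.
exists rho1, (r / 4 / K); split=> //; first by rewrite !divr_gt0.
move=> Fh q m mp eps u gal mmp eps0 small hFh uc.
have [vq Fv] := hloc u uc; set v := phi u in vq Fv *.
have mp0 : 0 <= mp by exact: le_trans mmp.
pose s := h0 * m; pose tau := 2 / l * eps + eta * mp.
have sle : `|s| <= `|h0| * mp by rewrite normrM ler_wpM2l.
have tau0 : 0 <= tau by rewrite addr_ge0// mulr_ge0// ?divr_ge0// ltW.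
have stau : `|s| + tau <= r / 4.
  move: small; rewrite ler_pdivlMr// => small.
  apply: le_trans small; rewrite /K /tau.
  have e1 : 0 <= `|h0| * eps by rewrite mulr_ge0.
  have e2 : 0 <= 2 / l * mp by rewrite mulr_ge0// divr_ge0// ltW.
  have e3 : 0 <= eta * eps by rewrite mulr_ge0// ltW.
  have -> : (mp + eps) * (`|h0| + 2 / l + eta) = `|h0| * mp + (2 / l * eps + eta * mp) +
     (`|h0| * eps + 2 / l * mp + eta * eps) by ring.
  by rewrite -[leLHS]addr0 lerD ?lerD2r// !addr_ge0.
have key : eps + eta1 * `|s| <= (l - eta1) * tau.
  apply: (@le_trans _ _ (l / 2 * tau)); last by rewrite ler_wpM2r//; lra.
  have -> : l / 2 * tau = eps + eta * l / 2 * mp by rewrite /tau; field; rewrite gt_eqF.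
  rewrite lerD2l (le_trans (ler_wpM2l (ltW eta10) sle))// mulrA ler_wpM2r//.
have ls : l * s = - (kappa * m) by rewrite /s /h0; field; rewrite gt_eqF.
have vr : `|v - q0| < r by lra.
have inball x : `|x| <= r / 2 -> `|v + x - q0| < r.
  move=> xr; have -> : v + x - q0 = v - q0 + x by ring.
  by rewrite (le_lt_trans (ler_normD _ _))//; lra.
have step x : `|x| <= r / 2 -> `|Fh (v + x) - u - (l * x + kappa * m)| <= eps + eta1 * `|x|.
  move=> /inball xb; have [b1 b2] := rle _ xb.
  have := hlin v (v + x) (rle _ vr).1 b1.
  have -> : v + x - v = x by ring.
  move: (hFh _ b2); rewrite Fv => i1 i2.
  have -> : Fh (v + x) - u - (l * x + kappa * m) =
     (Fh (v + x) - F (v + x) - kappa * m) + (F (v + x) - u - l * x) by ring.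
  by rewrite (le_trans (ler_normD _ _))// lerD.
rewrite ler_norml; apply/andP; split.
- rewrite leNgt; apply/negP => lt.
  (* The point is kept within [r / 8] of the claimed bound, so that it stays in the
     neighbourhood however small [q] may be. *)
  pose x : R := Num.max (q - v) (s - tau - r / 8).
  have xlt : x < s - tau.
    by rewrite gt_max; apply/andP; split; move: lt; rewrite -/s -/tau; lra.
  have xge : s - tau - r / 8 <= x by rewrite le_max lexx orbT.
  have qx : q <= v + x.
    have : q - v <= x by rewrite le_max lexx.
    by lra.
  have xr : `|x| <= r / 2.
    have := ler_norm s; have := ler_norm (- s); rewrite normrN ler_norml => i1 i2.
    by apply/andP; split; lra.
  move: qx; rewrite gal leNgt => /negP; apply.
  have := step x xr; rewrite ler_norml => /andP[_ i1].
  pose y := s - x; have ytau : tau < y by rewrite /y; lra.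
  have i2 : `|x| <= `|s| + y.
    have -> : x = s - y by rewrite /y; ring.
    rewrite (le_trans (ler_normB _ _))// lerD2l ger0_norm//; lra.
  have i3 : eta1 * `|x| <= eta1 * `|s| + eta1 * y by rewrite -mulrDr ler_pM2l.
  have i4 : (l - eta1) * tau < l * y - eta1 * y by rewrite -mulrBl ltr_pM2l//; lra.
  have i5 : l * x + kappa * m = - (l * y) by rewrite /y mulrBr ls; ring.
  move: i1 i3 i4 key; rewrite i5; clear.
  move: (eta1 * `|x|) (eta1 * `|s|) (eta1 * y) (l * y) ((l - eta1) * tau) (Fh _) => a1 a2 a3 a4 a5 a6.
  by lra.
- pose x := s + tau.
  suff : q <= v + x by rewrite /x -/s -/tau; lra.
  have xr : `|x| <= r / 2.
    by rewrite (le_trans (ler_normD _ _))// (ger0_norm tau0); lra.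
  rewrite gal.
  have := step x xr; rewrite ler_norml => /andP[i1 _].
  have i2 : `|x| <= `|s| + tau by rewrite (le_trans (ler_normD _ _))// (ger0_norm tau0).
  have i3 : eta1 * `|x| <= eta1 * `|s| + eta1 * tau by rewrite -mulrDr ler_pM2l.
  have i5 : l * x + kappa * m = l * tau by rewrite /x mulrDr ls; ring.
  move: i1 i3 key; rewrite i5 mulrBl; clear.
  move: (eta1 * `|x|) (eta1 * `|s|) (eta1 * tau) (l * tau) (Fh _) => a1 a2 a3 a4 a5.
  by lra.
Qed.


(** A point [s + t] exceeds the quantile as soon as each of the two tails is at most
    half of [1 - u]; for polynomial tails, powers of [1 / (1 - u)] suffice. *)
Lemma quantile_tail_bound (D beta s0 : R) : 0 < D -> 0 < beta -> 0 < s0 ->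
  exists C J, 0 < C /\ forall (G : R -> R) q u M k, 0 < u < 1 -> (2 <= k)%N -> 0 <= M -> 0 <= q ->
    (forall t, (q <= t) = (u <= G t)) ->
    (forall s t, s0 <= s -> 0 < t -> 1 - G (s + t) <= D * s `^ (- beta) + M / t ^+ k) ->
    q ^+ 2 <= C * `|1 - u|^-1 ^+ J * (1 + M).
Proof.
move=> D0 beta0 s00.
(* [B] makes the tail at [B] at most one half, and [v ^ J0] with
   [J0 * beta >= 1] gains the factor [1 / v]. *)
pose B := Num.max s0 ((2 * D) `^ beta^-1).
have Bs0 : s0 <= B by rewrite le_max lexx.
have B0 : 0 < B by exact: lt_le_trans Bs0.
have BD : D * B `^ (- beta) <= 2^-1.
  rewrite powRN ler_pdivrMr ?powR_gt0// mulrC -ler_pdivrMr// invrK mulrC.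
  have -> : 2 * D = ((2 * D) `^ beta^-1) `^ beta.
    by rewrite -powRrM mulVf ?gt_eqF// powRr1// mulr_ge0// ltW.
  by rewrite ge0_ler_powR ?nnegrE ?powR_ge0 ?(ltW B0) ?(ltW beta0)// le_max lexx orbT.
pose J0 := (Num.truncn beta^-1).+1.
have J0b : 1 <= J0%:R * beta.
  rewrite -ler_pdivrMr// mul1r ltW//.
  have := @truncn_itv _ beta^-1; rewrite invr_ge0 (ltW beta0) => /(_ isT)/andP[_].
  by [].
exists (2 * B ^+ 2 + 4), (J0.*2.+1); split; first by rewrite ltr_wpDl// mulr_ge0// sqr_ge0.
move=> G q u M k /andP[u0 u1] k2 M0 q0 gal tail.
have u1' : 0 < 1 - u by rewrite subr_gt0.
rewrite gtr0_norm//; set v := (1 - u)^-1.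
have v1 : 1 <= v by rewrite invf_ge1//; lra.
have v0 : 0 < v by rewrite invr_gt0.
have uv : 1 - u = v^-1 by rewrite invrK.
pose s := B * v ^+ J0; pose t := Num.sqrt (2 * (1 + M) * v).
have tt : t ^+ 2 = 2 * (1 + M) * v by rewrite sqr_sqrtr// !mulr_ge0// ?ltW//; lra.
have t1 : 1 <= t.
  rewrite -(@ler_pXn2r _ 2)// ?nnegrE ?sqrtr_ge0// expr1n tt.
  by rewrite -[1]mul1r ler_pM//; lra.
have vJ1 : 1 <= v ^+ J0 by rewrite exprn_ege1.
have ss0 : s0 <= s.
  by apply: (le_trans Bs0); rewrite ler_peMr// ltW.
have b1 : D * s `^ (- beta) <= v^-1 / 2.
  rewrite /s powRM ?(ltW B0)//; last by rewrite exprn_ge0// ltW.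
  rewrite mulrA [leRHS]mulrC ler_pM ?powR_ge0 ?mulr_ge0 ?powR_ge0 ?(ltW D0)//.
  rewrite -powR_mulrn ?(ltW v0)// -powRrM mulrN powRN lef_pV2 ?posrE ?powR_gt0//.
  by rewrite -[leLHS](powRr1 (ltW v0)) ler_powR.
have b2 : M / t ^+ k <= v^-1 / 2.
  have t2 : t ^+ 2 <= t ^+ k by rewrite ler_weXn2l.
  apply: (@le_trans _ _ (M / t ^+ 2)).
    by rewrite ler_wpM2l// lef_pV2 ?posrE ?exprn_gt0 ?(lt_le_trans _ t1)//.
  rewrite tt ler_pdivrMr ?mulr_gt0//; last by lra.
  have -> : v^-1 / 2 * (2 * (1 + M) * v) = 1 + M by field; rewrite gt_eqF.
  by lra.
have qst : q <= s + t.
  rewrite gal; have := tail s t ss0 (lt_le_trans ltr01 t1).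
  by rewrite -/v -uv in b1 b2 *; lra.
have e1 : q ^+ 2 <= 2 * s ^+ 2 + 2 * t ^+ 2.
  have : q ^+ 2 <= (s + t) ^+ 2 by rewrite ler_pXn2r ?nnegrE// (le_trans q0).
  by have := sqr_ge0 (s - t); clear; lra.
apply: (le_trans e1).
have -> : s ^+ 2 = B ^+ 2 * v ^+ J0.*2 by rewrite /s exprMn -exprM muln2.
rewrite tt.
have e2 : v ^+ J0.*2 <= v ^+ J0.*2.+1 * (1 + M).
  rewrite exprS; have w0 : 0 <= v ^+ J0.*2 by rewrite exprn_ge0// ltW.
  rewrite (mulrC v) -mulrA ler_peMr// -[1]mul1r ler_pM//; lra.
have e3 : (1 + M) * v <= v ^+ J0.*2.+1 * (1 + M).
  rewrite mulrC ler_wpM2r//; first by lra.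
  by rewrite exprS ler_peMr ?(ltW v0)// exprn_ege1.
have -> : 2 * (B ^+ 2 * v ^+ J0.*2) + 2 * (2 * (1 + M) * v) =
   (2 * B ^+ 2) * v ^+ J0.*2 + 4 * ((1 + M) * v) by ring.
rewrite -(mulrA _ (v ^+ _)) (mulrDl (2 * _)).
by apply: lerD; rewrite ler_wpM2l// mulr_ge0// sqr_ge0.
Qed.

End quantile_perturbation.

(** * Means, and the law of a score *)

Section expectation.
Context {R : realType} d (S : measurableType d) (mu : probability S R).
Implicit Types (g h : S -> R) (a : R).

Definition L1 g : Prop := mu.-integrable [set: S] (fun x => (g x)%:E).

Definition mean g : R := \int[mu]_x g x.

Lemma L1_measurable g : L1 g -> measurable_fun setT g.
Proof. by move=> /integrableP[/measurable_EFinP]. Qed.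

Lemma integral_mean g : L1 g -> (\int[mu]_x (g x)%:E = (mean g)%:E)%E.
Proof. by move=> Ig; rewrite /mean /Rintegral fineK//; exact: integrable_fin_num. Qed.

Lemma L1_cst a : L1 (fun=> a).
Proof. exact: finite_measure_integrable_cst. Qed.

Lemma mean_cst a : mean (fun=> a) = a.
Proof. by rewrite /mean Rintegral_cst// [X in fine X]probability_setT mulr1. Qed.

Lemma L1_D g h : L1 g -> L1 h -> L1 (fun x => g x + h x).
Proof. by move=> Ig Ih; exact: (integrableD measurableT Ig Ih). Qed.

Lemma L1_B g h : L1 g -> L1 h -> L1 (fun x => g x - h x).
Proof. by move=> Ig Ih; exact: (integrableB measurableT Ig Ih). Qed.

Lemma L1_Z a g : L1 g -> L1 (fun x => a * g x).
Proof. by move=> Ig; exact: (integrableZl measurableT a Ig). Qed.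

Lemma mean_D g h : L1 g -> L1 h -> mean (fun x => g x + h x) = mean g + mean h.
Proof. by move=> Ig Ih; exact: RintegralD. Qed.

Lemma mean_B g h : L1 g -> L1 h -> mean (fun x => g x - h x) = mean g - mean h.
Proof. by move=> Ig Ih; exact: RintegralB. Qed.

Lemma mean_Z a g : L1 g -> mean (fun x => a * g x) = a * mean g.
Proof. by move=> Ig; exact: RintegralZl. Qed.

Lemma le_mean g h : L1 g -> L1 h -> (forall x, g x <= h x) -> mean g <= mean h.
Proof. by move=> Ig Ih gh; exact: le_Rintegral. Qed.

Lemma mean_ge0 g : (forall x, 0 <= g x) -> 0 <= mean g.
Proof. by move=> g0; exact: Rintegral_ge0. Qed.

Lemma L1_dom g h : measurable_fun setT g -> (forall x, `|g x| <= h x) -> L1 h -> L1 g.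
Proof.
move=> mg gh Ih; apply: (le_integrable _ _ _ Ih) => //; first exact/measurable_EFinP.
by move=> x _ /=; rewrite lee_fin (le_trans (gh x))// ler_norm.
Qed.

Lemma L1_norm g : L1 g -> L1 (fun x => `|g x|).
Proof. by move=> Ig; exact: integrable_norm. Qed.

Lemma le_norm_mean g : L1 g -> `|mean g| <= mean (fun x => `|g x|).
Proof. by move=> Ig; exact: le_normr_Rintegral. Qed.

Lemma norm_mean_le g h : measurable_fun setT g -> (forall x, `|g x| <= h x) -> L1 h ->
  `|mean g| <= mean h.
Proof.
move=> mg gh Ih; have Ig := L1_dom mg gh Ih.
by rewrite (le_trans (le_norm_mean Ig))// le_mean//; exact: L1_norm.
Qed.

Lemma L1_exp_le p k g : (p <= k)%N -> measurable_fun setT g ->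
  L1 (fun x => `|g x| ^+ k) -> L1 (fun x => `|g x| ^+ p).
Proof.
move=> pk mg Ik; apply: (@L1_dom _ (fun x => 1 + `|g x| ^+ k)).
- by apply: measurable_funX; exact: measurableT_comp.
- move=> x; rewrite ger0_norm ?exprn_ge0//.
  have [g1|/ltW g1] := leP `|g x| 1.
    by rewrite -[leLHS]addr0 lerD ?exprn_ge0// exprn_ile1.
  by rewrite (le_trans (ler_weXn2l g1 pk))// lerDr.
- by apply: L1_D => //; exact: L1_cst.
Qed.

Lemma sqr_mean_le g : L1 g -> L1 (fun x => g x ^+ 2) -> mean g ^+ 2 <= mean (fun x => g x ^+ 2).
Proof.
move=> Ig Ig2; set a := mean g.
have I1 : L1 (fun x => 2 * a * g x) by exact: L1_Z.
have I2 : L1 (fun x => g x ^+ 2 - 2 * a * g x) by exact: L1_B.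
have I3 := L1_cst (a ^+ 2).
have : 0 <= mean (fun x => g x ^+ 2 - 2 * a * g x + a ^+ 2).
  apply: mean_ge0 => x; have -> : g x ^+ 2 - 2 * a * g x + a ^+ 2 = (g x - a) ^+ 2 by ring.
  exact: sqr_ge0.
rewrite mean_D// mean_B// mean_Z// mean_cst -/a; lra.
Qed.

End expectation.

Section error_distribution.
Context {R : realType} d (T : measurableType d) (PX : probability T R) (Q : probability R R).
Variable gamma : T -> R.
Hypothesis mgamma : measurable_fun setT gamma.
Local Notation F := (F_abs Q).
Local Notation G := (err_cdf PX Q gamma).

Let A t := [set v : T * R | `|v.2 - gamma v.1| <= t].

Let mA t : measurable (A t).
Proof.
have := measurable_abs_err mgamma; move=> /(_ measurableT _ (measurable_itv `]-oo, t]%R)).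
by rewrite setTI (_ : _ @^-1` _ = A t)//; apply/seteqP; split => v /=; rewrite in_itv.
Qed.

Let xA t x : xsection (A t) x = [set u | `|u - gamma x| <= t].
Proof. by apply/seteqP; split => u /=; rewrite /xsection/= inE. Qed.

Let finS t x : Q (xsection (A t) x) = (shifted_cdf Q t (gamma x))%:E.
Proof.
rewrite xA /shifted_cdf fineK// -xA fin_num_measure//.
exact: measurable_xsection.
Qed.

Lemma measurable_shifted_cdf t : measurable_fun setT (fun x => shifted_cdf Q t (gamma x)).
Proof.
apply/measurable_EFinP.
have := measurable_fun_xsection Q (mA t).
by rewrite (_ : Q \o _ = EFin \o (fun x => shifted_cdf Q t (gamma x)))//; apply/funext => x /=; exact: finS.
Qed.

Lemma shifted_cdf_01 t c : 0 <= shifted_cdf Q t c <= 1.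
Proof.
have mN : measurable_fun setT (fun u : R => `|u - c|).
  by apply: measurableT_comp => //; exact: measurable_funB.
exact: (law_cdf_01 Q mN t).
Qed.

Lemma L1_shifted_cdf t : L1 PX (fun x => shifted_cdf Q t (gamma x)).
Proof.
apply: (L1_dom (measurable_shifted_cdf t) _ (L1_cst PX 1)) => x /=.
by have /andP[h1 h2] := shifted_cdf_01 t (gamma x); rewrite ger0_norm.
Qed.

Lemma err_cdfE t : G t = mean PX (fun x => shifted_cdf Q t (gamma x)).
Proof.
rewrite /err_cdf /mean /Rintegral; congr fine.
by apply: eq_integral => x _ /=; exact: finS.
Qed.

(** A large score comes from a large noise or from a large estimation error. *)
Lemma err_cdf_tail s t k : 0 < t -> (0 < k)%N -> L1 PX (fun x => `|gamma x| ^+ k) ->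
  1 - G (s + t) <= (1 - F s) + mean PX (fun x => `|gamma x| ^+ k) / t ^+ k.
Proof.
move=> t0 k0 Ik; have tk : 0 < t ^+ k by rewrite exprn_gt0.
pose h x := `|gamma x| ^+ k / t ^+ k.
have hE : h = fun x => (t ^+ k)^-1 * `|gamma x| ^+ k by apply/funext => x; rewrite /h mulrC.
have Ih : L1 PX h by rewrite hE; exact: L1_Z.
have -> : mean PX (fun x => `|gamma x| ^+ k) / t ^+ k = mean PX h.
  by rewrite hE mean_Z// mulrC.
rewrite lerBlDr err_cdfE -lerBlDl opprD addrA.
have IS := L1_shifted_cdf (s + t); have IF := L1_cst PX (F s).
have -> : 1 - (1 - F s) - mean PX h = mean PX (fun x => F s - h x).
  by rewrite mean_B// mean_cst; ring.
apply: le_mean => //; first exact: L1_B.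
move=> x; rewrite /h -expr_div_n.
have [tc|ct] := leP t `|gamma x|.
  have h1 : 1 <= (`|gamma x| / t) ^+ k by rewrite exprn_ege1// ler_pdivlMr// mul1r.
  have /andP[s0 s1] := shifted_cdf_01 (s + t) (gamma x); have /andP[] := shifted_cdf_01 s 0.
  by rewrite shifted_cdf0 => f0 f1; lra.
apply: (@le_trans _ _ (F s)); first by rewrite gerBl exprn_ge0// divr_ge0// ltW.
have mN c r : measurable [set u : R | `|u - c| <= r].
  have mN' : measurable_fun setT (fun u : R => `|u - c|).
    by apply: measurableT_comp => //; exact: measurable_funB.
  have := mN' measurableT _ (measurable_itv `]-oo, r]%R).
  by rewrite setTI (_ : _ @^-1` _ = [set u : R | `|u - c| <= r])//; apply/seteqP; split => v /=; rewrite in_itv.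
rewrite -shifted_cdf0 /shifted_cdf fine_le ?fin_num_measure//.
apply: le_measure; rewrite ?inE// => u /=; rewrite subr0 => us.
by rewrite (le_trans (ler_normB _ _))// lerD// ltW.
Qed.

End error_distribution.

(** Where the error is below [rho] the expansion of the shifted law applies; where it
    is not, all the terms are bounded by a multiple of [|gamma x| ^ k]. *)
Lemma err_cdf_expansion {R : realType} d (T : measurableType d) (PX : probability T R)
    (Q : probability R R) (q0 : R) p k (kappa eta : R) :
  shift_expansion Q q0 p kappa -> 0 < eta -> (p <= k)%N ->
  exists rho C : R, [/\ 0 < rho, 0 <= C & forall gamma : T -> R, measurable_fun setT gamma ->
    L1 PX (fun x => `|gamma x| ^+ k) -> forall t, `|t - q0| < rho ->
    `|err_cdf PX Q gamma t - F_abs Q t - kappa * mean PX (fun x => gamma x ^+ p)|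
      <= eta * mean PX (fun x => `|gamma x| ^+ p) + C * mean PX (fun x => `|gamma x| ^+ k)].
Proof.
move=> hS eta0 pk; have [rho0 rho00 h] := hS eta eta0.
pose rho := Num.min rho0 1.
have rho_gt0 : 0 < rho by rewrite lt_min rho00 ltr01.
have rho1 : rho <= 1 by rewrite ge_min lexx orbT.
have rhole : rho <= rho0 by rewrite ge_min lexx.
pose C := (1 + `|kappa|) / rho ^+ k.
have C0 : 0 <= C by rewrite divr_ge0 ?exprn_ge0 ?addr_ge0// ltW.
exists rho, C; split=> // gamma mgamma Ik t tq.
have Ip := L1_exp_le pk mgamma Ik.
have mp : measurable_fun setT (fun x => gamma x ^+ p) by exact: measurable_funX.
have Ip' : L1 PX (fun x => gamma x ^+ p).
  by apply: (L1_dom mp _ Ip) => x; rewrite normrX.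
have IS := L1_shifted_cdf PX Q mgamma t; have IF := L1_cst PX (F_abs Q t).
have IK := L1_Z kappa Ip'.
rewrite err_cdfE// -[F_abs Q t](mean_cst PX) -(mean_Z kappa Ip') -(mean_B IS IF) -(mean_B (L1_B IS IF) IK).
have IR := L1_D (L1_Z eta Ip) (L1_Z C Ik).
rewrite -(mean_Z eta Ip) -(mean_Z C Ik) -(mean_D (L1_Z eta Ip) (L1_Z C Ik)).
apply: (norm_mean_le _ _ IR) => [|x].
  by apply: L1_measurable; exact: L1_B (L1_B IS IF) IK.
move: (gamma x) => c; have [cr|rc] := ltP `|c| rho.
  rewrite (le_trans (h t c _ _))//; [exact: lt_le_trans tq _|exact: lt_le_trans cr _|].
  by rewrite lerDl mulr_ge0// exprn_ge0.
have c0 : 0 < `|c| by exact: lt_le_trans rc.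
have rc1 : 1 <= `|c| / rho by rewrite ler_pdivlMr// mul1r.
rewrite -[leLHS]add0r lerD//; first by rewrite mulr_ge0 ?exprn_ge0// ltW.
rewrite /C mulrAC -mulrA -expr_div_n mulrDl mul1r (le_trans (ler_normB _ _))// lerD//.
  apply: (@le_trans _ _ 1); last by rewrite exprn_ege1.
  have /andP[s0 s1] := shifted_cdf_01 Q t c; have /andP[] := shifted_cdf_01 Q t 0.
  by rewrite shifted_cdf0 => f0 f1; rewrite ler_norml; apply/andP; split; lra.
rewrite normrM normrX ler_wpM2l//.
apply: (@le_trans _ _ ((`|c| / rho) ^+ p)); last by rewrite ler_weXn2l.
by rewrite lerXn2r ?nnegrE// ?divr_ge0 ?(ltW rho_gt0)// ler_pdivlMr// ler_piMr.
Qed.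

Section noise_distribution.
Context {R : realType} (Q : probability R R).
Local Notation F := (F_abs Q).

(** Turns the tail condition on [epsilon] into one on [|epsilon|]. *)
Lemma F_abs_tail s : 1 - F s <= F_eps Q (- s) + (1 - F_eps Q s).
Proof.
have mA : measurable [set u : R | `|u| <= s].
  have := @measurableT_comp _ _ _ _ _ _ (@Num.norm R R) _ id (@normr_measurable R setT) (@measurable_id _ _ setT).
  move=> /(_ measurableT _ (measurable_itv `]-oo, s]%R)).
  by rewrite setTI (_ : _ @^-1` _ = [set u : R | `|u| <= s])//; apply/seteqP; split => v /=; rewrite in_itv.
have fQ (B : set R) : measurable B -> Q B \is a fin_num by move=> mB; rewrite fin_num_measure.
suff : F_eps Q s <= F s + F_eps Q (- s) by lra.
rewrite /F_abs /F_eps -fineD ?fQ// fine_le ?fQ ?fin_numD ?fQ//.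
apply: le_trans (measureU2 _ mA (measurable_itv `]-oo, - s]%R)).
apply: le_measure; rewrite ?inE//; first exact: measurableU.
move=> u /=; rewrite !in_itv/= => us.
have [us'|su] := leP u (- s); first by right.
by left; rewrite ler_norml us (ltW su).
Qed.

End noise_distribution.

(** * Expansion of the quantiles of the scores *)

Lemma truncated_power {R : realType} (p k : nat) (e : R) : (p < k)%N -> (0 < p)%N -> 0 < e ->
  exists2 C : R, 0 <= C & forall x : R, 0 <= x -> x ^+ p <= e + C * x ^+ k.
Proof.
move=> pk p0 e0; pose e1 := Num.min e 1.
have e10 : 0 < e1 by rewrite lt_min e0 ltr01.
exists (e1 ^+ (k - p))^-1 => [|x x0]; first by rewrite invr_ge0 exprn_ge0// ltW.
have [xe|ex] := leP x e1.
  apply: (@le_trans _ _ e); last by rewrite lerDl mulr_ge0 ?invr_ge0 ?exprn_ge0// ltW.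
  apply: (@le_trans _ _ x); last by rewrite (le_trans xe)// ge_min lexx.
  by rewrite ler_iXnr// (le_trans xe)// ge_min lexx orbT.
rewrite -[leLHS]add0r lerD ?(ltW e0)//.
have -> : x ^+ k = x ^+ (k - p) * x ^+ p by rewrite -exprD subnK// ltnW.
rewrite mulrA ler_peMl ?exprn_ge0//.
rewrite mulrC ler_pdivlMr ?exprn_gt0// mul1r lerXn2r ?nnegrE ?(ltW ex)//; exact: ltW.
Qed.

Lemma sqr_sum3_le {R : realType} (x y z : R) :
  (x + y + z) ^+ 2 <= 3 * (x ^+ 2 + y ^+ 2 + z ^+ 2).
Proof.
by have := sqr_ge0 (x - y); have := sqr_ge0 (x - z); have := sqr_ge0 (y - z); lra.
Qed.

Lemma sqr_sub4_le {R : realType} (x y z t : R) :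
  (x - y - z - t) ^+ 2 <= 4 * (x ^+ 2 + y ^+ 2 + z ^+ 2 + t ^+ 2).
Proof.
have := sqr_ge0 (x + y); have := sqr_ge0 (x + z); have := sqr_ge0 (x + t).
by have := sqr_ge0 (y - z); have := sqr_ge0 (y - t); have := sqr_ge0 (z - t); lra.
Qed.

Section quantile_of_errors.
Context {R : realType} d (T : measurableType d) (PX : probability T R) (Q : probability R R).
Implicit Types (g : T -> R) (u t s mu eta rho r e : R).
Local Notation F := (F_abs Q).
Local Notation phi := (quantile (F_abs Q)).
Local Notation phih g := (quantile (err_cdf PX Q g)).
Local Notation mom r g := (mean PX (fun x => g x ^+ r)).
Local Notation amom r g := (mean PX (fun x => `|g x| ^+ r)).
Variables (c q0 rho0 delta kappa : R) (h : R -> R) (p k : nat) (D b s0 : R).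
Hypothesis c01 : 0 < c < 1.
Hypothesis q0E : q0 = phi c.
Hypothesis rho00 : 0 < rho0.
Hypothesis delta0 : 0 < delta.
Hypothesis dF : forall t, `|t - q0| < rho0 -> derivable F t 1 /\ derivable (derive1 F) t 1.
Hypothesis F'ge : forall t, `|t - q0| < rho0 -> delta < derive1 F t.
Hypothesis F''c : forall eta, 0 < eta ->
  exists2 rho : R, 0 < rho & forall t, `|t - q0| < rho ->
  `|derive1 (derive1 F) t - derive1 (derive1 F) q0| <= eta.
Hypothesis hS : shift_expansion Q q0 p kappa.
Hypothesis hq0 : h q0 = - kappa / derive1 F q0.
Hypothesis hc : {for q0, continuous h}.
Hypothesis p0 : (0 < p)%N.
Hypothesis pk : (p < k)%N.
Hypothesis D0 : 0 < D.
Hypothesis b0 : 0 < b.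
Hypothesis s00 : 0 < s0.
Hypothesis tail : forall s, s0 <= s -> 1 - F s <= D * s `^ (- b).

Let F01 t : 0 <= F t <= 1. Proof. exact: (law_cdf_01 Q (@normr_measurable R setT) t). Qed.
Let gal u t : 0 < u < 1 -> (phi u <= t) = (u <= F t).
Proof. exact: (@quantile_leP _ _ _ Q _ (@normr_measurable R setT) (fun=> normr_ge0 _)). Qed.

Let galh g u t : measurable_fun setT g -> 0 < u < 1 -> (phih g u <= t) = (u <= err_cdf PX Q g t).
Proof.
move=> mg; exact: (@quantile_leP _ _ _ (PX \x Q)%E _ (measurable_abs_err mg) (fun=> normr_ge0 _)).
Qed.

Let phih_ge0 g u : measurable_fun setT g -> 0 < u < 1 -> 0 <= phih g u.
Proof.
move=> mg; exact: (@quantile_ge0 _ _ _ (PX \x Q)%E _ (measurable_abs_err mg) (fun=> normr_ge0 _)).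
Qed.

Let q0q0 : `|q0 - q0| < rho0. Proof. by rewrite subrr normr0. Qed.

Let l : R := derive1 F q0.
Let l0 : 0 < l. Proof. exact: lt_trans delta0 (F'ge q0q0). Qed.

Let lin eta : 0 < eta -> exists2 r : R, 0 < r & forall x y : R, `|x - q0| < r -> `|y - q0| < r ->
  `|F y - F x - l * (y - x)| <= eta * `|y - x|.
Proof.
move=> eta0; have [_ d2] := dF q0q0.
have /cvgrPdist_le/(_ _ eta0)/near_ballP[r1 r10 h1] := derivable1_continuous d2.
exists (Num.min r1 rho0) => [|x y]; first by rewrite lt_min r10.
apply: mvt_lin => z; rewrite lt_min => /andP[z1 z2]; first by have [] := dF z2.
by rewrite distrC h1.
Qed.

Let M_ge0 g (r : nat) : 0 <= amom r g. Proof. by apply: mean_ge0 => x; rewrite exprn_ge0. Qed.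

Let mom_le g : measurable_fun setT g -> L1 PX (fun x => `|g x| ^+ k) -> `|mom p g| <= amom p g.
Proof.
move=> mg Ik; apply: (norm_mean_le _ _ (L1_exp_le (ltnW pk) mg Ik)).
  exact: measurable_funX.
by move=> x; rewrite normrX.
Qed.

Let amom_le (r : nat) e : (r < k)%N -> (0 < r)%N -> 0 < e -> exists2 C : R, 0 <= C & forall g,
  measurable_fun setT g -> L1 PX (fun x => `|g x| ^+ k) -> amom r g <= e + C * amom k g.
Proof.
move=> rk r0 e0; have [C C0 hC] := truncated_power rk r0 e0.
exists C => // g mg Ik; have Ip := L1_exp_le (ltnW rk) mg Ik.
rewrite -[e](mean_cst PX) -(mean_Z C Ik) -(mean_D (L1_cst PX e) (L1_Z C Ik)).
by apply: le_mean => // [|x]; [exact: L1_D (L1_cst PX e) (L1_Z C Ik)|exact: hC].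
Qed.

Let phi_loc r : 0 < r -> exists2 rho1 : R, 0 < rho1 &
  forall u, `|u - c| < rho1 -> `|phi u - q0| < r /\ F (phi u) = u.
Proof. exact: (phi_local F01 gal c01 q0E rho00 delta0 dF F'ge). Qed.

Let phi_c : {for c, continuous phi}.
Proof. exact: (phi_cont F01 gal c01 q0E rho00 delta0 dF F'ge). Qed.

Let hphi_c : {for c, continuous (h \o phi)}.
Proof. by apply: continuous_comp; [exact: phi_c|rewrite -q0E; exact: hc]. Qed.

(** [quantile_expand] applied to the scores. A small [k]-th error moment makes the
    [p]-th one small as well, so that the perturbed quantile remains in the
    neighbourhood; the coefficient is moved from [q0] to [phi mu] by continuity. *)
Lemma quantile_error_expansion eta : 0 < eta -> exists C rho M0 : R,
  [/\ 0 <= C, 0 < rho, 0 < M0 & forall g u mu, measurable_fun setT g ->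
    L1 PX (fun x => `|g x| ^+ k) -> amom k g <= M0 -> 0 < u < 1 ->
    `|u - c| < rho -> `|mu - c| < rho ->
    `|phih g u - phi u - h (phi mu) * mom p g| <= eta * amom p g + C * amom k g].
Proof.
move=> eta0.
have eta40 : 0 < eta / 4 by rewrite divr_gt0.
pose eta2 := eta * l / 8.
have eta20 : 0 < eta2 by rewrite divr_gt0// mulr_gt0.
have [rhoS [C1 [rhoS0 C10 hG]]] := err_cdf_expansion PX hS eta20 (ltnW pk).
have [rho1 [tau0 [rho10 tau00 hq]]] := @quantile_expand R F phi c q0 l kappa l0 lin phi_loc _ _ rhoS0 eta40.
have /cvgrPdist_le/(_ _ eta40)/near_ballP[rho2 rho20 hh] := hphi_c.
pose e := tau0 / (4 * (1 + eta2)).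
have e0 : 0 < e by rewrite divr_gt0// mulr_gt0// addr_gt0.
have [C2 C20 hM] := amom_le pk p0 e0.
pose K := (1 + eta2) * C2 + C1 + 1.
have K0 : 0 < K by rewrite ltr_wpDl// addr_ge0// mulr_ge0// addr_ge0// ltW.
exists (2 / l * C1), (Num.min rho1 rho2), (tau0 / 2 / K); split=> //.
- by rewrite mulr_ge0// divr_ge0// ltW.
- by rewrite lt_min rho10.
- by rewrite !divr_gt0.
move=> g u mu mg Ik Mle u01; rewrite !lt_min => /andP[u1 _] /andP[_ mu2].
have mp0 := M_ge0 g p; have Mk0 := M_ge0 g k; have mle := mom_le mg Ik.
have mpM := hM g mg Ik.
move: (hG g mg Ik) (hh mu mu2) => /= {}hG {}hh.
pose eps := eta2 * amom p g + C1 * amom k g.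
have eps0 : 0 <= eps by rewrite addr_ge0// mulr_ge0// ltW.
have small : amom p g + eps <= tau0.
  have -> : amom p g + eps = (1 + eta2) * amom p g + C1 * amom k g by rewrite /eps; ring.
  apply: (@le_trans _ _ ((1 + eta2) * (e + C2 * amom k g) + C1 * amom k g)).
    by rewrite lerD2r ler_wpM2l// addr_ge0// ltW.
  have -> : (1 + eta2) * (e + C2 * amom k g) + C1 * amom k g = tau0 / 4 + (K - 1) * amom k g.
    by rewrite /e /K; field; rewrite gt_eqF// addr_gt0.
  have : K * amom k g <= tau0 / 2 by rewrite mulrC -ler_pdivlMr.
  by move: Mk0 tau00; rewrite mulrBl mul1r; move: (K * _) => x; lra.
have := hq _ _ (mom p g) (amom p g) eps u (fun t => galh t mg u01) mle eps0 small
  hG u1.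
have hq0' : - kappa / l = h (phi c) by rewrite -q0E hq0.
rewrite hq0' => H.
have -> : phih g u - phi u - h (phi mu) * mom p g =
  (phih g u - phi u - h (phi c) * mom p g) + (h (phi c) - h (phi mu)) * mom p g by ring.
apply: (le_trans (ler_normD _ _)); rewrite normrM.
apply: (@le_trans _ _ ((2 / l * eps + eta / 4 * amom p g) + eta / 4 * amom p g)).
  by rewrite lerD// ler_pM.
have -> : 2 / l * eps = eta / 4 * amom p g + 2 / l * C1 * amom k g.
  by rewrite /eps /eta2; field; rewrite gt_eqF.
have : 0 <= eta * amom p g by rewrite mulr_ge0// ltW.
have -> : eta / 4 * amom p g = (eta * amom p g) / 4 by ring.
by lra.
Qed.

(** A bound at all levels, for the part of the space where no expansion holds. *)
Lemma quantile_error_bound : exists C J, 0 < C /\ forall g u, measurable_fun setT g ->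
  L1 PX (fun x => `|g x| ^+ k) -> 0 < u < 1 ->
  phih g u ^+ 2 <= C * `|1 - u|^-1 ^+ J * (1 + amom k g).
Proof.
have [C [J [C0 H]]] := @quantile_tail_bound R D b s0 D0 b0 s00.
exists C, J; split=> // g u mg Ik u01.
apply: (H (err_cdf PX Q g) _ _ _ k) => //.
- exact: leq_ltn_trans pk.
- exact: phih_ge0.
- by move=> t; exact: galh.
move=> s t ss t0; apply: (le_trans (err_cdf_tail Q mg s t0 _ Ik)); first exact: leq_ltn_trans pk.
by rewrite lerD2r; exact: tail.
Qed.

Let locally_bounded (f : R -> R) : {for c, continuous f} ->
  exists2 r : R, 0 < r & forall x : R, `|x - c| < r -> `|f x| <= `|f c| + 1.
Proof.
move=> /cvgrPdist_le/(_ _ ltr01)/near_ballP[r r0 hr]; exists r => // x /hr fx.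
have -> : f x = f c - (f c - f x) by ring.
by rewrite (le_trans (ler_normB _ _))// lerD2l.
Qed.

Variables phi1 phi2 : R -> R.
Hypothesis phi1E : derive1 phi = phi1.
Hypothesis phi2E : derive1 phi1 = phi2.

Let phi_reg : exists2 r : R, 0 < r & forall u, `|u - c| < r ->
  derivable phi u 1 /\ derivable phi1 u 1.
Proof.
have [r r0 hr] := phi_regular F01 gal c01 q0E rho00 delta0 dF F'ge.
by exists r => // u /hr[h1 h2 _ _ _]; rewrite -phi1E.
Qed.

Let phi1_c : {for c, continuous phi1}.
Proof.
have [r r0 hr] := phi_reg.
have [|_ d2] := hr c; first by rewrite subrr normr0.
exact: derivable1_continuous d2.
Qed.

Let phi2_c eta : 0 < eta -> exists2 r : R, 0 < r & forall u, `|u - c| < r ->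
  `|phi2 u - phi2 c| <= eta.
Proof.
move=> eta0; rewrite -phi2E -phi1E.
exact: (phi_second_cont F01 gal c01 q0E rho00 delta0 dF F'ge F''c).
Qed.

Lemma coefficient_bound : exists B r : R, [/\ 0 < B, 0 < r & forall mu, `|mu - c| < r ->
  [/\ 0 < mu < 1, `|phi mu| <= B, `|phi1 mu| <= B, `|phi2 mu| <= B &
     `|h (phi mu)| <= B]].
Proof.
have [r1 r10 h1] := locally_bounded phi_c.
have [r2 r20 h2] := locally_bounded phi1_c.
have [r3 r30 h3] := phi2_c ltr01.
have [r4 r40 h4] := locally_bounded hphi_c.
have /andP[c0 c1] := c01.
pose r := Num.min (Num.min c (1 - c)) (Num.min (Num.min r1 r2) (Num.min r3 r4)).
pose B := 1 + `|phi c| + `|phi1 c| + `|phi2 c| + `|h (phi c)|.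
exists B, r; split.
- by rewrite /B -!addrA ltr_wpDr// !addr_ge0.
- by rewrite !lt_min c0 subr_gt0 c1 r10 r20 r30 r40.
move=> mu; rewrite !lt_min => /andP[/andP[a1 a2] /andP[/andP[m1 m2] /andP[m3 m4]]].
have b1 := normr_ge0 (phi c); have b2 := normr_ge0 (phi1 c).
have b3 := normr_ge0 (phi2 c); have b4 := normr_ge0 (h (phi c)).
split.
- by move: a1 a2; rewrite !ltr_norml => /andP[? ?] /andP[? ?]; apply/andP; split; lra.
- by rewrite (le_trans (h1 _ m1))// /B; lra.
- by rewrite (le_trans (h2 _ m2))// /B; lra.
- have := h3 _ m3; have := ler_normD (phi2 mu - phi2 c) (phi2 c).
  by rewrite subrK /B; lra.
- by rewrite (le_trans (h4 _ m4))// /B /=; lra.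
Qed.

Let level_inv_ge1 u (J : nat) : 0 < u < 1 -> 1 <= `|1 - u|^-1 ^+ J.
Proof.
move=> /andP[u0 u1]; rewrite exprn_ege1// invf_ge1 ?normr_gt0 ?subr_eq0 ?gt_eqF//.
by rewrite gtr0_norm ?subr_gt0//; lra.
Qed.

Let level_dist u mu : 0 < u < 1 -> 0 < mu < 1 -> `|u - mu| <= 1.
Proof. by move=> /andP[? ?] /andP[? ?]; rewrite ler_norml; apply/andP; split; lra. Qed.

(* Outside the neighbourhood where the expansion is valid, a constant is
   dominated by the k-th error moment or by the fourth power of the deviation. *)
Let far_bound (M0 rho M x : R) : 0 < M0 -> 0 < rho -> 0 <= M -> M0 < M \/ rho <= `|x| ->
  1 + M <= (1 + M0^-1 + (rho ^+ 4)^-1) * (M + x ^+ 4).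
Proof.
move=> M00 r0 M_ge0' far; have x4 : 0 <= x ^+ 4 by rewrite exprn_even_ge0.
have i0 : 0 <= M0^-1 by rewrite invr_ge0 ltW.
have r4 : 0 < rho ^+ 4 by rewrite exprn_gt0.
have j0 : 0 <= (rho ^+ 4)^-1 by rewrite invr_ge0 ltW.
have : 1 <= M0^-1 * M + (rho ^+ 4)^-1 * x ^+ 4.
  case: far => [MM|rx].
    have : 1 <= M0^-1 * M by rewrite mulrC ler_pdivlMr// mul1r ltW.
    by have : 0 <= (rho ^+ 4)^-1 * x ^+ 4 by [rewrite mulr_ge0|]; lra.
  have : 1 <= (rho ^+ 4)^-1 * x ^+ 4.
    rewrite mulrC ler_pdivlMr// mul1r -[leRHS]ger0_norm// normrX.
    by rewrite lerXn2r ?nnegrE// ltW.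
  by have : 0 <= M0^-1 * M by [rewrite mulr_ge0|]; lra.
have a1 : 0 <= M0^-1 * x ^+ 4 by rewrite mulr_ge0.
have a2 : 0 <= (rho ^+ 4)^-1 * M by rewrite mulr_ge0.
move: a1 a2; rewrite !mulrDl !mulrDr !mul1r.
move: (M0^-1 * M) (M0^-1 * x ^+ 4) (_^-1 * M) (_^-1 * x ^+ 4) => y1 y2 y3 y4; lra.
Qed.

(** In the neighbourhood, the expansion of the quantiles of the scores and the
    Taylor formula for [phi] add up. Outside, [far_bound] absorbs the crude bound
    into the last term. *)
Lemma quantile_second_order eta : 0 < eta -> exists (C rho : R) (J : nat),
  [/\ 0 <= C, 0 < rho & forall g u mu, measurable_fun setT g ->
    L1 PX (fun x => `|g x| ^+ k) -> 0 < u < 1 -> `|mu - c| < rho ->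
    `|phih g u - phi mu - phi1 mu * (u - mu)
       - phi2 mu / 2 * (u - mu) ^+ 2 - h (phi mu) * mom p g|
    <= eta * (amom p g + (u - mu) ^+ 2)
       + C * `|1 - u|^-1 ^+ J * (amom k g + (u - c) ^+ 4)].
Proof.
move=> eta0; have eta20 : 0 < eta / 2 by rewrite divr_gt0.
have [C1 [rho1 [M0 [C10 rho10 M00 hE]]]] := quantile_error_expansion eta20.
have [A [J [A0 hA]]] := quantile_error_bound.
have [B [rB [B0 rB0 hB]]] := coefficient_bound.
have [C2 C20 hM] := amom_le pk p0 ltr01.
have [r2 r20 h2] := phi2_c eta20.
have [r3 r30 h3] := phi_reg.
pose rho := Num.min (Num.min rho1 rB) (Num.min r2 r3).
have rho_gt0 : 0 < rho by rewrite !lt_min rho10 rB0 r20.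
have rhoP x : x < rho -> [/\ x < rho1, x < rB, x < r2 & x < r3].
  by rewrite !lt_min => /andP[/andP[-> ->] /andP[-> ->]].
pose A' := 1 + A + 4 * B + B * C2.
have A'0 : 0 <= A' by rewrite !addr_ge0 ?mulr_ge0// ltW.
pose E := 1 + M0^-1 + (rho ^+ 4)^-1.
have E0 : 0 <= E by rewrite !addr_ge0// invr_ge0 ?exprn_ge0// ltW.
exists (C1 + A' * E), rho, J; split=> //; first by rewrite addr_ge0// mulr_ge0.
move=> g u mu mg Ik u01 muc; have [muc1 mucB muc2 muc3] := rhoP _ muc.
have [mu01 f0 f1 f2 hm] := hB mu mucB.
have Mk0 := M_ge0 g k; have Mp0 := M_ge0 g p; have mle := mom_le mg Ik; have MpM := hM g mg Ik.
have V1 := level_inv_ge1 J u01; have hu := level_dist u01 mu01.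
have hA' := hA g u mg Ik u01.
move: V1 hA'; set V := _ ^+ J => V1 hA'.
have V0 : 0 <= V by exact: le_trans V1.
have x4 : 0 <= (u - c) ^+ 4 by rewrite exprn_even_ge0.
have [/andP[good1 good2]|bad] := boolP ((amom k g <= M0) && (`|u - c| < rho)).
  have [uc1 ucB uc2 uc3] := rhoP _ good2.
  have X1 := hE g u mu mg Ik good1 u01 uc1 muc1.
  have X2 : `|phi u - phi mu - phi1 mu * (u - mu) - phi2 c / 2 * (u - mu) ^+ 2|
      <= eta / 2 * (u - mu) ^+ 2.
    have := @taylor2 _ phi c rho (phi2 c) (eta / 2) (ltW eta20); rewrite phi1E phi2E; apply=> //.
      by move=> x /rhoP[_ _ _ /h3].
    by move=> x /rhoP[_ _ /h2].
  have X3 : `|(phi2 c - phi2 mu) / 2 * (u - mu) ^+ 2|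
      <= eta / 4 * (u - mu) ^+ 2.
    have d0 : 0 <= (u - mu) ^+ 2 by exact: sqr_ge0.
    rewrite normrM (ger0_norm d0) ler_wpM2r//.
    by rewrite normrM distrC gtr0_norm ?invr_gt0//; have := h2 mu muc2; lra.
  have X4 : C1 * amom k g <= (C1 + A' * E) * V * (amom k g + (u - c) ^+ 4).
    apply: ler_pM => //; last by rewrite lerDl.
    rewrite mulrDl -[leLHS]addr0 lerD ?ler_peMr//.
    by rewrite mulr_ge0// mulr_ge0.
  have -> : phih g u - phi mu - phi1 mu * (u - mu)
       - phi2 mu / 2 * (u - mu) ^+ 2 - h (phi mu) * mom p g =
    (phih g u - phi u - h (phi mu) * mom p g) +
    (phi u - phi mu - phi1 mu * (u - mu) - phi2 c / 2 * (u - mu) ^+ 2) +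
    (phi2 c - phi2 mu) / 2 * (u - mu) ^+ 2 by ring.
  apply: (le_trans (ler_normD _ _)); apply: (le_trans (lerD (ler_normD _ _) (lexx _))).
  apply: (le_trans (lerD (lerD X1 X2) X3)).
  have Y1 : 0 <= eta * amom p g by rewrite mulr_ge0// ltW.
  have Y2 : 0 <= eta * (u - mu) ^+ 2 by rewrite mulr_ge0 ?sqr_ge0// ltW.
  rewrite mulrDr.
  have -> : eta / 2 * amom p g = eta * amom p g / 2 by ring.
  have -> : eta / 2 * (u - mu) ^+ 2 = eta * (u - mu) ^+ 2 / 2 by ring.
  have -> : eta / 4 * (u - mu) ^+ 2 = eta * (u - mu) ^+ 2 / 4 by ring.
  move: X4 Y1 Y2; move: (eta * _) (eta * _) (C1 * _) (_ * _ * _) => y1 y2 y3 y4; lra.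
have far : M0 < amom k g \/ rho <= `|u - c|.
  by move: bad; rewrite negb_and -!(ltNge, leNgt) => /orP.
have X1 := far_bound M00 rho_gt0 Mk0 far; rewrite -/E in X1.
apply: (@le_trans _ _ (A' * V * (1 + amom k g))); last first.
  rewrite -[leLHS]add0r lerD//.
    by rewrite mulr_ge0 ?addr_ge0 ?sqr_ge0// ltW.
  apply: (@le_trans _ _ (A' * V * (E * (amom k g + (u - c) ^+ 4)))).
    by rewrite ler_wpM2l// mulr_ge0.
  have -> : A' * V * (E * (amom k g + (u - c) ^+ 4)) = A' * E * (V * (amom k g + (u - c) ^+ 4)) by ring.
  by rewrite -[leRHS]mulrA ler_wpM2r ?mulr_ge0 ?addr_ge0// lerDr.
have T1 : `|phih g u| <= 1 + A * V * (1 + amom k g).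
  rewrite ger0_norm ?phih_ge0//.
  have := sqr_ge0 (phih g u - 1); have := sqr_ge0 (phih g u).
  by move: hA'; rewrite sqrrB1; move: (A * V * _) (phih g u) (phih g u ^+ 2) => y z w; lra.
have T2 : `|phi1 mu * (u - mu)| <= B by rewrite normrM -[B]mulr1 ler_pM.
have T3 : `|phi2 mu / 2 * (u - mu) ^+ 2| <= B.
  have i20 : 0 < 2^-1 :> R by rewrite invr_gt0.
  rewrite normrM -[B]mulr1 ler_pM//.
    by rewrite normrM (gtr0_norm i20); move: (`|_|) f2 => y; lra.
  by rewrite normrX exprn_ile1.
have T4 : `|h (phi mu) * mom p g| <= B * (1 + C2 * amom k g).
  by rewrite normrM ler_pM// (le_trans mle).
apply: (le_trans (ler_normB _ _)); apply: (le_trans (lerD (ler_normB _ _) T4)).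
apply: (le_trans (lerD (lerD (ler_normB _ _) T3) (lexx _))).
apply: (le_trans (lerD (lerD (lerD (ler_normB _ _) T2) (lexx _)) (lexx _))).
apply: (le_trans (lerD (lerD (lerD (lerD T1 f0) (lexx _)) (lexx _)) (lexx _))).
have W : 1 + amom k g <= V * (1 + amom k g) by rewrite ler_peMl// addr_ge0.
have Z1 : (1 + 4 * B + B * C2) * (1 + amom k g) <= (1 + 4 * B + B * C2) * (V * (1 + amom k g)).
  by rewrite ler_wpM2l// !addr_ge0 ?mulr_ge0// ltW.
have -> : A' * V * (1 + amom k g) = A * V * (1 + amom k g) + (1 + 4 * B + B * C2) * (V * (1 + amom k g)).
  by rewrite /A'; ring.
have Z2 : 0 <= B * amom k g by rewrite mulr_ge0// ltW.
have Z3 : 0 <= B * C2 by rewrite mulr_ge0// ltW.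
have Z4 : 1 + B + B + B + B * (1 + C2 * amom k g) <= (1 + 4 * B + B * C2) * (1 + amom k g).
  have -> : (1 + 4 * B + B * C2) * (1 + amom k g) =
    1 + B + B + B + B * (1 + C2 * amom k g) + (B * C2 + amom k g + 4 * (B * amom k g)) by ring.
  by rewrite lerDl !addr_ge0// mulr_ge0.
move: Z1 Z4; move: (A * V * _) (B * (1 + _)) (_ * (1 + _)) (_ * (V * _)) => y1 y2 y3 y4; lra.
Qed.

(** For the variance only the first-order expansion of the quantile function is
    needed, but with a bound on the square of the remainder. *)
Lemma quantile_first_order eta : (p.*2 < k)%N -> 0 < eta -> exists (C rho : R) (J : nat),
  [/\ 0 <= C, 0 < rho & forall g u mu, measurable_fun setT g ->
    L1 PX (fun x => `|g x| ^+ k) -> 0 < u < 1 -> `|mu - c| < rho ->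
    (phih g u - phi mu - phi1 mu * (u - mu) - h (phi mu) * mom p g) ^+ 2
    <= eta * (amom p.*2 g + (u - mu) ^+ 2)
       + C * `|1 - u|^-1 ^+ J * (amom k g + (u - c) ^+ 4)].
Proof.
move=> p2k eta0.
pose e1 := Num.min 1 (eta / 12).
have e10 : 0 < e1 by rewrite lt_min ltr01 divr_gt0.
have e1sq : e1 ^+ 2 <= eta / 12.
  apply: (@le_trans _ _ e1); last by rewrite ge_min lexx orbT.
  by rewrite ler_iXnr// ?(ltW e10)// ge_min lexx.
have p20 : (0 < p.*2)%N by rewrite double_gt0.
have [C1 [rho1 [M0 [C10 rho10 M00 hE]]]] := quantile_error_expansion e10.
have [A [J [A0 hA]]] := quantile_error_bound.
have [B [rB [B0 rB0 hB]]] := coefficient_bound.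
have [C2 C20 hM] := amom_le p2k p20 ltr01.
have /cvgrPdist_le/(_ _ e10)/near_ballP[r2 r20 h2] := phi1_c.
have [r3 r30 h3] := phi_reg.
pose rho := Num.min (Num.min rho1 rB) (Num.min r2 r3).
have rho_gt0 : 0 < rho by rewrite !lt_min rho10 rB0 r20.
have rhoP x : x < rho -> [/\ x < rho1, x < rB, x < r2 & x < r3].
  by rewrite !lt_min => /andP[/andP[-> ->] /andP[-> ->]].
pose A' := 4 * A + 4 * (3 * B ^+ 2 + B ^+ 2 * C2).
have A'0 : 0 <= A' by rewrite !addr_ge0 ?mulr_ge0 ?addr_ge0 ?mulr_ge0 ?sqr_ge0// ltW.
pose E := 1 + M0^-1 + (rho ^+ 4)^-1.
have E0 : 0 <= E by rewrite !addr_ge0// invr_ge0 ?exprn_ge0// ltW.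
have C30 : 0 <= 3 * (C1 ^+ 2 * M0) by rewrite !mulr_ge0 ?sqr_ge0// ltW.
exists (3 * (C1 ^+ 2 * M0) + A' * E), rho, J; split=> //; first by rewrite addr_ge0// mulr_ge0.
move=> g u mu mg Ik u01 muc; have [muc1 mucB muc2 muc3] := rhoP _ muc.
have [mu01 f0 f1 _ hm] := hB mu mucB.
have Mk0 := M_ge0 g k; have Mp0 := M_ge0 g p; have mle := mom_le mg Ik.
have M2p0 := M_ge0 g p.*2; have MpM := hM g mg Ik.
have mp2 : amom p g ^+ 2 <= amom p.*2 g.
  have e2 : (fun x => `|g x| ^+ p.*2) = (fun x => (`|g x| ^+ p) ^+ 2).
    by apply/funext => x; rewrite -exprM muln2.
  rewrite e2; apply: sqr_mean_le; first exact: L1_exp_le (ltnW pk) mg Ik.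
  by rewrite -e2; exact: L1_exp_le (ltnW p2k) mg Ik.
have V1 := level_inv_ge1 J u01; have hu := level_dist u01 mu01.
have hA' := hA g u mg Ik u01.
move: V1 hA'; set V := _ ^+ J => V1 hA'.
have V0 : 0 <= V by exact: le_trans V1.
have x4 : 0 <= (u - c) ^+ 4 by rewrite exprn_even_ge0.
have [/andP[good1 good2]|bad] := boolP ((amom k g <= M0) && (`|u - c| < rho)).
  have [uc1 ucB uc2 uc3] := rhoP _ good2.
  have X1 := hE g u mu mg Ik good1 u01 uc1 muc1.
  have X2 : `|phi u - phi mu - phi1 c * (u - mu)| <= e1 * `|u - mu|.
    have := @mvt_lin _ phi c rho (phi1 c) e1; rewrite phi1E; apply=> //.
      by move=> x /rhoP[_ _ _ /h3[]].
    by move=> x /rhoP[_ _ /h2]; rewrite distrC.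
  have X3 : `|(phi1 c - phi1 mu) * (u - mu)| <= e1 * `|u - mu|.
    by rewrite normrM ler_wpM2r//; exact: h2.
  have -> : phih g u - phi mu - phi1 mu * (u - mu) - h (phi mu) * mom p g =
    (phih g u - phi u - h (phi mu) * mom p g) +
    ((phi u - phi mu - phi1 c * (u - mu)) + (phi1 c - phi1 mu) * (u - mu)) by ring.
  move: X1 X2 X3; move: (_ - _ - _ * mom p g) => z1.
  move: (_ - _ - _ * (u - mu)) => z2; move: (_ * (u - mu)) => z3 X1 X2 X3.
  have X : `|z1 + (z2 + z3)| <= e1 * amom p g + C1 * amom k g + 2 * (e1 * `|u - mu|).
    rewrite (le_trans (ler_normD _ _))//; have := ler_normD z2 z3.
    by move: X1 X2 X3; move: (e1 * `|u - mu|) (e1 * amom p g) (C1 * amom k g) => y1 y2 y3; lra.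
  rewrite -[leLHS]ger0_norm ?sqr_ge0// normrX.
  apply: (le_trans (lerXn2r 2 _ _ X)).
  - by rewrite nnegrE.
  - by rewrite nnegrE !addr_ge0 ?mulr_ge0// ltW.
  apply: (le_trans (sqr_sum3_le _ _ _)).
  have Y1 : (e1 * amom p g) ^+ 2 <= eta / 12 * amom p.*2 g.
    by rewrite exprMn ler_pM ?sqr_ge0.
  have Y2 : (2 * (e1 * `|u - mu|)) ^+ 2 <= eta / 3 * (u - mu) ^+ 2.
    have -> : (2 * (e1 * `|u - mu|)) ^+ 2 = 4 * e1 ^+ 2 * (u - mu) ^+ 2.
      by rewrite !exprMn real_normK ?num_real//; ring.
    by rewrite ler_wpM2r ?sqr_ge0//; lra.
  have Y3 : (C1 * amom k g) ^+ 2 <= C1 ^+ 2 * M0 * amom k g.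
    by rewrite exprMn (expr2 (amom k g)) mulrA ler_wpM2r// ler_wpM2l ?sqr_ge0.
  have X4 : 3 * (C1 ^+ 2 * M0) * amom k g <=
     (3 * (C1 ^+ 2 * M0) + A' * E) * V * (amom k g + (u - c) ^+ 4).
    move: C30; move: (3 * _) => K3 K30.
    apply: ler_pM => //; last by rewrite lerDl.
    rewrite mulrDl -[leLHS]addr0 lerD ?ler_peMr//.
    by rewrite mulr_ge0// mulr_ge0.
  have Z1 : 0 <= eta * amom p.*2 g by rewrite mulr_ge0// ltW.
  move: Y1 Y2 Y3 X4 Z1; rewrite !mulrDr.
  have -> : eta / 12 * amom p.*2 g = eta * amom p.*2 g / 12 by ring.
  have -> : eta / 3 * (u - mu) ^+ 2 = eta * (u - mu) ^+ 2 / 3 by ring.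
  rewrite -(mulrA 3).
  move: (eta * amom p.*2 g) (eta * (u - mu) ^+ 2) (C1 ^+ 2 * M0 * amom k g) => y1 y2 y3.
  move: ((_ + _) * V * amom k g) ((_ + _) * V * (u - c) ^+ 4) => y4 y5.
  move: ((e1 * amom p g) ^+ 2) ((C1 * amom k g) ^+ 2) ((2 * (e1 * `|u - mu|)) ^+ 2) => w1 w2 w3; lra.
have far : M0 < amom k g \/ rho <= `|u - c|.
  by move: bad; rewrite negb_and -!(ltNge, leNgt) => /orP.
have X1 := far_bound M00 rho_gt0 Mk0 far; rewrite -/E in X1.
apply: (@le_trans _ _ (A' * V * (1 + amom k g))); last first.
  rewrite -[leLHS]add0r lerD//.
    by rewrite mulr_ge0 ?addr_ge0 ?sqr_ge0// ltW.
  apply: (@le_trans _ _ (A' * V * (E * (amom k g + (u - c) ^+ 4)))).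
    by rewrite ler_wpM2l// mulr_ge0.
  have -> : A' * V * (E * (amom k g + (u - c) ^+ 4)) = A' * E * (V * (amom k g + (u - c) ^+ 4)) by ring.
  by rewrite -[leRHS]mulrA ler_wpM2r ?mulr_ge0 ?addr_ge0// lerDr.
apply: (le_trans (sqr_sub4_le _ _ _ _)).
have sqle (x y : R) : `|x| <= y -> x ^+ 2 <= y ^+ 2.
  by move=> xy; rewrite -[leLHS]ger0_norm ?sqr_ge0// normrX lerXn2r ?nnegrE// (le_trans _ xy).
have T1 := sqle _ _ f0.
have T2 : (phi1 mu * (u - mu)) ^+ 2 <= B ^+ 2.
  by apply: sqle; rewrite normrM -[B]mulr1 ler_pM.
have T3 : (h (phi mu) * mom p g) ^+ 2 <= B ^+ 2 * (1 + C2 * amom k g).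
  rewrite exprMn ler_pM ?sqr_ge0 ?sqle// (le_trans (sqle _ _ mle))//.
  exact: le_trans MpM.
have W : 1 + amom k g <= V * (1 + amom k g) by rewrite ler_peMl// addr_ge0.
have B20 := sqr_ge0 B.
have Z1 : (3 * B ^+ 2 + B ^+ 2 * C2) * (1 + amom k g) <= (3 * B ^+ 2 + B ^+ 2 * C2) * (V * (1 + amom k g)).
  by rewrite ler_wpM2l//; apply: addr_ge0; rewrite mulr_ge0.
have -> : A' * V * (1 + amom k g) =
  4 * (A * V * (1 + amom k g) + (3 * B ^+ 2 + B ^+ 2 * C2) * (V * (1 + amom k g))).
  by rewrite /A'; ring.
have Z2 : 0 <= B ^+ 2 * amom k g by rewrite mulr_ge0.
have Z3 : 0 <= B ^+ 2 * C2 by rewrite mulr_ge0.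
have Z4 : B ^+ 2 + B ^+ 2 + B ^+ 2 * (1 + C2 * amom k g) <= (3 * B ^+ 2 + B ^+ 2 * C2) * (1 + amom k g).
  have -> : (3 * B ^+ 2 + B ^+ 2 * C2) * (1 + amom k g) =
    B ^+ 2 + B ^+ 2 + B ^+ 2 * (1 + C2 * amom k g) + (B ^+ 2 * C2 + 3 * (B ^+ 2 * amom k g)) by ring.
  by rewrite lerDl; apply: addr_ge0; rewrite // mulr_ge0.
rewrite ler_pM2l//; move: hA' T1 T2 T3 Z1 Z4.
move: (A * V * (1 + amom k g)) (B ^+ 2 * (1 + C2 * amom k g)) => y1 y2.
move: ((3 * B ^+ 2 + B ^+ 2 * C2) * (1 + amom k g)) ((3 * B ^+ 2 + B ^+ 2 * C2) * _) => y3 y4.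
move: (phih g u ^+ 2) (B ^+ 2) (phi mu ^+ 2) ((phi1 mu * (u - mu)) ^+ 2) ((h _ * _) ^+ 2).
move=> y5 y6 y7 y8 y9; lra.
Qed.


End quantile_of_errors.

(** * Local regularity from the smoothness condition *)

Lemma near_nat2P (P : nat -> nat -> Prop) :
  (\forall n1 \near \oo & n2 \near \oo, P n1 n2) <->
  exists N, forall n1 n2, (N <= n1)%N -> (N <= n2)%N -> P n1 n2.
Proof.
split=> [[[A B] /= [[N1 _ hA] [N2 _ hB]] h]|[N h]].
  exists (maxn N1 N2) => n1 n2; rewrite !geq_max => /andP[a1 _] /andP[_ a2].
  by apply: (h (n1, n2)); split; [exact: hA|exact: hB].
exists ([set n | (N <= n)%N], [set n | (N <= n)%N]).
  by split; exists N.
by move=> [n1 n2] /= [a1 a2]; exact: h.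
Qed.

Lemma dist_half_half {R : realType} (x y z eta : R) :
  `|x - z| <= eta / 2 -> `|y - z| <= eta / 2 -> `|x - y| <= eta.
Proof.
move=> xz yz; have -> : x - y = (x - z) - (y - z) by ring.
by rewrite (le_trans (ler_normB _ _))//; lra.
Qed.

Section local_regularity.
Context {R : realType} (Q : probability R R).
Local Notation F := (F_abs Q).
Local Notation Fe := (F_eps Q).
Implicit Types (delta alpha t c rho : R).

(** What remains of the smoothness condition once the windows are replaced by a
    fixed neighbourhood. *)
Definition regular_near (c rho delta : R) : Prop :=
  let q0 := quantile F c in
  [/\ 0 < q0, 0 < rho, 0 < delta,
    (forall t : R, `|t - q0| < rho -> [/\ derivable F t 1 /\ derivable (derive1 F) t 1,
       derivable Fe t 1 /\ derivable (derive1 Fe) t 1,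
       derivable Fe (- t) 1 /\ derivable (derive1 Fe) (- t) 1 & delta < derive1 F t]) &
    forall eta : R, 0 < eta -> exists2 r : R, 0 < r & forall t : R, `|t - q0| < r ->
      `|derive1 (derive1 F) t - derive1 (derive1 F) q0| <= eta].

(** The windows around the levels [mu_alpha] are wide enough to contain the limit
    level [1 - alpha], at distance at most [1 / (N + 1)]. *)
Lemma log_ratio_lower (N : nat) : (0 < N)%N ->
  N.+1%:R^-1 <= Num.sqrt (ln (N + N)%:R / (N + N)%:R) :> R.
Proof.
move=> N0; have N0' : 0 < N%:R :> R by rewrite ltr0n.
have NN0 : 0 < (N + N)%:R :> R by rewrite ltr0n addn_gt0 N0.
have ln2 : 2^-1 <= ln (N + N)%:R :> R.
  have := @le_ln1Dx R ((N + N)%:R^-1 - 1).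
  rewrite ltrBrDr addrC subrr invr_gt0 NN0 => /(_ isT).
  rewrite addrCA subrr addr0 lnV ?posrE//.
  have : (N + N)%:R^-1 <= 2^-1 :> R.
    by rewrite lef_pV2 ?posrE// ler_nat; lia.
  by lra.
rewrite -[leLHS]ger0_norm ?invr_ge0// -sqrtr_sqr ler_wsqrtr//.
rewrite exprVn ler_pdivlMr// mulrC ler_pdivrMr ?exprn_gt0//.
apply: (@le_trans _ _ (2^-1 * N.+1%:R ^+ 2)); last by rewrite ler_wpM2r ?exprn_ge0.
rewrite -(natr1 N) natrD; move: (N%:R : R) => x.
have -> : 2^-1 * (x + 1) ^+ 2 = x + x + (x - 1) ^+ 2 / 2 by field.
by rewrite lerDl divr_ge0// sqr_ge0.
Qed.

Lemma mu_alpha_dist alpha (n : nat) : 0 < alpha < 1 ->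
  0 <= mu_alpha alpha n - (1 - alpha) <= n.+1%:R^-1.
Proof.
move=> a01; have /andP[l u] := m_alpha_bounds n a01.
have n0 : 0 < n.+1%:R :> R by rewrite ltr0n.
rewrite /mu_alpha subr_ge0 ler_pdivlMr// mulrC l/= lerBlDr ler_pdivrMr// mulrDl mulVf ?gt_eqF//.
by rewrite addrC (mulrC (1 - _)) ltW.
Qed.

(** The window for one pair of sizes [(N, N)], chosen large, contains a whole
    neighbourhood of the [(1 - alpha)]-quantile: its width in [y] is positive, and
    [x = 1 - alpha - mu_alpha] is allowed. Hence the smoothness conditions hold on a
    fixed neighbourhood, and the [o (1)] condition is the continuity of [F'']. *)
Lemma cond_S_regular delta alpha K (beta : nat -> R) r :
  0 < delta <= 1 -> 0 < alpha < 1 -> cond_S Q delta alpha K beta r ->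
  exists k : nat, [/\ (r < k)%N, (k <= K)%N, beta r < beta k &
    exists rho : R, regular_near (1 - alpha) rho delta].
Proof.
move=> /andP[d0 d1] a01 [k [gamma [/andP[rk kK] /andP[g0 gk] h1 h2 h3]]].
have k0 : 0 < k%:R :> R by rewrite ltr0n (leq_ltn_trans _ rk).
exists k; split=> //.
  by rewrite -subr_gt0 -(pmulr_lgt0 _ (_ : 0 < k%:R^-1)) ?invr_gt0// (lt_trans g0).
pose q0 := quantile F (1 - alpha).
pose D n1 n2 := window Q delta gamma (mu_alpha alpha n2) (n1 + n2).
pose a1 (N : nat) : R := delta^-1 * (N + N)%:R `^ (- gamma).
have a1_gt0 N : (0 < N)%N -> 0 < a1 N.
  by move=> N0; rewrite mulr_gt0 ?invr_gt0// powR_gt0// ltr0n addn_gt0 N0.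
have inD N t : (0 < N)%N -> `|t - q0| <= a1 N -> D N N t.
  move=> N0 tq; exists (1 - alpha - mu_alpha alpha N), (t - q0); split => //.
    have /andP[m1 m2] := mu_alpha_dist N a01.
    rewrite -normrN opprB ger0_norm// (le_trans m2)//.
    apply: (le_trans (log_ratio_lower N0)).
    by rewrite ler_peMl ?sqrtr_ge0// invf_ge1.
  have -> : mu_alpha alpha N + (1 - alpha - mu_alpha alpha N) = 1 - alpha by ring.
  by rewrite -/q0 addrC subrK.
have [N1 H1] := (near_nat2P _).1 h1.
have [N2 H2] := (near_nat2P _).1 h2.
pose N := (maxn N1 N2).+1; have N0 : (0 < N)%N by [].
have NN1 : (N1 <= N)%N by rewrite /N; lia.
have NN2 : (N2 <= N)%N by rewrite /N; lia.
have dn t : `|t - q0| < a1 N ->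
  [/\ derivable F t 1 /\ derivable (derive1 F) t 1,
       derivable Fe t 1 /\ derivable (derive1 Fe) t 1,
       derivable Fe (- t) 1 /\ derivable (derive1 Fe) (- t) 1 & delta < derive1 F t].
  move=> /ltW/(inD N t N0) Dt.
  have [[e1 e2] [e3 e4] [e5 e6]] := H1 N N NN1 NN1 t Dt.
  have n1 := nbhs_singleton e1; have n3 := nbhs_singleton e3; have n5 := nbhs_singleton e5.
  split; [by []|by []|by []|].
  have [e7 _ _ _] := H2 N N NN2 NN2.
  rewrite -lte_fin (lt_le_trans e7)//; apply: ereal_inf_lbound; by exists t.
have aN := a1_gt0 _ N0.
have qq : `|q0 - q0| < a1 N by rewrite subrr normr0.
exists (a1 N); split=> //.
- have q0_ge0 : 0 <= q0.
    apply: (@quantile_ge0 _ _ _ Q _ (@normr_measurable R setT) (fun=> normr_ge0 _)).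
    by case/andP: a01 => ? ?; apply/andP; split; lra.
  rewrite lt_neqAle q0_ge0 andbT; apply/negP => /eqP q00.
  (* [F] vanishes on the negative half-line, so its slope would be zero close to
     [q0 = 0]. *)
  have tq : `|- (a1 N / 2) - q0| < a1 N.
    have q00' : q0 = 0 := esym q00.
    by rewrite q00' subr0 normrN gtr0_norm ?divr_gt0//; lra.
  have [_ _ _ ] := dn _ tq.
  have nz : \forall x \near (- (a1 N / 2)), cst 0 x = F x.
    apply/near_ballP; exists (a1 N / 2); first by rewrite divr_gt0.
    move=> x; rewrite ltr_norml => /andP[_ hx].
    rewrite /=; apply/esym/(@law_cdf_neg _ _ _ Q _ (fun=> normr_ge0 _)); lra.
  have id0 := is_derive_cst (0 : R) (- (a1 N / 2)) (1 : R).
  have := near_eq_is_derive nz id0.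
  by rewrite derive1E => /@derive_val ->; rewrite ltNge ltW.
- move=> eta eta0; have eta20 : 0 < eta / 2 by rewrite divr_gt0.
  have [N3 H3] := (near_nat2P _).1 (h3 _ eta20).
  pose N' := N3.+1; have N'0 : (0 < N')%N by [].
  exists (a1 N'); first exact: a1_gt0.
  move=> t tq; have H := H3 N' N' (leqnSn _) (leqnSn _).
  have le s : `|s - q0| <= a1 N' ->
      `|derive1n 2 F s - derive1n 2 F (quantile F (mu_alpha alpha N'))| <= eta / 2.
    move=> sq; rewrite -lee_fin; apply: le_trans H; apply: ereal_sup_ubound.
    by exists s => //; exact: inD.
  have l1 := le t (ltW tq).
  have l2 : `|derive1n 2 F q0 - derive1n 2 F (quantile F (mu_alpha alpha N'))| <= eta / 2.
    by apply: le; rewrite subrr normr0 ltW// a1_gt0.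
  exact: dist_half_half l1 l2.
Qed.

End local_regularity.

(** * The coefficients of the expansions *)

Lemma gt_neq0 {R : realType} (a x : R) : 0 < a -> a < x -> x != 0.
Proof. by move=> a0 ax; rewrite gt_eqF// (lt_trans a0). Qed.

Lemma double_neq0 {R : realType} (a x y : R) : 0 < a -> a < x -> x = 2 * y -> y != 0.
Proof. by move=> a0 ax xy; rewrite gt_eqF//; lra. Qed.

Lemma double_dist {R : realType} (a b x y eta : R) : a = 2 * x -> b = 2 * y ->
  `|a - b| <= eta * 2 -> `|y - x| <= eta.
Proof.
by move=> -> ->; rewrite -mulrBr normrM distrC ger0_norm//; move: (`|_|) => z; lra.
Qed.

Section coefficients.
Context {R : realType} (Q : probability R R).
Local Notation F := (F_abs Q).
Local Notation Fe := (F_eps Q).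

(** [h] is the function that appears in the theorem; only its value and continuity
    at [q0] matter, as it is evaluated at points that tend to [q0]. *)
Definition shift_coefficient (q0 : R) (p : nat) (h : R -> R) : Prop :=
  exists kappa, [/\ shift_expansion Q q0 p kappa, h q0 = - kappa / derive1 F q0 &
    {for q0, continuous h}].

Variables (c rho delta : R).
Hypothesis reg : regular_near Q c rho delta.
Let q0 := quantile F c.

Let q0q0 : `|q0 - q0| < rho.
Proof. by case: reg => _ r0 _ _ _; rewrite subrr normr0. Qed.

Lemma H_abs_coefficient : shift_coefficient q0 1 (H_abs Q).
Proof.
have [q00 r0 d0 hd _] := reg.
have [[_ c1] [_ c2] [_ c3] dl] := hd _ q0q0.
have {}c1 := derivable1_continuous c1.
have {}c2 := derivable1_continuous c2.
have {}c3 := derivable1_continuous c3.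
exists (derive1 Fe q0 - derive1 Fe (- q0)); split; last 1 first.
- rewrite /H_abs; apply: cvgM.
    apply: cvgN; apply: cvgB; first exact: c2.
    apply: (@continuous_comp _ _ _ (fun x : R => - x) (derive1 Fe)); last exact: c3.
    exact: opp_continuous.
  apply: cvgV; last exact: c1.
  exact: gt_neq0 d0 dl.
- have hd' t : `|t - q0| < rho -> derivable Fe t 1 /\ derivable Fe (- t) 1.
    by move=> tq; have [_ [e1 _] [e2 _] _] := hd t tq; split; [exact: e1|exact: e2].
  exact: (shift_expansion1 q00 r0 hd' c2 c3).
- exact: erefl.
Qed.

Lemma symmetric_F_abs : symmetric_law Q -> forall t, `|t - q0| < rho -> 0 <= t -> F t = 2 * Fe t - 1.
Proof.
have [q00 r0 d0 hd _] := reg => sQ t tq t0.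
have [_ [e1 _] [e2 _] _] := hd t tq.
rewrite -shifted_cdf0 shifted_cdfE//; last by rewrite sub0r; exact: derivable1_continuous e2.
rewrite add0r sub0r symmetric_F_eps//; last exact: derivable1_continuous e1.
by ring.
Qed.

(** For a symmetric law [F = 2 Fe - 1] on the positive half-line. *)
Lemma symmetric_F_abs_derive : symmetric_law Q -> exists2 r : R, 0 < r & forall t, `|t - q0| < r ->
  derive1 F t = 2 * derive1 Fe t /\ derive1 (derive1 F) t = 2 * derive1 (derive1 Fe) t.
Proof.
move=> sQ; have [q00 r0 d0 hd _] := reg.
pose r := Num.min rho q0.
have r_gt0 : 0 < r by rewrite lt_min r0.
have rP x : x < r -> x < rho /\ x < q0 by rewrite lt_min => /andP.
have near_ball t : `|t - q0| < r -> exists2 e : R, 0 < e & forall s, `|s - t| < e -> `|s - q0| < r.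
  move=> tq; exists (r - `|t - q0|); first by rewrite subr_gt0.
  by move=> s; rewrite ltrBrDr; apply: le_lt_trans; exact: ler_distD.
have E0 t : `|t - q0| < r -> F t = 2 * Fe t - 1.
  move=> tq; have [h1 h2] := rP _ tq; apply: symmetric_F_abs => //.
  by move: h2; rewrite ltr_norml => /andP[]; lra.
have E1 t : `|t - q0| < r -> derive1 F t = 2 * derive1 Fe t.
  move=> tq; have [h1 h2] := rP _ tq; have [_ [e1 _] _ _] := hd t h1.
  have id1 : is_derive t 1 Fe (derive1 Fe t) by apply: DeriveDef; [exact: e1|rewrite (derive1E Fe)].
  have id2 : is_derive t 1 (fun s => 2 * Fe s) (2 *: derive1 Fe t) by exact: is_deriveZ.
  have id3 : is_derive t 1 (fun s => 2 * Fe s - 1) (2 *: derive1 Fe t - 0) by exact: is_deriveB.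
  have [e e0 he] := near_ball t tq.
  have nE : \forall s \near t, (2 * Fe s - 1) = F s.
    by apply/near_ballP; exists e => // s /he/E0 ->.
  have := near_eq_is_derive nE id3.
  by move=> /@derive_val; rewrite (derive1E F) subr0 => ->.
exists r => // t tq; split; first exact: E1.
have [h1 h2] := rP _ tq; have [_ [_ e1] _ _] := hd t h1.
have id1 : is_derive t 1 (derive1 Fe) (derive1 (derive1 Fe) t).
  by apply: DeriveDef; [exact: e1|rewrite (derive1E (derive1 Fe))].
have id2 : is_derive t 1 (fun s => 2 * derive1 Fe s) (2 *: derive1 (derive1 Fe) t) by exact: is_deriveZ.
have [e e0 he] := near_ball t tq.
have nE : \forall s \near t, 2 * derive1 Fe s = derive1 F s.
  by apply/near_ballP; exists e => // s /he/E1 ->.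
have := near_eq_is_derive nE id2.
by move=> /@derive_val; rewrite (derive1E (derive1 F)) => ->.
Qed.

Lemma G_eps_coefficient : symmetric_law Q -> shift_coefficient q0 2 (G_eps Q).
Proof.
move=> sQ; have [q00 r0 d0 hd hc] := reg.
have [r r_gt0 hr] := symmetric_F_abs_derive sQ.
have [_ [e1 e2] _ dl] := hd _ q0q0.
have [E1 E2] : derive1 F q0 = 2 * derive1 Fe q0 /\ derive1 (derive1 F) q0 = 2 * derive1 (derive1 Fe) q0.
  by apply: hr; rewrite subrr normr0.
have F'0 : derive1 Fe q0 != 0.
  exact: double_neq0 d0 dl E1.
have cF'' : {for q0, continuous (derive1 (derive1 Fe))}.
  apply/cvgrPdist_le => eta eta0; have eta20 : 0 < eta * 2 by rewrite mulr_gt0.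
  have [r1 r10 h1] := hc _ eta20.
  apply/near_ballP; exists (Num.min r r1); first by rewrite lt_min r_gt0.
  move=> x; rewrite lt_min => /andP[x1 x2].
  have [_ E3] := hr x x1.
  exact: double_dist E3 E2 (h1 x x2).
exists (derive1 (derive1 Fe) q0); split.
- have hd' t : `|t - q0| < rho ->
      [/\ derivable Fe t 1, derivable Fe (- t) 1 & derivable (derive1 Fe) t 1].
    by move=> tq; have [_ [a1 a2] [a3 _] _] := hd t tq; split; [exact: a1|exact: a3|exact: a2].
  exact: (shift_expansion2 q00 r0 sQ hd' cF'').
- rewrite E1; exact: erefl.
- rewrite /G_eps; apply: cvgM; first exact: cvgN.
  apply: cvgV; first exact: mulf_neq0 (lt0r_neq0 (ltr0n R 2)) F'0.
  apply: cvgM; first exact: cvg_cst.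
  exact: derivable1_continuous e2.
Qed.

End coefficients.

Section expansions_at.
Context {R : realType} d (T : measurableType d) (PX : probability T R) (Q : probability R R).
Local Notation phi := (quantile (F_abs Q)).
Local Notation phih g := (quantile (err_cdf PX Q g)).
Local Notation mom r g := (mean PX (fun x => g x ^+ r)).
Local Notation amom r g := (mean PX (fun x => `|g x| ^+ r)).

(** The conclusions of [quantile_second_order] and [quantile_first_order], with
    constants that depend neither on the estimation error nor on the levels. *)
Definition second_order_at (c : R) (p k : nat) (h : R -> R) : Prop :=
  forall eta : R, 0 < eta -> exists (C rho : R) (J : nat),
  [/\ 0 <= C, 0 < rho & forall (g : T -> R) (u mu : R), measurable_fun setT g ->
    L1 PX (fun x => `|g x| ^+ k) -> 0 < u < 1 -> `|mu - c| < rho ->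
    `|phih g u - phi mu - derive1 phi mu * (u - mu)
       - derive1 (derive1 phi) mu / 2 * (u - mu) ^+ 2 - h (phi mu) * mom p g|
    <= eta * (amom p g + (u - mu) ^+ 2)
       + C * `|1 - u|^-1 ^+ J * (amom k g + (u - c) ^+ 4)].

Definition first_order_at (c : R) (p k : nat) (h : R -> R) : Prop :=
  forall eta : R, 0 < eta -> exists (C rho : R) (J : nat),
  [/\ 0 <= C, 0 < rho & forall (g : T -> R) (u mu : R), measurable_fun setT g ->
    L1 PX (fun x => `|g x| ^+ k) -> 0 < u < 1 -> `|mu - c| < rho ->
    (phih g u - phi mu - derive1 phi mu * (u - mu) - h (phi mu) * mom p g) ^+ 2
    <= eta * (amom p.*2 g + (u - mu) ^+ 2)
       + C * `|1 - u|^-1 ^+ J * (amom k g + (u - c) ^+ 4)].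

Variables (c rho delta beta_eps : R) (p k : nat) (h : R -> R).
Hypothesis c01 : 0 < c < 1.
Hypothesis reg : regular_near Q c rho delta.
Hypothesis T0 : cond_T Q delta beta_eps.
Hypothesis hcoef : shift_coefficient Q (quantile (F_abs Q) c) p h.
Hypothesis p0 : (0 < p)%N.

Let tail : forall s : R, delta^-1 <= s -> 1 - F_abs Q s <= delta^-1 * s `^ (- beta_eps).
Proof.
move=> s ds; have [_ _ d0 _ _] := reg; have [_ hT] := T0.
rewrite (le_trans (F_abs_tail Q s))// -[X in _ <= _ * X `^ _]ger0_norm; first exact: hT.
by rewrite (le_trans _ ds)// invr_ge0 ltW.
Qed.

Lemma second_order_expansion : (p < k)%N -> second_order_at c p k h.
Proof.
move=> pk; have [_ r0 d0 hd hc] := reg; have [b0 _] := T0; have [kappa [k1 k2 k3]] := hcoef.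
have di0 : 0 < delta^-1 by rewrite invr_gt0.
have hd1 t : `|t - phi c| < rho -> derivable (F_abs Q) t 1 /\ derivable (derive1 (F_abs Q)) t 1.
  by move=> /hd[].
have hd2 t : `|t - phi c| < rho -> delta < derive1 (F_abs Q) t by move=> /hd[].
move=> eta; exact: (@quantile_second_order R d T PX Q c (phi c) rho delta kappa h p k _ _ _ c01 erefl
  r0 d0 hd1 hd2 hc k1 k2 k3 p0 pk di0 b0 di0 tail _ _ erefl erefl).
Qed.

Lemma first_order_expansion : (p.*2 < k)%N -> first_order_at c p k h.
Proof.
move=> pk; have [_ r0 d0 hd hc] := reg; have [b0 _] := T0; have [kappa [k1 k2 k3]] := hcoef.
have di0 : 0 < delta^-1 by rewrite invr_gt0.
have pk' : (p < k)%N by apply: leq_trans pk; rewrite ltnS -addnn leq_addr.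
have hd1 t : `|t - phi c| < rho -> derivable (F_abs Q) t 1 /\ derivable (derive1 (F_abs Q)) t 1.
  by move=> /hd[].
have hd2 t : `|t - phi c| < rho -> delta < derive1 (F_abs Q) t by move=> /hd[].
move=> eta; exact: (@quantile_first_order R d T PX Q c (phi c) rho delta kappa h p k _ _ _ c01 erefl
  r0 d0 hd1 hd2 hc k1 k2 k3 p0 pk' di0 b0 di0 tail _ _ erefl erefl eta pk).
Qed.

Lemma coefficients_bounded : exists B r : R, [/\ 0 < B, 0 < r & forall mu : R, `|mu - c| < r ->
  `|derive1 phi mu| <= B /\ `|h (phi mu)| <= B].
Proof.
have [_ r0 d0 hd hc] := reg; have [kappa [_ _ k3]] := hcoef.
have hd1 t : `|t - phi c| < rho -> derivable (F_abs Q) t 1 /\ derivable (derive1 (F_abs Q)) t 1.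
  by move=> /hd[].
have hd2 t : `|t - phi c| < rho -> delta < derive1 (F_abs Q) t by move=> /hd[].
have [B [r [B0 r_gt0 hB]]] := coefficient_bound c01 erefl r0 d0 hd1 hd2 hc k3 erefl erefl.
by exists B, r; split=> // mu /hB[_ _ b1 _ b2].
Qed.

End expansions_at.

(** * Equality in law and product laws *)

Section same_law.
Context {R : realType} d (S : measurableType d) d' (S' : measurableType d').
Context (mu : probability S R) (nu : probability S' R) (X : S -> R) (Y : S' -> R).
Hypothesis mX : measurable_fun setT X.
Hypothesis mY : measurable_fun setT Y.
Hypothesis XY : forall A : set R, measurable A -> mu (X @^-1` A) = nu (Y @^-1` A).

(** The identities below transport the mean and the variance of the length to the
    product space where the coupling is defined. *)
Lemma same_law_integral (g : R -> \bar R) : measurable_fun setT g ->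
  (\int[mu]_x g (X x) = \int[nu]_y g (Y y))%E.
Proof.
move=> mg.
have ge0 (h : R -> \bar R) : measurable_fun setT h -> (forall x, 0 <= h x)%E ->
    (\int[mu]_x h (X x) = \int[nu]_y h (Y y))%E.
  move=> mh h0; pose X' : {RV mu >-> R} := mfun_Sub (mem_set mX).
  pose Y' : {RV nu >-> R} := mfun_Sub (mem_set mY).
  rewrite -[LHS](ge0_integral_distribution X' mh h0) -[RHS](ge0_integral_distribution Y' mh h0).
  by apply: eq_measure_integral => A mA _; exact: XY.
rewrite integralE [RHS]integralE; congr (_ - _)%E.
  rewrite (eq_integral (fun x => (g^\+)%E (X x))); last by move=> x _; rewrite !funeposE.
  rewrite [RHS](eq_integral (fun y => (g^\+)%E (Y y))); last by move=> x _; rewrite !funeposE.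
  by apply: ge0 => [|x]; [exact: measurable_funepos|exact: funepos_ge0].
rewrite (eq_integral (fun x => (g^\-)%E (X x))); last by move=> x _; rewrite !funenegE.
rewrite [RHS](eq_integral (fun y => (g^\-)%E (Y y))); last by move=> x _; rewrite !funenegE.
by apply: ge0 => [|x]; [exact: measurable_funeneg|exact: funeneg_ge0].
Qed.

Lemma same_law_expectation : ('E_mu[X] = 'E_nu[Y])%E.
Proof.
rewrite !unlock; apply: (same_law_integral (g := EFin)).
by apply/measurable_EFinP; exact: measurable_id.
Qed.

Lemma same_law_L1 : L1 nu Y -> L1 mu X.
Proof.
move=> /integrableP[_ hY]; apply/integrableP; split; first exact/measurable_EFinP.
have := same_law_integral (g := fun x => `|x%:E|%E).
move=> ->; first exact: hY.
by apply: measurableT_comp => //; apply/measurable_EFinP; exact: measurable_id.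
Qed.

Lemma same_law_variance : ('V_mu[X] = 'V_nu[Y])%E.
Proof.
rewrite /variance !covariance.unlock same_law_expectation unlock.
set a := fine _.
have mg : measurable_fun setT (fun x : R => ((x - a) * (x - a))%:E).
  by apply/measurable_EFinP; apply: measurable_funM; exact: measurable_funB.
exact: (same_law_integral mg).
Qed.

End same_law.

Lemma expectation_mean {R : realType} d (S : measurableType d) (mu : probability S R) (X : S -> R) :
  L1 mu X -> ('E_mu[X] = (mean mu X)%:E)%E.
Proof. by move=> IX; rewrite unlock; exact: integral_mean. Qed.

Lemma variance_mean {R : realType} d (S : measurableType d) (mu : probability S R) (X : S -> R) :
  L1 mu X -> L1 mu (fun x => (X x - mean mu X) ^+ 2) ->
  ('V_mu[X] = (mean mu (fun x => (X x - mean mu X) ^+ 2))%:E)%E.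
Proof.
move=> IX IX2; rewrite /variance covariance.unlock (expectation_mean IX) unlock.
by rewrite -(integral_mean IX2).
Qed.

Section product.
Context {R : realType} d (S : measurableType d) d' (S' : measurableType d').
Context (mu : probability S R) (nu : probability S' R).
Let Pr : probability (S * S')%type R := (mu \x nu)%E.

Let fst_law (f : S -> R) : measurable_fun setT f -> forall A : set R, measurable A ->
  Pr ((fun z => f z.1) @^-1` A) = mu (f @^-1` A).
Proof.
move=> mf A mA; rewrite (_ : _ @^-1` A = (f @^-1` A) `*` setT); last first.
  by apply/seteqP; split => z /=; [move=> ?; split|case].
have mfA : measurable (f @^-1` A) by rewrite -[X in measurable X]setTI; exact: mf.
by rewrite [LHS]product_measure1E// [X in (_ * X)%E]probability_setT mule1.
Qed.

Let snd_law (f : S' -> R) : measurable_fun setT f -> forall A : set R, measurable A ->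
  Pr ((fun z => f z.2) @^-1` A) = nu (f @^-1` A).
Proof.
move=> mf A mA; rewrite (_ : _ @^-1` A = setT `*` (f @^-1` A)); last first.
  by apply/seteqP; split => z /=; [move=> ?; split|case].
have mfA : measurable (f @^-1` A) by rewrite -[X in measurable X]setTI; exact: mf.
by rewrite [LHS]product_measure1E// [X in (X * _)%E]probability_setT mul1e.
Qed.

Lemma L1_fst f : L1 mu f -> L1 Pr (fun z => f z.1) /\ mean Pr (fun z => f z.1) = mean mu f.
Proof.
move=> If; have mf := L1_measurable If.
have mf1 : measurable_fun setT (fun z : S * S' => f z.1) by exact: measurableT_comp.
split; first exact: (same_law_L1 mf1 mf (fst_law mf)).
rewrite /mean /Rintegral; congr fine.
apply: (same_law_integral mf1 mf (fst_law mf) (g := EFin)).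
by apply/measurable_EFinP; exact: measurable_id.
Qed.

Lemma L1_snd f : L1 nu f -> L1 Pr (fun z => f z.2) /\ mean Pr (fun z => f z.2) = mean nu f.
Proof.
move=> If; have mf := L1_measurable If.
have mf1 : measurable_fun setT (fun z : S * S' => f z.2) by exact: measurableT_comp.
split; first exact: (same_law_L1 mf1 mf (snd_law mf)).
rewrite /mean /Rintegral; congr fine.
apply: (same_law_integral mf1 mf (snd_law mf) (g := EFin)).
by apply/measurable_EFinP; exact: measurable_id.
Qed.

(** Independence of the two coordinates, by Fubini. *)
Lemma mean_prod_centered f g : L1 nu g -> mean nu g = 0 -> L1 Pr (fun z => f z.1 * g z.2) ->
  mean Pr (fun z => f z.1 * g z.2) = 0.
Proof.
move=> Ig g0 Ifg; rewrite /mean /Rintegral.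
rewrite -[X in fine X](integral12_prod_meas1 Ifg) /fubini_F /=.
rewrite integral0_eq// => x _.
by rewrite (integral_mean (L1_Z (f x) Ig)) (mean_Z (f x) Ig) g0 mulr0.
Qed.

End product.

(** * Moments of an expansion in independent variables *)

Section second_moments.
Context {R : realType} d (S : measurableType d) (mu : probability S R).
Implicit Types (g h r : S -> R) (a t : R).

Lemma L1_of_sqr g : measurable_fun setT g -> L1 mu (fun x => g x ^+ 2) -> L1 mu g.
Proof.
move=> mg Ig; apply: (L1_dom mg _ (L1_D (L1_cst mu 1) Ig)) => x.
rewrite -[X in _ + X]ger0_norm ?sqr_ge0// normrX.
by move: (normr_ge0 (g x)); move: (`|g x|) => y y0; have := sqr_ge0 (y - 1); lra.
Qed.

Lemma L1_sqr_center g a : measurable_fun setT g -> L1 mu (fun x => g x ^+ 2) ->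
  L1 mu (fun x => (g x - a) ^+ 2).
Proof.
move=> mg Ig; have Ig1 := L1_of_sqr mg Ig.
have -> : (fun x => (g x - a) ^+ 2) = (fun x => g x ^+ 2 - (2 * a) * g x + a ^+ 2).
  by apply/funext => x; ring.
exact: L1_D (L1_B Ig (L1_Z (2 * a) Ig1)) (L1_cst mu (a ^+ 2)).
Qed.

Lemma L1_mul g h : measurable_fun setT g -> measurable_fun setT h ->
  L1 mu (fun x => g x ^+ 2) -> L1 mu (fun x => h x ^+ 2) -> L1 mu (fun x => g x * h x).
Proof.
move=> mg mh Ig Ih; apply: (L1_dom _ _ (L1_D Ig Ih)) => [|x]; first exact: measurable_funM.
rewrite ler_norml; move: (g x) (h x) => y z.
have := sqr_ge0 (y - z); have := sqr_ge0 (y + z); have := sqr_ge0 y; have := sqr_ge0 z.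
by move=> ? ? ? ?; apply/andP; split; lra.
Qed.

Lemma mean_sqr_center_le g : measurable_fun setT g -> L1 mu (fun x => g x ^+ 2) ->
  mean mu (fun x => (g x - mean mu g) ^+ 2) <= mean mu (fun x => g x ^+ 2).
Proof.
move=> mg Ig; have Ig1 := L1_of_sqr mg Ig; set a := mean mu g.
have -> : (fun x => (g x - a) ^+ 2) = (fun x => g x ^+ 2 - (2 * a) * g x + a ^+ 2).
  by apply/funext => x; ring.
rewrite (mean_D (L1_B Ig (L1_Z (2 * a) Ig1)) (L1_cst mu (a ^+ 2))).
rewrite (mean_B Ig (L1_Z (2 * a) Ig1)) (mean_Z _ Ig1) mean_cst -/a.
by have := sqr_ge0 a; rewrite expr2; lra.
Qed.

(** The cross term is split by [2 |g r| <= t g ^ 2 + r ^ 2 / t], the Cauchy-Schwarz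
    inequality with a free parameter. *)
Lemma mean_sqr_perturb g r t : 0 < t -> measurable_fun setT g -> measurable_fun setT r ->
  L1 mu (fun x => g x ^+ 2) -> L1 mu (fun x => r x ^+ 2) ->
  L1 mu (fun x => (g x + r x) ^+ 2) /\
  `|mean mu (fun x => (g x + r x) ^+ 2) - mean mu (fun x => g x ^+ 2)|
    <= t * mean mu (fun x => g x ^+ 2) + (1 + t^-1) * mean mu (fun x => r x ^+ 2).
Proof.
move=> t0 mg mr Ig Ir; have Igr := L1_mul mg mr Ig Ir.
have E : (fun x => (g x + r x) ^+ 2) = (fun x => g x ^+ 2 + (2 * (g x * r x) + r x ^+ 2)).
  by apply/funext => x; ring.
have I2 := L1_D (L1_Z 2 Igr) Ir.
split; first by rewrite E; exact: L1_D.
rewrite E (mean_D Ig I2) addrAC subrr add0r.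
rewrite -(mean_Z t Ig) -(mean_Z (1 + t^-1) Ir) -(mean_D (L1_Z t Ig) (L1_Z (1 + t^-1) Ir)).
apply: (norm_mean_le _ _ (L1_D (L1_Z t Ig) (L1_Z (1 + t^-1) Ir))) => [|x].
  exact: L1_measurable I2.
move: (g x) (r x) => y z.
have ti0 : 0 < t^-1 by rewrite invr_gt0.
have h1 : 0 <= t^-1 * (t * y - z) ^+ 2 by rewrite mulr_ge0 ?sqr_ge0// ltW.
have h2 : 0 <= t^-1 * (t * y + z) ^+ 2 by rewrite mulr_ge0 ?sqr_ge0// ltW.
have e1 : t^-1 * (t * y - z) ^+ 2 = t * y ^+ 2 - 2 * (y * z) + t^-1 * z ^+ 2 by field; rewrite gt_eqF.
have e2 : t^-1 * (t * y + z) ^+ 2 = t * y ^+ 2 + 2 * (y * z) + t^-1 * z ^+ 2 by field; rewrite gt_eqF.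
have e3 : (1 + t^-1) * z ^+ 2 = z ^+ 2 + t^-1 * z ^+ 2 by ring.
have e4 : 2 * (y * z) + z ^+ 2 = z ^+ 2 + 2 * (y * z) by ring.
rewrite e3 e4; rewrite {}e1 in h1; rewrite {}e2 in h2.
move: h1 h2 (sqr_ge0 z); clear.
move: (t * y ^+ 2) (t^-1 * z ^+ 2) (z ^+ 2) (y * z) => y1 y2 y3 y4 h1 h2 h3.
by rewrite ler_norml; apply/andP; split; lra.
Qed.

End second_moments.

Section nonnegative_integrals.
Context {R : realType} d (S : measurableType d) (nu : probability S R).
Implicit Types (f g : S -> \bar R).
Local Open Scope ereal_scope.

Lemma ge0_intD f g : measurable_fun setT f -> measurable_fun setT g ->
  (forall x, 0 <= f x) -> (forall x, 0 <= g x) ->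
  \int[nu]_x (f x + g x) = \int[nu]_x f x + \int[nu]_x g x.
Proof. by move=> mf mg f0 g0; rewrite ge0_integralD. Qed.

Lemma ge0_intZ (k : R) f : measurable_fun setT f -> (forall x, 0 <= f x) -> (0 <= k)%R ->
  \int[nu]_x (k%:E * f x) = k%:E * \int[nu]_x f x.
Proof. by move=> mf f0 k0; rewrite ge0_integralZl_EFin. Qed.

Lemma int_cst (k : \bar R) : \int[nu]_x k = k.
Proof. by rewrite integral_cst// [X in _ * X]probability_setT mule1. Qed.

Lemma ge0_int_affine (k : R) f : measurable_fun setT f -> (forall x, 0 <= f x) -> (0 <= k)%R ->
  \int[nu]_x (f x + k%:E) = \int[nu]_x f x + k%:E.
Proof. by move=> mf f0 k0; rewrite ge0_intD// int_cst. Qed.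

End nonnegative_integrals.

Section coupling.
Context {R : realType} d (W : measurableType d) (P : probability W R) (B : probability R R).
Let Pr : probability (W * R)%type R := (P \x B)%E.
Variables (Rm : W * R -> R) (mu s2 : R).
Hypothesis mRm : measurable_fun setT Rm.
Hypothesis B01 : {ae B, forall u : R, 0 < u < 1}.
Hypothesis B1 : L1 B (fun u => u - mu) /\ mean B (fun u => u - mu) = 0.
Hypothesis B2 : L1 B (fun u => (u - mu) ^+ 2) /\ mean B (fun u => (u - mu) ^+ 2) = s2.

(** The bound is integrated first in [u], for a fixed training set, and then over
    the training sets. The moments [a] and [b] are extended-real, which covers the
    training sets for which they are infinite. *)
Lemma remainder_integral_le (a b : W -> \bar R) (V : R -> R) (c eta C CV CW Ea Eb : R) :
  measurable_fun setT a -> measurable_fun setT b -> measurable_fun setT V ->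
  (forall w, 0 <= a w)%E -> (forall w, 0 <= b w)%E -> (forall u, 0 <= V u) ->
  0 <= eta -> 0 <= C -> 0 <= CV ->
  (\int[B]_u (V u)%:E <= CV%:E)%E ->
  (\int[B]_u ((V u)%:E * ((u - c) ^+ 4)%:E) <= CW%:E)%E ->
  (\int[P]_w a w <= Ea%:E)%E -> (\int[P]_w b w <= Eb%:E)%E ->
  (forall w u, 0 < u < 1 -> (`|Rm (w, u)|%:E <=
     eta%:E * (a w + ((u - mu) ^+ 2)%:E) + (C * V u)%:E * (b w + ((u - c) ^+ 4)%:E))%E) ->
  L1 Pr Rm /\ mean Pr (fun z => `|Rm z|) <= eta * (Ea + s2) + C * (CV * Eb + CW).
Proof.
move=> ma mb mV a0 b0 V0 eta0 C0 CV0 hV hW ha hb bound.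
have mN : measurable_fun setT (fun z => `|Rm z|%:E).
  by apply/measurable_EFinP; exact: measurableT_comp.
have main : (\int[Pr]_z `|Rm z|%:E <= (eta * (Ea + s2) + C * (CV * Eb + CW))%:E)%E.
  rewrite [leLHS](@fubini_tonelli1 _ _ _ _ _ P B _ mN)//.
  have mX : measurable_fun setT (fun u : R => ((u - mu) ^+ 2)%:E).
    by apply/measurable_EFinP; apply: measurable_funX; exact: measurable_funB.
  have mY : measurable_fun setT (fun u : R => ((u - c) ^+ 4)%:E).
    by apply/measurable_EFinP; apply: measurable_funX; exact: measurable_funB.
  have mVE : measurable_fun setT (fun u : R => (V u)%:E) by exact/measurable_EFinP.
  have X0 u : (0 <= ((u - mu) ^+ 2)%:E :> \bar R)%E by rewrite lee_fin sqr_ge0.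
  have Y0 u : (0 <= ((u - c) ^+ 4)%:E :> \bar R)%E by rewrite lee_fin exprn_even_ge0.
  have VE0 u : (0 <= (V u)%:E)%E by rewrite lee_fin.
  have VY0 u : (0 <= (V u)%:E * ((u - c) ^+ 4)%:E)%E by rewrite mule_ge0.
  have mVY : measurable_fun setT (fun u : R => (V u)%:E * ((u - c) ^+ 4)%:E)%E by exact: emeasurable_funM.
  have s20 : 0 <= s2 by rewrite -B2.2; apply: mean_ge0 => u; exact: sqr_ge0.
  have CW0 : 0 <= CW.
    by rewrite -lee_fin (le_trans _ hW)// integral_ge0.
  have iX : (\int[B]_u ((u - mu) ^+ 2)%:E = s2%:E)%E by rewrite (integral_mean B2.1) B2.2.
  have inner w : (\int[B]_u `|Rm (w, u)|%:E <=
      eta%:E * (a w + s2%:E) + C%:E * (CV%:E * b w + CW%:E))%E.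
    have mVb : measurable_fun setT (fun u : R => (V u)%:E * b w)%E by exact: emeasurable_funM.
    have Vb0 u : (0 <= (V u)%:E * b w)%E by rewrite mule_ge0.
    have m1 : measurable_fun setT (fun u : R => a w + ((u - mu) ^+ 2)%:E)%E by exact: emeasurable_funD.
    have p1 u : (0 <= a w + ((u - mu) ^+ 2)%:E)%E by rewrite adde_ge0.
    have m2 : measurable_fun setT (fun u : R => (V u)%:E * b w + (V u)%:E * ((u - c) ^+ 4)%:E)%E.
      exact: emeasurable_funD.
    have p2 u : (0 <= (V u)%:E * b w + (V u)%:E * ((u - c) ^+ 4)%:E)%E by rewrite adde_ge0.
    have m3 : measurable_fun setT (fun u : R => eta%:E * (a w + ((u - mu) ^+ 2)%:E))%E by exact: measurable_funeM.
    have m4 : measurable_fun setT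
      (fun u : R => C%:E * ((V u)%:E * b w + (V u)%:E * ((u - c) ^+ 4)%:E))%E by exact: measurable_funeM.
    have p3 u : (0 <= eta%:E * (a w + ((u - mu) ^+ 2)%:E))%E by rewrite mule_ge0// lee_fin.
    have p4 u : (0 <= C%:E * ((V u)%:E * b w + (V u)%:E * ((u - c) ^+ 4)%:E))%E by rewrite mule_ge0// lee_fin.
    apply: (@le_trans _ _ (\int[B]_u (eta%:E * (a w + ((u - mu) ^+ 2)%:E)
        + C%:E * ((V u)%:E * b w + (V u)%:E * ((u - c) ^+ 4)%:E)))%E).
      apply: ae_ge0_le_integral => //.
      - exact: (measurableT_comp mN (pair1_measurable w)).
      - by move=> u _; rewrite adde_ge0.
      - exact: emeasurable_funD.
      apply: filterS B01 => u u01 _; apply: (le_trans (bound w u u01)).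
      rewrite leeD2l// (EFinM C (V u)) -muleA lee_wpmul2l ?lee_fin//.
      by rewrite ge0_muleDr.
    rewrite (ge0_intD B m3 m4 p3 p4) (ge0_intZ B m1 p1 eta0) (ge0_intZ B m2 p2 C0).
    rewrite (ge0_intD B _ mX _ X0)// int_cst iX (ge0_intD B mVb mVY Vb0 VY0).
    rewrite ge0_integralZr//.
    by rewrite leeD2l// lee_wpmul2l ?lee_fin// leeD// lee_wpmul2r.
  have mb' : measurable_fun setT (fun w => CV%:E * b w)%E by exact: measurable_funeM.
  have b'0 w : (0 <= CV%:E * b w)%E by rewrite mule_ge0// lee_fin.
  have ma1 : measurable_fun setT (fun w => a w + s2%:E)%E by exact: emeasurable_funD.
  have mb1 : measurable_fun setT (fun w => CV%:E * b w + CW%:E)%E by exact: emeasurable_funD.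
  have a10 w : (0 <= a w + s2%:E)%E by rewrite adde_ge0// lee_fin.
  have b10 w : (0 <= CV%:E * b w + CW%:E)%E by rewrite adde_ge0// lee_fin.
  have ma2 : measurable_fun setT (fun w => eta%:E * (a w + s2%:E))%E by exact: measurable_funeM.
  have mb2 : measurable_fun setT (fun w => C%:E * (CV%:E * b w + CW%:E))%E by exact: measurable_funeM.
  have a20 w : (0 <= eta%:E * (a w + s2%:E))%E by rewrite mule_ge0// lee_fin.
  have b20 w : (0 <= C%:E * (CV%:E * b w + CW%:E))%E by rewrite mule_ge0// lee_fin.
  apply: (@le_trans _ _ (\int[P]_w (eta%:E * (a w + s2%:E) + C%:E * (CV%:E * b w + CW%:E)))%E).
    apply: ge0_le_integral => //.
    - by move=> w _; apply: integral_ge0 => u _; rewrite lee_fin.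
    - by apply: measurable_fun_fubini_tonelli_F => // z; rewrite lee_fin.
    - exact: emeasurable_funD.
    - by move=> w _; exact: inner.
  have E1 := ge0_intD P ma2 mb2 a20 b20.
  have E2 := ge0_intZ P ma1 a10 eta0; have E3 := ge0_intZ P mb1 b10 C0.
  have E4 := ge0_int_affine P ma a0 s20; have E5 := ge0_int_affine P mb' b'0 CW0.
  have E6 := ge0_intZ P mb b0 CV0.
  rewrite /= in E1 E2 E3 E4 E5 E6.
  rewrite [leLHS]E1 E2 E3 E4 E5 E6.
  rewrite (EFinD (eta * _)); apply: leeD.
    by rewrite EFinM EFinD lee_wpmul2l ?lee_fin// leeD2r.
  rewrite EFinM EFinD EFinM lee_wpmul2l ?lee_fin// leeD2r//.
  by rewrite lee_wpmul2l ?lee_fin.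
have fin : (\int[Pr]_z `|Rm z|%:E < +oo)%E by rewrite (le_lt_trans main)// ltry.
have IR : L1 Pr Rm.
  by apply/integrableP; split; [exact/measurable_EFinP|exact: fin].
split=> //; by rewrite -lee_fin -integral_mean//; exact: L1_norm.
Qed.

Lemma coupled_mean (q : W * R -> R) (m : W -> R) (f0 f1 f2 h : R) :
  (forall z, q z = f0 + f1 * (z.2 - mu) + f2 * (z.2 - mu) ^+ 2 + h * m z.1 + Rm z) ->
  L1 P m -> L1 Pr Rm ->
  L1 Pr q /\ mean Pr q = f0 + f2 * s2 + h * mean P m + mean Pr Rm.
Proof.
move=> /funext -> Im IR.
have [I1 E1] := L1_snd P B1.1; have [I2 E2] := L1_snd P B2.1; have [I3 E3] := L1_fst B Im.
have J0 := L1_cst Pr f0.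
have J1 := L1_D J0 (L1_Z f1 I1); have J2 := L1_D J1 (L1_Z f2 I2); have J3 := L1_D J2 (L1_Z h I3).
split; first exact: L1_D J3 IR.
rewrite (mean_D J3 IR) (mean_D J2 (L1_Z h I3)) (mean_D J1 (L1_Z f2 I2)) (mean_D J0 (L1_Z f1 I1)).
rewrite mean_cst (mean_Z f1 I1) (mean_Z f2 I2) (mean_Z h I3) E1 E2 E3 B1.2 B2.2.
by ring.
Qed.

(** The leading terms are independent, so their variances add up. *)
Lemma coupled_variance (q : W * R -> R) (m : W -> R) (f0 f1 h t : R) : 0 < t ->
  (forall z, q z = f0 + f1 * (z.2 - mu) + h * m z.1 + Rm z) ->
  measurable_fun setT m -> L1 P (fun w => m w ^+ 2) -> L1 Pr (fun z => Rm z ^+ 2) ->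
  let Vm := mean P (fun w => (m w - mean P m) ^+ 2) in
  [/\ L1 Pr q, L1 Pr (fun z => (q z - mean Pr q) ^+ 2) &
    `|mean Pr (fun z => (q z - mean Pr q) ^+ 2) - (f1 ^+ 2 * s2 + h ^+ 2 * Vm)|
     <= t * (f1 ^+ 2 * s2 + h ^+ 2 * Vm) + (1 + t^-1) * mean Pr (fun z => Rm z ^+ 2)].
Proof.
move=> t0 qE mm Im2 IR2 Vm.
have Im := L1_of_sqr mm Im2; have IR := L1_of_sqr mRm IR2.
have [] := @coupled_mean q m f0 f1 0 h _ Im IR.
  by move=> z; rewrite qE mul0r addr0.
rewrite mul0r addr0 => Iq Eq.
pose m' w := m w - mean P m.
have mm' : measurable_fun setT m' by exact: measurable_funB.
have Im' : L1 P (fun w => m' w ^+ 2) by exact: L1_sqr_center.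
pose A z : R := f1 * (z.2 - mu) + h * m' z.1.
have mu2 : measurable_fun setT (fun z : W * R => z.2 - mu) by exact: measurable_funB.
have mm1 : measurable_fun setT (fun z : W * R => m' z.1) by exact: measurableT_comp.
have mA : measurable_fun setT A.
  by apply: measurable_funD; apply: measurable_funM.
have [I2 E2] := L1_snd P B2.1; have [I3 E3] := L1_fst B Im'.
have Icross : L1 Pr (fun z => m' z.1 * (z.2 - mu)) by exact: L1_mul.
have Ecross := mean_prod_centered B1.1 B1.2 Icross.
have A2E : (fun z => A z ^+ 2) = fun z => f1 ^+ 2 * (z.2 - mu) ^+ 2 +
    (2 * f1 * h) * (m' z.1 * (z.2 - mu)) + h ^+ 2 * m' z.1 ^+ 2.
  by apply/funext => z; rewrite /A; ring.
have J1 := L1_D (L1_Z (f1 ^+ 2) I2) (L1_Z (2 * f1 * h) Icross).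
have IA : L1 Pr (fun z => A z ^+ 2) by rewrite A2E; exact: L1_D J1 (L1_Z (h ^+ 2) I3).
have EA : mean Pr (fun z => A z ^+ 2) = f1 ^+ 2 * s2 + h ^+ 2 * Vm.
  rewrite A2E (mean_D J1 (L1_Z (h ^+ 2) I3)) (mean_D (L1_Z (f1 ^+ 2) I2) (L1_Z (2 * f1 * h) Icross)).
  rewrite (mean_Z _ I2) (mean_Z _ Icross) (mean_Z _ I3) Ecross E2 E3 B2.2.
  by rewrite mulr0 addr0.
pose R' z := Rm z - mean Pr Rm.
have mR' : measurable_fun setT R' by exact: measurable_funB.
have IR' : L1 Pr (fun z => R' z ^+ 2) by exact: L1_sqr_center.
have qE' : (fun z => (q z - mean Pr q) ^+ 2) = (fun z => (A z + R' z) ^+ 2).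
  by apply/funext => z; rewrite Eq qE /A /R' /m'; ring.
rewrite qE' -EA; have [H1 H2] := mean_sqr_perturb t0 mA mR' IA IR'.
split=> //; apply: (le_trans H2); rewrite lerD2l ler_wpM2l//.
  by rewrite addr_ge0// invr_ge0 ltW.
exact: mean_sqr_center_le.
Qed.

End coupling.

(** * Mean and variance of the length at fixed sample sizes *)

Section fixed_sizes.
Context {R : realType} d (T : measurableType d) d' (W : measurableType d')
  (P : probability W R) (PX : probability T R) (Q : probability R R)
  (f : T -> R) (mf : measurable_fun [set: T] f)
  (X : nat -> {RV P >-> T}) (e : nat -> {RV P >-> R})
  (iidXe : iid_sample PX Q X e)
  (fhat : estimator R T) (mfhat : measurable_estimator fhat)
  (s : splitting) (alpha : R).
Local Notation Z := (obs f X e).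

Definition risk (r n : nat) : \bar R :=
  (\int[P]_w \int[PX]_x (`|fhat [tuple Z i w | i < n] x - f x| ^+ r)%:E)%E.

Variables n1 n2 : nat.
Let m := m_alpha alpha n2.
Hypothesis m0 : (0 < m)%N.
Hypothesis mn : (m <= n2)%N.

Let D (w : W) : n1.-tuple (T * R)%type := tup (noise_pair X e) (1%g : {perm 'I_n1}) w.
Let g (w : W) : T -> R := est_error f fhat (D w).
Let B : probability R R := betaP m.-1 (n2 - m).
Let Pr : probability (W * R)%type R := (P \x B)%E.
Let q := coupled_q PX Q f X e fhat n1.
Let mu := mu_alpha alpha n2.
Let s2 := sigma2_alpha alpha n2.
Local Notation phi := (quantile (F_abs Q)).
Local Notation mom r w := (mean PX (fun x => g w x ^+ r)).

Let mg w : measurable_fun setT (g w).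
Proof. exact: measurable_est_error1. Qed.

Let mD : measurable_fun setT D. Proof. exact: measurable_tup. Qed.

Let emom (r : nat) (w : W) : \bar R := (\int[PX]_x (`|g w x| ^+ r)%:E)%E.

Let mgr w (r : nat) : measurable_fun setT (fun x => `|g w x| ^+ r).
Proof. by apply: measurable_funX; exact: measurableT_comp. Qed.

Let emom_ge0 r w : (0 <= emom r w)%E.
Proof. by apply: integral_ge0 => x _; rewrite lee_fin exprn_ge0. Qed.

Let memom r : measurable_fun setT (emom r).
Proof.
apply: (@measurableT_comp _ _ _ _ _ _ (fun y : n1.-tuple (T * R)%type =>
  \int[PX]_x (`|est_error f fhat y x| ^+ r)%:E)%E _ D) => //.
have mh : measurable_fun setT (fun z : n1.-tuple (T * R)%type * T =>
    (`|est_error f fhat z.1 z.2| ^+ r)%:E).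
  apply/measurable_EFinP; apply: measurable_funX; apply: measurableT_comp => //.
  exact: measurable_est_error.
have hp : measurable_fun setT (fubini_F PX (fun z : n1.-tuple (T * R)%type * T =>
    (`|est_error f fhat z.1 z.2| ^+ r)%:E)).
  by apply: measurable_fun_fubini_tonelli_F => [|z]; [exact: mh|rewrite lee_fin exprn_ge0].
exact: hp.
Qed.

Let emom_risk r : (\int[P]_w emom r w = risk r n1)%E.
Proof.
apply: eq_integral => w _; apply: eq_integral => x _.
by rewrite /g training_first_obs.
Qed.

Let emom_fin r w : (emom r w < +oo)%E -> L1 PX (fun x => `|g w x| ^+ r).
Proof.
move=> h; apply/integrableP; split; first exact/measurable_EFinP.
by under eq_integral do rewrite /= normrX normr_id.
Qed.

Let emomE r w : L1 PX (fun x => `|g w x| ^+ r) -> emom r w = (mean PX (fun x => `|g w x| ^+ r))%:E.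
Proof. by move=> h; rewrite -integral_mean. Qed.

Let mmom r : measurable_fun setT (fun w => mom r w).
Proof. exact: (measurableT_comp (measurable_error_moment PX mf mfhat (n1 := n1) r) mD). Qed.

Let mom_le r w : (`|mom r w|%:E <= emom r w)%E.
Proof.
have := emom_ge0 r w; case E : (emom r w) => [a| |] //; last by move=> _; rewrite leey.
have fin : (emom r w < +oo)%E by rewrite E ltry.
have I := emom_fin fin.
rewrite -E (emomE I) lee_fin => _; apply: (norm_mean_le _ _ I); first exact: measurable_funX.
by move=> x; rewrite normrX.
Qed.

Let sqr_mom_le r w : ((mom r w ^+ 2)%:E <= emom r.*2 w)%E.
Proof.
have := emom_ge0 r.*2 w; case E : (emom r.*2 w) => [a| |] //; last by move=> _; rewrite leey.
have fin : (emom r.*2 w < +oo)%E by rewrite E ltry.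
have I := emom_fin fin.
rewrite -E (emomE I) lee_fin => _.
have mgw : measurable_fun setT (fun x => g w x ^+ r) by exact: measurable_funX.
have e2 : (fun x => `|g w x| ^+ r.*2) = (fun x => (g w x ^+ r) ^+ 2).
  by apply/funext => x; rewrite -muln2 exprM -normrX real_normK ?num_real.
rewrite e2 in I *; apply: sqr_mean_le => //.
exact: L1_of_sqr.
Qed.

Let beta_meanE : beta_mean m.-1 (n2 - m) = mu.
Proof.
rewrite /beta_mean /mu /mu_alpha prednK//; congr (_ / _%:R).
by move: m0 mn; rewrite -/m; move: m => a; lia.
Qed.

Let B1 : L1 B (fun u => u - mu) /\ mean B (fun u => u - mu) = 0.
Proof.
have [I E] := @integral_betaP_mean R m.-1 (n2 - m); rewrite beta_meanE in I E.
by split=> //; rewrite /mean /Rintegral [X in fine X]E.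
Qed.

Let B2 : L1 B (fun u => (u - mu) ^+ 2) /\ mean B (fun u => (u - mu) ^+ 2) = s2.
Proof.
have [I E] := @integral_betaP_variance R m.-1 (n2 - m); rewrite beta_meanE in I E.
split=> //; rewrite /mean /Rintegral [X in fine X]E /= /s2 /sigma2_alpha -/mu.
by congr (_ / _%:R); move: m0 mn; rewrite -/m; move: m => a; lia.
Qed.

Let V (J : nat) (u : R) := `|1 - u|^-1 ^+ J.

Let mV J : measurable_fun setT (V J).
Proof.
apply: measurable_funX.
rewrite (_ : (fun u => _) = fun u : R => `|1 - u| `^ (-1)); last first.
  by apply/funext => u; rewrite powR_inv1.
apply: (@measurableT_comp _ _ _ _ _ _ (fun y : R => y `^ (-1))); first exact: measurable_powR.
by apply: measurableT_comp => //; exact: measurable_funB.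
Qed.

Let V0 J u : 0 <= V J u. Proof. by rewrite exprn_ge0// invr_ge0. Qed.

Let mq : measurable_fun setT q. Proof. exact: measurable_coupled_q. Qed.

Let law_q (A : set R) : measurable A -> P (qhat alpha fhat Z s n1 n2 @^-1` A) = Pr (q @^-1` A).
Proof. exact: (law_qhat mf iidXe mfhat s n1 m0 mn). Qed.

Let law_E1 r (A : set R) : measurable A ->
  P (E1_error PX f fhat Z s r n1 n2 @^-1` A) = P ((fun w => mom r w) @^-1` A).
Proof. exact: (law_E1_error mf iidXe mfhat s n1 n2 r). Qed.

Let coupled_qE w u : 0 < u < 1 -> q (w, u) = quantile (err_cdf PX Q (g w)) u.
Proof. by move=> u01; rewrite /q /coupled_q /= u01. Qed.

(* Where the [k]-th moment is infinite the bound is [+oo], provided that its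
   coefficient is positive: hence [C + 1]. *)
Let bound_ext (x : R) (p k J : nat) (eta C c : R) (w : W) (u : R) : 0 <= eta -> 0 <= C ->
  (p <= k)%N -> 0 < u < 1 ->
  (L1 PX (fun x => `|g w x| ^+ k) -> x <= eta * (mean PX (fun x => `|g w x| ^+ p) + (u - mu) ^+ 2)
     + C * V J u * (mean PX (fun x => `|g w x| ^+ k) + (u - c) ^+ 4)) ->
  (x%:E <= eta%:E * (emom p w + ((u - mu) ^+ 2)%:E)
     + ((C + 1) * V J u)%:E * (emom k w + ((u - c) ^+ 4)%:E))%E.
Proof.
move=> eta0 C0 pk u01 h.
have x4 : 0 <= (u - c) ^+ 4 by rewrite exprn_even_ge0.
have := emom_ge0 k w; case E : (emom k w) => [a| |] // a0.
  have I : L1 PX (fun x => `|g w x| ^+ k) by apply: emom_fin; rewrite E ltry.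
  have Ip := L1_exp_le pk (mg w) I.
  rewrite -E (emomE I) (emomE Ip) -!EFinD lee_fin.
  apply: (le_trans (h I)); rewrite lerD2l ler_wpM2r//.
    by rewrite addr_ge0// mean_ge0// => y; rewrite exprn_ge0.
  by rewrite ler_wpM2r// lerDl.
rewrite addye// gt0_muley ?addey ?leey//.
  rewrite -ltNye; apply: lt_le_trans (ltNyr 0) _.
  by rewrite mule_ge0 ?lee_fin// adde_ge0// lee_fin sqr_ge0.
have u1 : 0 < `|1 - u| by rewrite normr_gt0 subr_eq0; case/andP: u01 => _ u1; rewrite gt_eqF.
by rewrite lte_fin mulr_gt0 ?exprn_gt0 ?invr_gt0// ltr_wpDl.
Qed.

Variables (c : R) (p k J : nat) (h : R -> R) (CV CW eta C Ek : R).
Hypothesis CV0 : 0 <= CV.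
Hypothesis hV : (\int[B]_u (V J u)%:E <= CV%:E)%E.
Hypothesis hW : (\int[B]_u ((V J u)%:E * ((u - c) ^+ 4)%:E) <= CW%:E)%E.
Hypothesis eta0 : 0 <= eta.
Hypothesis C0 : 0 <= C.
Hypothesis hEk : (risk k n1 <= Ek%:E)%E.

Let emom_risk_le r E : (risk r n1 <= E%:E)%E -> (\int[P]_w emom r w <= E%:E)%E.
Proof. by rewrite emom_risk. Qed.

Let Imom r E : (risk r n1 <= E%:E)%E -> L1 P (fun w => mom r w).
Proof.
move=> hE; apply/integrableP; split; first exact/measurable_EFinP.
apply: (@le_lt_trans _ _ E%:E); last exact: ltry.
apply: le_trans (emom_risk_le hE); apply: ge0_le_integral => //.
  by apply/measurable_EFinP; apply: measurableT_comp.
by move=> w _; exact: mom_le.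
Qed.

Lemma length_mean (Ep : R) : (p <= k)%N -> (risk p n1 <= Ep%:E)%E ->
  (forall w u, L1 PX (fun x => `|g w x| ^+ k) -> 0 < u < 1 ->
     `|quantile (err_cdf PX Q (g w)) u - phi mu - derive1 phi mu * (u - mu)
       - derive1 (derive1 phi) mu / 2 * (u - mu) ^+ 2 - h (phi mu) * mom p w|
    <= eta * (mean PX (fun x => `|g w x| ^+ p) + (u - mu) ^+ 2)
       + C * V J u * (mean PX (fun x => `|g w x| ^+ k) + (u - c) ^+ 4)) ->
  ('E_P[E1_error PX f fhat Z s p n1 n2] \is a fin_num)%E /\
  exists2 rem : R, `|rem| <= 2 * (eta * (Ep + s2) + (C + 1) * (CV * Ek + CW)) &
    ('E_P[split_length alpha fhat Z s n1 n2] =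
     (2 * phi mu)%:E + (2 * h (phi mu))%:E * 'E_P[E1_error PX f fhat Z s p n1 n2]
     + (s2 * derive1n 2 phi mu)%:E + rem%:E)%E.
Proof.
move=> pk hEp bound; have Im := Imom hEp.
have mE1 : measurable_fun setT (E1_error PX f fhat Z s p n1 n2) by exact: measurable_E1_error.
have mqh : measurable_fun setT (qhat alpha fhat Z s n1 n2) by exact: measurable_qhat.
rewrite (same_law_expectation mE1 (mmom p) (law_E1 p)) (expectation_mean Im); split=> //.
move: bound; rewrite [derive1n 2 phi mu]/=.
move: (phi mu) (derive1 phi mu) (derive1 (derive1 phi) mu) => f0 f1 f2 bound.
pose Rm z := q z - f0 - f1 * (z.2 - mu) - f2 / 2 * (z.2 - mu) ^+ 2 - h f0 * mom p z.1.
have mu2 : measurable_fun setT (fun z : W * R => z.2 - mu) by exact: measurable_funB.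
have mm1 : measurable_fun setT (fun z : W * R => mom p z.1).
  exact: (measurableT_comp (mmom p) measurable_fst).
have mRm : measurable_fun setT Rm.
  apply: measurable_funB; last exact: measurable_funM (measurable_cst _) mm1.
  apply: measurable_funB; last by apply: measurable_funM => //; exact: measurable_funX.
  by apply: measurable_funB; [exact: measurable_funB|exact: measurable_funM].
have C10 : 0 <= C + 1 by rewrite addr_ge0.
have [IR hR] := @remainder_integral_le _ _ W P B Rm mu s2 mRm (betaP_01 _ _) B2 (emom p) (emom k)
  (V J) c eta (C + 1) CV CW Ep Ek (memom p) (memom k) (mV J) (emom_ge0 p) (emom_ge0 k) (V0 J)
  eta0 C10 CV0 hV hW (emom_risk_le hEp) (emom_risk_le hEk)
  (fun w u u01 => bound_ext eta0 C0 pk u01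
     (fun I => eq_ind_r (fun y => `|y - f0 - f1 * (u - mu) - f2 / 2 * (u - mu) ^+ 2 - h f0 * mom p w| <= _)
        (bound w u I u01) (coupled_qE w u01))).
have [|Iq Eq] := @coupled_mean _ _ W P B Rm mu s2 B1 B2 q (fun w => mom p w) f0 f1 (f2 / 2) (h f0) _ Im IR.
  by move=> z; rewrite /Rm; ring.
exists (2 * mean Pr Rm).
  rewrite normrM ger0_norm// ler_pM2l//.
  by rewrite (le_trans (le_norm_mean IR)).
have Iqh := same_law_L1 mqh mq law_q Iq.
have -> : ('E_P[split_length alpha fhat Z s n1 n2] = (2 * mean P (qhat alpha fhat Z s n1 n2))%:E)%E.
  by rewrite -(mean_Z 2 Iqh) -(expectation_mean (L1_Z 2 Iqh)).
have -> : mean P (qhat alpha fhat Z s n1 n2) = mean Pr q.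
  by apply: EFin_inj; rewrite -!expectation_mean//; exact: same_law_expectation.
by rewrite Eq -EFinM -!EFinD; congr EFin; field.
Qed.

Lemma length_variance (E2p t B0 : R) : 0 < t -> (p.*2 <= k)%N -> (risk p.*2 n1 <= E2p%:E)%E ->
  `|derive1 phi mu| <= B0 -> `|h (phi mu)| <= B0 ->
  (forall w u, L1 PX (fun x => `|g w x| ^+ k) -> 0 < u < 1 ->
     (quantile (err_cdf PX Q (g w)) u - phi mu - derive1 phi mu * (u - mu)
        - h (phi mu) * mom p w) ^+ 2
    <= eta * (mean PX (fun x => `|g w x| ^+ p.*2) + (u - mu) ^+ 2)
       + C * V J u * (mean PX (fun x => `|g w x| ^+ k) + (u - c) ^+ 4)) ->
  ('V_P[E1_error PX f fhat Z s p n1 n2] \is a fin_num)%E /\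
  exists2 rem : R, `|rem| <= 4 * (t * (B0 ^+ 2 * (s2 + E2p))
        + (1 + t^-1) * (eta * (E2p + s2) + (C + 1) * (CV * Ek + CW))) &
    ('V_P[split_length alpha fhat Z s n1 n2] =
     (4 * h (phi mu) ^+ 2)%:E * 'V_P[E1_error PX f fhat Z s p n1 n2]
     + (4 * s2 * derive1 phi mu ^+ 2)%:E + rem%:E)%E.
Proof.
move=> t0 pk hEp b1 b2 bound.
have mE1 : measurable_fun setT (E1_error PX f fhat Z s p n1 n2) by exact: measurable_E1_error.
have mqh : measurable_fun setT (qhat alpha fhat Z s n1 n2) by exact: measurable_qhat.
move: b1 b2 bound; move: (phi mu) (derive1 phi mu) => f0 f1 b1 b2 bound.
have m2E : (\int[P]_w (mom p w ^+ 2)%:E <= E2p%:E)%E.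
  apply: le_trans (emom_risk_le hEp); apply: ge0_le_integral => //.
  - by move=> w _; rewrite lee_fin sqr_ge0.
  - by apply/measurable_EFinP; exact: measurable_funX.
have Im2 : L1 P (fun w => mom p w ^+ 2).
  apply/integrableP; split; first by apply/measurable_EFinP; exact: measurable_funX.
  apply: le_lt_trans (ltry E2p); apply: le_trans m2E.
  by under eq_integral do rewrite /= ger0_norm ?sqr_ge0//.
have Im := L1_of_sqr (mmom p) Im2.
have m2E' : mean P (fun w => mom p w ^+ 2) <= E2p by rewrite -lee_fin -integral_mean.
pose Vm := mean P (fun w => (mom p w - mean P (fun w => mom p w)) ^+ 2).
have Vm0 : 0 <= Vm by apply: mean_ge0 => w; exact: sqr_ge0.
have VmE : Vm <= E2p by apply: le_trans m2E'; exact: mean_sqr_center_le.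
have VE1 : ('V_P[E1_error PX f fhat Z s p n1 n2] = Vm%:E)%E.
  rewrite (same_law_variance mE1 (mmom p) (law_E1 p)) variance_mean//.
  exact: L1_sqr_center.
rewrite VE1; split=> //.
pose Rm z := q z - f0 - f1 * (z.2 - mu) - h f0 * mom p z.1.
have mu2 : measurable_fun setT (fun z : W * R => z.2 - mu) by exact: measurable_funB.
have mm1 : measurable_fun setT (fun z : W * R => mom p z.1).
  exact: (measurableT_comp (mmom p) measurable_fst).
have mRm : measurable_fun setT Rm.
  apply: measurable_funB; last exact: measurable_funM (measurable_cst _) mm1.
  by apply: measurable_funB; [exact: measurable_funB|exact: measurable_funM].
have mRm2 : measurable_fun setT (fun z => Rm z ^+ 2) by exact: measurable_funX.
have C10 : 0 <= C + 1 by rewrite addr_ge0.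
have bnd w u : 0 < u < 1 -> (`|Rm (w, u) ^+ 2|%:E <=
     eta%:E * (emom p.*2 w + ((u - mu) ^+ 2)%:E)
     + ((C + 1) * V J u)%:E * (emom k w + ((u - c) ^+ 4)%:E))%E.
  move=> u01; apply: bound_ext => // I; rewrite ger0_norm ?sqr_ge0// /Rm coupled_qE//=.
  exact: bound.
have [IR hR] := @remainder_integral_le _ _ W P B _ mu s2 mRm2 (betaP_01 _ _) B2 (emom p.*2) (emom k)
  (V J) c eta (C + 1) CV CW E2p Ek (memom _) (memom k) (mV J) (emom_ge0 _) (emom_ge0 k) (V0 J)
  eta0 C10 CV0 hV hW (emom_risk_le hEp) (emom_risk_le hEk) bnd.
have qE z : q z = f0 + f1 * (z.2 - mu) + h f0 * mom p z.1 + Rm z by rewrite /Rm; ring.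
have [Iq Iq2 main] := @coupled_variance _ _ W P B Rm mu s2 mRm B1 B2 q (fun w => mom p w) f0 f1 (h f0) t
  t0 qE (mmom p) Im2 IR.
rewrite -/Vm in main.
have Iqh := same_law_L1 mqh mq law_q Iq.
have Eqh : mean P (qhat alpha fhat Z s n1 n2) = mean Pr q.
  by apply: EFin_inj; rewrite -!expectation_mean//; exact: same_law_expectation.
have mq2 : measurable_fun setT (fun z => (2 * q z) : R) by exact: measurable_funM.
have m2L : measurable_fun setT (split_length alpha fhat Z s n1 n2) by exact: measurable_funM.
have law2 (A : set R) : measurable A ->
    P (split_length alpha fhat Z s n1 n2 @^-1` A) = Pr ((fun z => 2 * q z) @^-1` A).
  move=> mA; pose A' := (fun x : R => 2 * x) @^-1` A.
  have mA' : measurable A'.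
    have mf2 : measurable_fun setT (fun x : R => 2 * x) by exact: measurable_funM.
    by rewrite -[A']setTI; exact: mf2.
  exact: (law_q mA').
have V2E : (fun z => (2 * q z - mean Pr (fun z => 2 * q z)) ^+ 2) =
    (fun z => 4 * (q z - mean Pr q) ^+ 2).
  by apply/funext => z; rewrite (mean_Z 2 Iq); ring.
have I4 := L1_Z 4 Iq2.
have -> : ('V_P[split_length alpha fhat Z s n1 n2] = (4 * mean Pr (fun z => (q z - mean Pr q) ^+ 2))%:E)%E.
  rewrite (same_law_variance m2L mq2 law2) variance_mean ?V2E ?(mean_Z 4 Iq2)//.
  exact: L1_Z.
exists (4 * (mean Pr (fun z => (q z - mean Pr q) ^+ 2) - (f1 ^+ 2 * s2 + h f0 ^+ 2 * Vm))).
  rewrite normrM ger0_norm// ler_pM2l//; apply: (le_trans main).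
  have s20 : 0 <= s2 by rewrite -B2.2; apply: mean_ge0 => u; exact: sqr_ge0.
  have sqB (x : R) : `|x| <= B0 -> x ^+ 2 <= B0 ^+ 2.
    by move=> xB; rewrite -[leLHS]ger0_norm ?sqr_ge0// normrX lerXn2r ?nnegrE// (le_trans _ xB).
  rewrite lerD//.
    rewrite ler_wpM2l ?(ltW t0)// mulrDr lerD//.
      by rewrite ler_wpM2r// sqB.
    by rewrite ler_pM ?sqr_ge0// sqB.
  rewrite ler_wpM2l//; first by rewrite addr_ge0// invr_ge0 ltW.
  apply: le_trans hR; rewrite le_eqVlt; apply/orP; left; apply/eqP.
  by congr mean; apply/funext => z; rewrite ger0_norm ?sqr_ge0.
by rewrite -EFinM -!EFinD; congr EFin; ring.
Qed.

End fixed_sizes.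

(** * Rates, and the asymptotic expansions *)

Lemma near_natP (P : nat -> Prop) :
  (\forall n \near \oo, P n) -> exists N, forall n, (N <= n)%N -> P n.
Proof. by move=> [N _ h]; exists N => n Nn; exact: h. Qed.

Section rates.
Context {R : realType}.
Implicit Types (a b eps : R).

Lemma powR_eventually_le a b eps : a < b -> 0 < eps ->
  exists N, forall n, (N <= n)%N -> n%:R `^ (- b) <= eps * n%:R `^ (- a) :> R.
Proof.
move=> ab e0; have d0 : 0 < b - a by rewrite subr_gt0.
exists (Num.truncn (eps^-1 `^ (b - a)^-1)).+1 => n Nn.
have n0 : 0 < n%:R :> R by rewrite ltr0n (leq_trans _ Nn).
have -> : - b = - (b - a) + - a by ring.
rewrite powRD; last by rewrite (gt_eqF n0) implybT.
rewrite ler_wpM2r ?powR_ge0// powRN -[leRHS]invrK lef_pV2 ?posrE ?powR_gt0 ?invr_gt0//.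
have -> : eps^-1 = (eps^-1 `^ (b - a)^-1) `^ (b - a).
  by rewrite -powRrM mulVf ?gt_eqF// powRr1// invr_ge0 ltW.
rewrite ge0_ler_powR ?nnegrE ?powR_ge0 ?(ltW d0) ?(ltW n0)//.
have := @truncn_itv _ (eps^-1 `^ (b - a)^-1); rewrite powR_ge0 => /(_ isT)/andP[_ /ltW h].
by rewrite (le_trans h)// ler_nat.
Qed.

Lemma inv_eventually_le eps : 0 < eps ->
  exists N, forall n, (N <= n)%N -> n%:R^-1 <= eps :> R.
Proof.
move=> e0; exists (Num.truncn eps^-1).+1 => n Nn.
have n0 : 0 < n%:R :> R by rewrite ltr0n (leq_trans _ Nn).
rewrite -[leRHS]invrK lef_pV2 ?posrE ?invr_gt0//.
have := @truncn_itv _ eps^-1; rewrite invr_ge0 (ltW e0) => /(_ isT)/andP[_ /ltW h].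
by rewrite (le_trans h)// ler_nat.
Qed.

Lemma sigma2_alpha_le (alpha : R) n : (0 < n)%N -> sigma2_alpha alpha n <= n%:R^-1.
Proof.
move=> n0; rewrite /sigma2_alpha; move: (mu_alpha _ _) => x.
have h : x * (1 - x) <= 1 by have := sqr_ge0 (x - 2^-1); lra.
have n2 : 0 <= n.+2%:R^-1 :> R by rewrite invr_ge0.
rewrite (le_trans (ler_wpM2r n2 h))// mul1r lef_pV2 ?posrE ?ltr0n//.
by rewrite ler_nat -addn2 leq_addr.
Qed.

Lemma small_rates (C eps x y z : R) : 0 <= C -> 0 <= eps -> 0 <= x -> 0 <= z ->
  y <= eps * x -> z <= eps -> C * y + z * z <= (C + 1) * (eps * (x + z)).
Proof.
move=> C0 e0 x0 z0 yx ze.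
have h1 : C * y <= C * (eps * x) by rewrite ler_wpM2l.
have h2 : z * z <= eps * z by rewrite ler_wpM2r.
have h3 : 0 <= C * (eps * z) by rewrite !mulr_ge0.
have h4 : 0 <= eps * x by rewrite mulr_ge0.
have -> : (C + 1) * (eps * (x + z)) = C * (eps * x) + eps * z + (C * (eps * z) + eps * x) by ring.
by rewrite -[leLHS]addr0 !lerD// addr_ge0.
Qed.

Lemma scaled_rate_le (C s2 x z : R) : 0 <= C -> 0 <= x -> 0 <= z -> s2 <= z ->
  C * x + s2 <= (C + 1) * (x + z).
Proof.
move=> C0 x0 z0 sz; have -> : (C + 1) * (x + z) = (C * x + z) + (C * z + x) by ring.
by rewrite -[leLHS]addr0 !lerD// addr_ge0// mulr_ge0.
Qed.

End rates.

Section expansions.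
Context {R : realType} d (T : measurableType d) d' (W : measurableType d')
  (P : probability W R) (PX : probability T R) (Q : probability R R)
  (f : T -> R) (mf : measurable_fun [set: T] f)
  (X : nat -> {RV P >-> T}) (e : nat -> {RV P >-> R})
  (iidXe : iid_sample PX Q X e)
  (fhat : estimator R T) (mfhat : measurable_estimator fhat)
  (s : splitting) (alpha : R).
Hypothesis alpha01 : 0 < alpha < 1.
Local Notation Z := (obs f X e).
Local Notation L := (split_length alpha fhat Z s).
Local Notation Finv := (quantile (F_abs Q)).
Local Notation mu := (mu_alpha alpha).
Local Notation rk r n := (risk PX f X e fhat r n).
Variables (p k : nat) (h : R -> R).

Let risk_rate (r : nat) (b : R) := exists2 C : R, 0 < C &
  exists N, forall n, (N <= n)%N -> (rk r n <= (C * n%:R `^ (- b))%:E)%E.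

Let calibration_size (rho : R) (J : nat) : 0 < rho -> exists2 CV : R, 0 < CV & exists N, forall n2,
  (N <= n2)%N -> [/\ (0 < m_alpha alpha n2)%N && (m_alpha alpha n2 <= n2)%N, (0 < n2)%N,
    `|mu n2 - (1 - alpha)| < rho,
    (\int[betaP (m_alpha alpha n2).-1 (n2 - m_alpha alpha n2)]_u (`|1 - u|^-1 ^+ J)%:E <= CV%:E)%E &
    (\int[betaP (m_alpha alpha n2).-1 (n2 - m_alpha alpha n2)]_u
       ((`|1 - u|^-1 ^+ J)%:E * ((u - (1 - alpha)) ^+ 4)%:E) <= (CV / n2%:R ^+ 2)%:E)%E].
Proof.
move=> rho0; have [CV CV0 /near_natP[N1 h1]] := betaP_tail_bounds J alpha01.
have [N2 h2] := near_natP (m_alpha_room 0 alpha01).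
have rho20 : 0 < rho / 2 by rewrite divr_gt0.
have [N3 h3] := inv_eventually_le rho20.
exists CV => //; exists (maxn N1 (maxn N2 N3)) => n2.
rewrite !geq_max => /andP[a1 /andP[a2 a3]].
have [b1 b2] := h1 n2 a1.
have [c1 _ c2 _] := h2 n2 a2.
split=> //; first by rewrite m_alpha_gt0//= -[X in (X <= _)%N]addn0.
have /andP[m1 m2] := mu_alpha_dist n2 alpha01.
rewrite ger0_norm//; apply: (le_lt_trans m2).
apply: (@le_lt_trans _ _ (n2%:R^-1)); first by rewrite lef_pV2 ?posrE ?ltr0n// ler_nat.
by apply: (le_lt_trans (h3 n2 a3)); rewrite ltr_pdivrMr// ltr_pMr// ltr1n.
Qed.

(** The constant [e1] is chosen first, so that the terms of the exact order take
    half of the allowed error; it determines [C] and [J], and then the terms of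
    smaller order take the other half for large sizes. *)
Lemma expands_mean (b_p b_k : R) : (0 < p)%N -> (p < k)%N -> b_p < b_k ->
  risk_rate p b_p -> risk_rate k b_k -> second_order_at PX Q (1 - alpha) p k h ->
  expands (fun n1 n2 => 'E_P[L n1 n2])%E
    (fun n1 n2 => (2 * Finv (mu n2))%:E
       + (2 * h (Finv (mu n2)))%:E * 'E_P[E1_error PX f fhat Z s p n1 n2]
       + (sigma2_alpha alpha n2 * derive1n 2 Finv (mu n2))%:E)%E
    (fun n1 n2 => n1%:R `^ (- b_p) + n2%:R^-1).
Proof.
move=> p0 pk bpk [Cp Cp0 [Np hp]] [Ck Ck0 [Nk hk]] h2 eta eta0.
pose e1 := eta / (4 * (Cp + 1)).
have e10 : 0 < e1 by rewrite divr_gt0// mulr_gt0// addr_gt0.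
have [C [rho [J [C0 rho0 bound]]]] := h2 e1 e10.
have [CV CV0 [Nc hc]] := calibration_size J rho0.
pose e2 := eta / (4 * (C + 1) * CV * (Ck + 1)).
have C10 : 0 < C + 1 by rewrite ltr_wpDl.
have Ck10 : 0 < Ck + 1 by rewrite addr_gt0.
have e20 : 0 < e2 by rewrite divr_gt0// !mulr_gt0.
have [Ne he] := powR_eventually_le bpk e20.
have [Ni hi] := inv_eventually_le e20.
apply/near_nat2P; exists (maxn (maxn Np Nk) (maxn Nc (maxn Ne Ni))) => n1 n2.
rewrite !geq_max => /andP[/andP[a1 a2] /andP[_ /andP[a3 _]]].
move=> /andP[_ /andP[a4 /andP[_ a5]]].
have [/andP[m0 mn] n20 mur hV hW] := hc n2 a4.
have [fin [rem remle LE]] := @length_mean R d T d' W P PX Q f mf X e iidXe fhat mfhat s alpha n1 n2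
  m0 mn (1 - alpha) p k J h CV (CV / n2%:R ^+ 2) e1 C (Ck * n1%:R `^ (- b_k)) (ltW CV0) hV hW (ltW e10) C0
  (hk n1 a2) (Cp * n1%:R `^ (- b_p)) (ltnW pk) (hp n1 a1)
  (fun w u Ik u01 => bound _ u (mu n2) (measurable_est_error1 mf mfhat _) Ik u01 mur).
split; first by rewrite !fin_numD fin_numM.
exists rem => //; apply: (le_trans remle).
have n2i : 0 < n2%:R^-1 :> R by rewrite invr_gt0 ltr0n.
have := sigma2_alpha_le alpha n20; have := he n1 a3; have := hi n2 a5.
have -> : CV / n2%:R ^+ 2 = CV * (n2%:R^-1 * n2%:R^-1) by rewrite -exprVn expr2.
have := powR_ge0 (n1%:R : R) (- b_p); have := powR_ge0 (n1%:R : R) (- b_k).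
move: (n1%:R `^ (- b_p)) (n1%:R `^ (- b_k)) (n2%:R^-1) n2i (sigma2_alpha _ _) => x y z z0 s2 y0 x0 zle yle s2le.
have E1 : e1 * (Cp + 1) = eta / 4 by rewrite /e1; field; rewrite gt_eqF// addr_gt0.
have E2 : (C + 1) * CV * (Ck + 1) * e2 = eta / 4.
  by rewrite /e2; field; rewrite !gt_eqF.
clearbody e1 e2.
have F1 : e1 * (Cp * x + s2) <= eta / 4 * (x + z).
  by rewrite -E1 -mulrA ler_pM2l// scaled_rate_le// ltW.
have F2 : (C + 1) * (CV * (Ck * y) + CV * (z * z)) <= eta / 4 * (x + z).
  have G1 := small_rates (ltW Ck0) (ltW e20) x0 (ltW z0) yle zle.
  rewrite -E2; have -> : (C + 1) * (CV * (Ck * y) + CV * (z * z)) = (C + 1) * CV * (Ck * y + z * z) by ring.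
  have -> : (C + 1) * CV * (Ck + 1) * e2 * (x + z) = (C + 1) * CV * ((Ck + 1) * (e2 * (x + z))) by ring.
  by rewrite ler_pM2l// mulr_gt0.
move: F1 F2; have -> : eta / 4 * (x + z) = eta * (x + z) / 4 by ring.
by move: (eta * (x + z)) (e1 * _) ((C + 1) * _) => y1 y2 y3; lra.
Qed.

(** The same scheme, with the parameter [t] of [mean_sqr_perturb] chosen before
    [e1]. *)
Lemma expands_variance (b_p b_k : R) : (0 < p)%N -> (p.*2 < k)%N -> b_p < b_k ->
  risk_rate p.*2 b_p -> risk_rate k b_k -> first_order_at PX Q (1 - alpha) p k h ->
  (exists B r : R, [/\ 0 < B, 0 < r & forall u : R, `|u - (1 - alpha)| < r ->
     `|derive1 Finv u| <= B /\ `|h (Finv u)| <= B]) ->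
  expands (fun n1 n2 => 'V_P[L n1 n2])%E
    (fun n1 n2 => (4 * h (Finv (mu n2)) ^+ 2)%:E * 'V_P[E1_error PX f fhat Z s p n1 n2]
       + (4 * sigma2_alpha alpha n2 * (derive1 Finv (mu n2)) ^+ 2)%:E)%E
    (fun n1 n2 => n1%:R `^ (- b_p) + n2%:R^-1).
Proof.
move=> p0 pk bpk [Cp Cp0 [Np hp]] [Ck Ck0 [Nk hk]] h1 [B [r [B0 r0 hB]]] eta eta0.
pose t := eta / (16 * B ^+ 2 * (Cp + 1)).
have Cp10 : 0 < Cp + 1 by rewrite addr_gt0.
have B20 : 0 < B ^+ 2 by rewrite exprn_gt0.
have t0 : 0 < t by rewrite divr_gt0// !mulr_gt0.
pose t' := 1 + t^-1.
have t'0 : 0 < t' by rewrite addr_gt0// invr_gt0.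
pose e1 := eta / (16 * t' * (Cp + 1)).
have e10 : 0 < e1 by rewrite divr_gt0// !mulr_gt0.
have [C [rho [J [C0 rho0 bound]]]] := h1 e1 e10.
pose rho' := Num.min rho r.
have rho'0 : 0 < rho' by rewrite lt_min rho0.
have [CV CV0 [Nc hc]] := calibration_size J rho'0.
pose e2 := eta / (16 * t' * (C + 1) * CV * (Ck + 1)).
have C10 : 0 < C + 1 by rewrite ltr_wpDl.
have Ck10 : 0 < Ck + 1 by rewrite addr_gt0.
have e20 : 0 < e2 by rewrite divr_gt0// !mulr_gt0.
have [Ne he] := powR_eventually_le bpk e20.
have [Ni hi] := inv_eventually_le e20.
apply/near_nat2P; exists (maxn (maxn Np Nk) (maxn Nc (maxn Ne Ni))) => n1 n2.
rewrite !geq_max => /andP[/andP[a1 a2] /andP[_ /andP[a3 _]]].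
move=> /andP[_ /andP[a4 /andP[_ a5]]].
have [/andP[m0 mn] n20 + hV hW] := hc n2 a4.
rewrite lt_min => /andP[mur mur'].
have [B1 B2] := hB (mu n2) mur'.
have [fin [rem remle LE]] := @length_variance R d T d' W P PX Q f mf X e iidXe fhat mfhat s alpha n1 n2
  m0 mn (1 - alpha) p k J h CV (CV / n2%:R ^+ 2) e1 C (Ck * n1%:R `^ (- b_k)) (ltW CV0) hV hW (ltW e10) C0
  (hk n1 a2) (Cp * n1%:R `^ (- b_p)) t B t0 (ltnW pk) (hp n1 a1) B1 B2
  (fun w u Ik u01 => bound _ u (mu n2) (measurable_est_error1 mf mfhat _) Ik u01 mur).
split; first by rewrite !fin_numD fin_numM.
exists rem => //; apply: (le_trans remle); rewrite -/t'.
have n2i : 0 < n2%:R^-1 :> R by rewrite invr_gt0 ltr0n.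
have := sigma2_alpha_le alpha n20; have := he n1 a3; have := hi n2 a5.
have -> : CV / n2%:R ^+ 2 = CV * (n2%:R^-1 * n2%:R^-1) by rewrite -exprVn expr2.
have := powR_ge0 (n1%:R : R) (- b_p); have := powR_ge0 (n1%:R : R) (- b_k).
move: (n1%:R `^ (- b_p)) (n1%:R `^ (- b_k)) (n2%:R^-1) n2i (sigma2_alpha _ _) => x y z z0 s2 y0 x0 zle yle s2le.
have E0 : t * (B ^+ 2 * (Cp + 1)) = eta / 16 by rewrite /t; field; rewrite !gt_eqF.
have E1 : t' * (e1 * (Cp + 1)) = eta / 16 by rewrite /e1; field; rewrite !gt_eqF.
have E2 : t' * ((C + 1) * CV * (Ck + 1) * e2) = eta / 16.
  by rewrite /e2; field; rewrite !gt_eqF.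
clearbody t' e1 e2.
have G0 : s2 + Cp * x <= (Cp + 1) * (x + z).
  by rewrite addrC scaled_rate_le// ltW.
have F0 : t * (B ^+ 2 * (s2 + Cp * x)) <= eta / 16 * (x + z).
  rewrite -E0; have -> : t * (B ^+ 2 * (Cp + 1)) * (x + z) = t * (B ^+ 2 * ((Cp + 1) * (x + z))) by ring.
  by rewrite !ler_pM2l.
have F1 : t' * (e1 * (Cp * x + s2)) <= eta / 16 * (x + z).
  rewrite -E1; have -> : t' * (e1 * (Cp + 1)) * (x + z) = t' * (e1 * ((Cp + 1) * (x + z))) by ring.
  by rewrite !ler_pM2l// addrC.
have F2 : t' * ((C + 1) * (CV * (Ck * y) + CV * (z * z))) <= eta / 16 * (x + z).
  have G1 := small_rates (ltW Ck0) (ltW e20) x0 (ltW z0) yle zle.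
  rewrite -E2; have -> : (C + 1) * (CV * (Ck * y) + CV * (z * z)) = (C + 1) * CV * (Ck * y + z * z) by ring.
  have -> : t' * ((C + 1) * CV * (Ck + 1) * e2) * (x + z) =
    t' * ((C + 1) * CV * ((Ck + 1) * (e2 * (x + z)))) by ring.
  by rewrite !ler_pM2l// mulr_gt0.
rewrite (mulrDr t').
move: F0 F1 F2; have -> : eta / 16 * (x + z) = eta * (x + z) / 16 by ring.
have : 0 <= eta * (x + z) by rewrite mulr_ge0 ?addr_ge0// ltW.
by move: (eta * (x + z)) (t * _) (t' * (e1 * _)) (t' * ((C + 1) * _)) => y1 y2 y3 y4; lra.
Qed.

End expansions.

Theorem theorem3p1 (R : realType)
    (d : measure_display) (T : measurableType d)
    (d' : measure_display) (W : measurableType d') (P : probability W R)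
    (PX : probability T R) (Q : probability R R)
    (f : T -> R) (mf : measurable_fun [set: T] f)
    (X : nat -> {RV P >-> T}) (e : nat -> {RV P >-> R})
    (iidXe : iid_sample PX Q X e)
    (fhat : estimator R T) (mfhat : measurable_estimator fhat)
    (s : splitting)
    (K : nat) (beta : nat -> R) (delta beta_eps alpha : R)
    (hdelta : 0 < delta <= 1)
    (halpha : \forall n2 \near \oo,
       2 / n2%:R < beta_eps /\
       (beta_eps + 1) / (beta_eps * n2.+1%:R) <= alpha
         < 1 - 1 / (beta_eps * n2.+1%:R)) :
  let Z := obs f X e in
  let M := cond_M P PX f fhat Z K beta in
  let S r := cond_S Q delta alpha K beta r in
  let Tail := cond_T Q delta beta_eps in
  let L := split_length alpha fhat Z s in
  let E1 r := E1_error PX f fhat Z s r in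
  let Finv := quantile (F_abs Q) in
  let mu := mu_alpha alpha in
  let sigma2 := sigma2_alpha alpha in
  let rate b (n1 n2 : nat) : R := n1%:R `^ (- b) + n2%:R^-1 in
  ((M -> S 1%N -> Tail ->
      expands (fun n1 n2 => 'E_P[L n1 n2])%E
        (fun n1 n2 =>
           (2 * Finv (mu n2))%:E
           + (2 * H_abs Q (Finv (mu n2)))%:E * 'E_P[E1 1%N n1 n2]
           + (sigma2 n2 * derive1n 2 Finv (mu n2))%:E)%E
        (rate (beta 1%N))) /\
   (M -> S 2%N -> Tail ->
      expands (fun n1 n2 => 'V_P[L n1 n2])%E
        (fun n1 n2 =>
           (4 * H_abs Q (Finv (mu n2)) ^+ 2)%:E * 'V_P[E1 1%N n1 n2]
           + (4 * sigma2 n2 * (derive1 Finv (mu n2)) ^+ 2)%:E)%E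
        (rate (beta 2%N)))) /\
  (symmetric_law Q ->
   (M -> S 2%N -> Tail ->
      expands (fun n1 n2 => 'E_P[L n1 n2])%E
        (fun n1 n2 =>
           (2 * Finv (mu n2))%:E
           + (2 * G_eps Q (Finv (mu n2)))%:E * 'E_P[E1 2%N n1 n2]
           + (sigma2 n2 * derive1n 2 Finv (mu n2))%:E)%E
        (rate (beta 2%N))) /\
   (M -> S 4%N -> Tail ->
      expands (fun n1 n2 => 'V_P[L n1 n2])%E
        (fun n1 n2 =>
           (4 * G_eps Q (Finv (mu n2)) ^+ 2)%:E * 'V_P[E1 2%N n1 n2]
           + (4 * sigma2 n2 * (derive1 Finv (mu n2)) ^+ 2)%:E)%E
        (rate (beta 4%N)))).
Proof.
cbv zeta.
have alpha01 : 0 < alpha < 1.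
  have [N hN] := near_natP halpha.
  have [h1 /andP[h2 h3]] := hN N.+1 (leqnSn _).
  have b0 : 0 < beta_eps by apply: le_lt_trans h1; rewrite divr_ge0.
  apply/andP; split; first by apply: lt_le_trans h2; rewrite divr_gt0 ?mulr_gt0// addr_gt0.
  by apply: (lt_trans h3); rewrite ltrBlDr ltrDl divr_gt0// mulr_gt0.
have c01 : 0 < 1 - alpha < 1 by case/andP: alpha01 => ? ?; apply/andP; split; lra.
pose risk_rate (r : nat) (b : R) := exists2 C : R, 0 < C &
  exists N, forall n, (N <= n)%N -> (risk PX f X e fhat r n <= (C * n%:R `^ (- b))%:E)%E.
have rates : cond_M P PX f fhat (obs f X e) K beta -> forall r, (1 <= r <= K)%N -> risk_rate r (beta r).
  move=> [_ _ _ hM] r /hM[[C /near_natP[N hN]] _].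
  exists (Num.max C 1); first by rewrite lt_max ltr01 orbT.
  exists N => n /hN h; apply: (le_trans h); rewrite lee_fin ler_wpM2r ?powR_ge0//.
  by rewrite le_max lexx.
split; [split|move=> sQ; split] => M S0 T0.
- have [k [rk kK bk [rho reg]]] := cond_S_regular hdelta alpha01 S0.
  apply: (expands_mean mf iidXe mfhat s alpha01 (k := k) (b_k := beta k)) => //.
  + by apply: (rates M); rewrite /= (leq_trans _ kK)// ltnW.
  + by apply: (rates M); rewrite kK andbT (leq_ltn_trans _ rk).
  + exact (second_order_expansion PX c01 reg T0 (H_abs_coefficient reg) isT rk).
- have [k [rk kK bk [rho reg]]] := cond_S_regular hdelta alpha01 S0.
  apply: (expands_variance mf iidXe mfhat s alpha01 (p := 1) (k := k) (b_k := beta k)) => //.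
  + by apply: (rates M); rewrite /= (leq_trans _ kK)// ltnW.
  + by apply: (rates M); rewrite kK andbT (leq_ltn_trans _ rk).
  + exact (first_order_expansion PX c01 reg T0 (H_abs_coefficient reg) isT rk).
  + exact: (coefficients_bounded c01 reg (H_abs_coefficient reg)).
- have [k [rk kK bk [rho reg]]] := cond_S_regular hdelta alpha01 S0.
  apply: (expands_mean mf iidXe mfhat s alpha01 (k := k) (b_k := beta k)) => //.
  + by apply: (rates M); rewrite /= (leq_trans _ kK)// ltnW.
  + by apply: (rates M); rewrite kK andbT (leq_ltn_trans _ rk).
  + exact (second_order_expansion PX c01 reg T0 (G_eps_coefficient reg sQ) isT rk).
- have [k [rk kK bk [rho reg]]] := cond_S_regular hdelta alpha01 S0.
  apply: (expands_variance mf iidXe mfhat s alpha01 (p := 2) (k := k) (b_k := beta k)) => //.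
  + by apply: (rates M); rewrite /= (leq_trans _ kK)// ltnW.
  + by apply: (rates M); rewrite kK andbT (leq_ltn_trans _ rk).
  + exact (first_order_expansion PX c01 reg T0 (G_eps_coefficient reg sQ) isT rk).
  + exact: (coefficients_bounded c01 reg (G_eps_coefficient reg sQ)).
Qed.
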